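(* Let $I_{\mathcal{X}_0}\subseteq S=K[\{w_{N,\mu}:(N,\mu)\in A\}]$ be the canonical ideal of the special fibre $\mathcal{X}_0: X^p-X=x^\ell/a(x)^p$, and let $G_1^{\overline{\mathbf{c}}},G_2^{\overline{\mathbf{c}}}\subseteq S$ be the explicit sets of quadratic polynomials described in the context. Then $$I_{\mathcal{X}_0}=\langle G_1^{\overline{\mathbf{c}}}\cup G_2^{\overline{\mathbf{c}}}\rangle .$$
   Context: Setting. Let $k$ be an algebraically closed field of characteristic $p>0$. Let $m\ge 1$ be an integer not divisible by $p$, and write $m=pq-\ell$ with $1\le \ell\le p-1$. Put $K=\mathrm{Quot}(k[[x_1,\dots,x_q]])$ if $\ell=1$ and $K=\mathrm{Quot}(k[[x_1,\dots,x_{q-1}]])$ if $\ell\ne1$, and $$a(x)=x^q+x_1x^{q-1}+\cdots+x_{q-1}x+x_q\ \ (\ell=1),\qquad a(x)=x^q+x_1x^{q-1}+\cdots+x_{q-1}x\ \ (\ell\neq1).$$ $\mathcal{X}_0$ is the non-singular projective curve over $K$ with affine model $X^p-X=x^\ell/a(x)^p$, assumed (geometrically) of genus $g\geq 3$, non-hyperelliptic, not trigonal and not a plane quintic. Index set: $A=\{(N,\mu)\in\mathbb{N}^2:\lfloor\mu\ell/p\rfloor\le N\le\mu q-2,\ 1\le\mu\le p-1\}$; $|A|=g$. The set $\overline{\mathbf{c}}=\Big\{\dfrac{x^Na(x)^{p-1-\mu}X^{p-1-\mu}}{a(x)^{p-1}}dx:(N,\mu)\in A\Big\}$ is a basis of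 $H^0(\mathcal{X}_0,\Omega_{\mathcal{X}_0})$. $I_{\mathcal{X}_0}$ is the kernel of the graded $K$-algebra homomorphism $\phi_{0,\overline{\mathbf{c}}}:S\to\bigoplus_{n\ge0}H^0(\mathcal{X}_0,\Omega^{\otimes n}_{\mathcal{X}_0})$ sending $w_{N,\mu}$ to the basis element indexed by $(N,\mu)$. Multidegree: $\mathrm{mdeg}(w_{N_1,\mu_1}\cdots w_{N_d,\mu_d})=(d,\sum N_i,\sum\mu_i)$; $\mathbb{T}^2$ is the set of degree $2$ monomials of $S$. $G_1^{\overline{\mathbf{c}}}$: all $w_{N_1,\mu_1}w_{N'_1,\mu'_1}-w_{N_2,\mu_2}w_{N'_2,\mu'_2}$ with both monomials in $\mathbb{T}^2$ of the same multidegree. Let $j_{\min}(1)=0$ if $\ell=1$ and $j_{\min}(1)=p-1$ if $\ell\ne1$, and let $c_{j,p-1}$ be the coefficient of $x^j$ in $a(x)^{p-1}=\sum_{j=j_{\min}(1)}^{(p-1)q}c_{j,p-1}x^j$. $G_2^{\overline{\mathbf{c}}}$: all polynomials $$w_{N,\mu}w_{N',\mu'}-w_{N'',\mu''}w_{N''',\mu'''}-\sum_{j=j_{\min}(1)}^{(p-1)q}c_{j,p-1}w_{N_j,\mu_j}w_{N'_j,\mu'_j}$$ with monomials in $\mathbb{T}^2$ such that $\mathrm{mdeg}(w_{N'',\mu''}w_{N''',\mu'''})=\mathrm{mdeg}(w_{N,\mu}w_{N',\mu'})+(0,\ell,p)$ and $\mathrm{mdeg}(w_{N_j,\mu_j}w_{N'_j,\mu'_j})=\mathrm{mdeg}(w_{N,\mu}w_{N',\mu'})+(0,j,p-1)$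 for all $j_{\min}(1)\le j\le(p-1)q$. *)

(* Defs.v *)
From HB Require Import structures.
From mathcomp Require Import all_boot all_order all_algebra.
From mathcomp Require Import boolp mpoly.

Set Implicit Arguments.
Unset Strict Implicit.
Unset Printing Implicit Defensive.

Import GRing.Theory.
Local Open Scope ring_scope.

(* [mpseries n R] is R[[x_1, ..., x_n]], a series being given by its
   coefficients.  For a domain R it is again a domain, so that
   [{fraction mpseries n R}] is its quotient field. *)
Record mpseries (n : nat) (R : Type) :=
  MPSeries { pscoef : 'X_{1..n} -> R }.

HB.instance Definition _ n R := gen_eqMixin (mpseries n R).
HB.instance Definition _ n R := gen_choiceMixin (mpseries n R).

Section PowerSeries.
Variables (n : nat) (R : idomainType).
Implicit Types (f g h : mpseries n R) (P Q : {mpoly R[n]}).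

Definition ps0 : mpseries n R := MPSeries (fun=> 0).
Definition ps1 : mpseries n R := MPSeries (fun m => (m == 0%MM)%:R).
Definition psX (i : 'I_n) : mpseries n R := MPSeries (fun m => (m == U_(i)%MM)%:R).
Definition psopp f : mpseries n R := MPSeries (fun m => - pscoef f m).
Definition psadd f g : mpseries n R :=
  MPSeries (fun m => pscoef f m + pscoef g m).
Definition psmul f g : mpseries n R :=
  MPSeries (fun m =>
    \sum_(u : 'X_{1..n < (mdeg m).+1, (mdeg m).+1} | m == (u.1 + u.2)%MM)
       pscoef f u.1 * pscoef g u.2).

Lemma psP f g : (forall m, pscoef f m = pscoef g m) -> f = g.
Proof. by case: f => f; case: g => g /= fg; congr MPSeries; apply: funext. Qed.

Fact psaddA : associative psadd.
Proof. by move=> f g h; apply: psP => m /=; rewrite addrA. Qed.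
Fact psaddC : commutative psadd.
Proof. by move=> f g; apply: psP => m /=; rewrite addrC. Qed.
Fact psadd0 : left_id ps0 psadd.
Proof. by move=> f; apply: psP => m /=; rewrite add0r. Qed.
Fact psaddN : left_inverse ps0 psopp psadd.
Proof. by move=> f; apply: psP => m /=; rewrite addNr. Qed.
HB.instance Definition _ :=
  GRing.isZmodule.Build (mpseries n R) psaddA psaddC psadd0 psaddN.

(* [f] and [P] agree up to degree [d]. *)
Let appr d f P := forall m, (mdeg m <= d)%N -> pscoef f m = P@_m.

Let apprE d f : {P | appr d f P}.
Proof.
exists (\sum_(m : 'X_{1..n < d.+1}) pscoef f m *: 'X_[m]) => m led.
by rewrite mcoeff_mpoly.
Qed.

Let appr_mul d f g P Q : appr d f P -> appr d g Q -> appr d (psmul f g) (P * Q).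
Proof.
move=> fP gQ m led; rewrite mcoeffM /=; apply: eq_bigr => u _.
by rewrite fP ?gQ //; apply: leq_trans led; rewrite -ltnS bmdeg.
Qed.

Let appr_eq f g : (forall d, exists2 P, appr d f P & appr d g P) -> f = g.
Proof. by move=> H; apply: psP => m; have [P -> // ->] := H (mdeg m). Qed.

Let appr1 d : appr d ps1 1.
Proof. by move=> m _ /=; rewrite mcoeff1. Qed.

Let appr_add d f g P Q : appr d f P -> appr d g Q -> appr d (psadd f g) (P + Q).
Proof. by move=> fP gQ m led /=; rewrite mcoeffD fP ?gQ. Qed.

Fact psmulA : associative psmul.
Proof.
move=> f g h; apply: appr_eq => d.
have [P fP] := apprE d f; have [Q gQ] := apprE d g; have [S hS] := apprE d h.
exists (P * (Q * S)); first by do !apply: appr_mul.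
by rewrite mulrA; do !apply: appr_mul.
Qed.
Fact psmulC : commutative psmul.
Proof.
move=> f g; apply: appr_eq => d.
have [P fP] := apprE d f; have [Q gQ] := apprE d g.
by exists (P * Q); first exact: appr_mul; rewrite mulrC; apply: appr_mul.
Qed.
Fact psmul1 : left_id ps1 psmul.
Proof.
move=> f; apply: appr_eq => d; have [P fP] := apprE d f.
by exists P => //; rewrite -[P]mul1r; apply: appr_mul.
Qed.
Fact psmulDl : left_distributive psmul psadd.
Proof.
move=> f g h; apply: appr_eq => d.
have [P fP] := apprE d f; have [Q gQ] := apprE d g; have [S hS] := apprE d h.
exists ((P + Q) * S); first by apply: appr_mul => //; apply: appr_add.
by rewrite mulrDl; apply: appr_add; apply: appr_mul.
Qed.
Fact ps1_neq0 : ps1 != ps0.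
Proof.
apply/eqP => /(congr1 (fun f => pscoef f 0%MM)) /= /eqP.
by rewrite eqxx oner_eq0.
Qed.
HB.instance Definition _ := GRing.Zmodule_isComNzRing.Build (mpseries n R)
  psmulA psmulC psmul1 psmulDl ps1_neq0.

Definition psunit : {pred mpseries n R} := [pred f | `[< exists g, g * f = 1 >]].
Definition psinv f : mpseries n R :=
  if pselect (exists g, g * f = 1) is left fU then projT1 (cid fU) else f.

Fact psmulV : {in psunit, left_inverse 1 psinv *%R}.
Proof. by move=> f /asboolP fU; rewrite /psinv; case: pselect => // ?; case: cid. Qed.
Fact psunitP f g : g * f = 1 -> psunit f.
Proof. by move=> gf; apply/asboolP; exists g. Qed.
Fact psinv_out : {in [predC psunit], psinv =1 id}.
Proof. by move=> f /asboolPn fU; rewrite /psinv; case: pselect. Qed.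
HB.instance Definition _ := GRing.ComNzRing_hasMulInverse.Build (mpseries n R)
  psmulV psunitP psinv_out.

(* The component of least degree of [f], a nonzero polynomial. *)
Let lowest f : f != 0 -> exists d P, [/\ P != 0,
  forall m, (mdeg m < d)%N -> pscoef f m = 0 &
  forall m, P@_m = if mdeg m == d then pscoef f m else 0].
Proof.
move=> f0.
have [m fm] : exists m, pscoef f m != 0.
  apply: contrapT => nf; case/eqP: f0; apply: psP => m.
  by apply: contrapT => /eqP fm; apply: nf; exists m.
have exd : exists d, `[< exists2 m, mdeg m = d & pscoef f m != 0 >].
  by exists (mdeg m); apply/asboolP; exists m.
case: (ex_minnP exd) => d /asboolP[{fm}m dm fm] dmin.
pose g := @MPSeries n R (fun m => if mdeg m == d then pscoef f m else 0).
pose P : {mpoly R[n]} := \sum_(m : 'X_{1..n < d.+1}) pscoef g m *: 'X_[m].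
have PE m' : P@_m' = pscoef g m'.
  case: (ltnP (mdeg m') d.+1) => [led|gtd]; first by rewrite mcoeff_mpoly.
  rewrite /P raddf_sum big1 /= => [|u _].
    by rewrite gtn_eqF.
  rewrite mcoeffZ mcoeffX; have [um|_] := eqVneq (u : multinom n) m'; last by rewrite mulr0.
  by have := bmdeg u; rewrite um ltnNge gtd.
exists d, P; split=> // [|m' ltd].
  by apply: contraNneq fm => P0; have := PE m; rewrite P0 mcoeff0 /= dm eqxx => <-.
apply: contrapT => /eqP fm'; suff /dmin : `[< exists2 m, mdeg m = mdeg m' & pscoef f m != 0 >].
  by rewrite leqNgt ltd.
by apply/asboolP; exists m'.
Qed.

Fact ps_integral : GRing.integral_domain_axiom (mpseries n R).
Proof.
move=> f g fg0; apply/norP => -[/lowest[d [P [P0 fd PE]]] /lowest[e [Q [Q0 ge QE]]]].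
have /eqP[] : P * Q != 0 by rewrite mulf_neq0.
apply/mpolyP => m; rewrite mcoeff0 mcoeffM.
case: (eqVneq (mdeg m) (d + e)%N) => [dm|dm]; last first.
  apply: big1 => u /eqP mu; rewrite PE QE.
  case: eqP => [ud|]; last by rewrite mul0r.
  case: eqP => [ue|]; last by rewrite mulr0.
  by case/eqP: dm; rewrite mu mdegD ud ue.
transitivity (pscoef (f * g) m); last by rewrite fg0.
rewrite [RHS]/=; apply: eq_bigr => u /eqP mu; rewrite PE QE.
have /eqP : (mdeg u.1 + mdeg u.2 = d + e)%N by rewrite -mdegD -mu.
case: (ltngtP (mdeg u.1) d) => [ltd _|gtd|->].
- by rewrite fd // !mul0r.
- case: (ltnP (mdeg u.2) e) => [lte|lee]; first by rewrite ge // mulr0 mul0r.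
  by move=> /eqP E; have := leq_add gtd lee; rewrite E addSn ltnn.
- by rewrite eqn_add2l => ->.
Qed.
HB.instance Definition _ := GRing.ComUnitRing_isIntegral.Build (mpseries n R)
  ps_integral.

End PowerSeries.

Definition ideal_gen (S : comNzRingType) (G : S -> Prop) (P : S) : Prop :=
  exists n (c h : 'I_n -> S), (forall i, G (h i)) /\ P = \sum_i c i * h i.

Section ParameterField.
Variables (k : fieldType) (q l : nat).

Definition nparams : nat := if l == 1%N then q else q.-1.

Definition param_field : fieldType := {fraction mpseries nparams k}.

(* The [i]-th parameter, counted from 0, is x_(i+1), and multiplies
   x^(q - (i+1)); for l != 1 there is no constant term. *)
Definition apoly : {poly param_field} :=
  'X^q + \sum_(i < nparams) tofrac (psX k i) *: 'X^(q - i.+1).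

End ParameterField.

(* A non-singular projective curve over L is handled through its function
   field F, an extension of L given by [iota].  Its closed points are the
   non-trivial valuation rings of F containing L. *)
Section FunctionField.
Variables (L F : fieldType) (iota : {rmorphism L -> F}).
Implicit Types (E V O : F -> Prop) (x X y z f : F).

(* [e] is a basis of [V] over the subfield [E]. *)
Definition is_basis E V d (e : 'I_d -> F) : Prop :=
  [/\ forall i, V (e i),
      forall z, V z ->
        exists2 c : 'I_d -> F, (forall i, E (c i)) & z = \sum_i c i * e i
    & forall c : 'I_d -> F, (forall i, E (c i)) ->
        \sum_i c i * e i = 0 -> forall i, c i = 0].

Definition constant z : Prop := exists c, z = iota c.

Definition whole z : Prop := True.

(* The subfield L(s_1, ..., s_n). *)
Definition adjoin n (s : n.-tuple F) z : Prop :=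
  exists P Q : {mpoly L[n]}, mmap iota (tnth s) Q != 0 /\
    z = mmap iota (tnth s) P / mmap iota (tnth s) Q.

(* The function field of the curve X^p - X = x^l / a(x)^p: x is
   transcendental over L, and F = L(x)[X] with X of degree p over L(x). *)
Definition AS_function_field p l (a : {poly L}) x X : Prop :=
  [/\ forall P : {poly L}, P != 0 -> (map_poly iota P).[x] != 0,
      X ^+ p - X = x ^+ l / (map_poly iota a).[x] ^+ p
    & is_basis (adjoin [tuple x]) whole (fun i : 'I_p => X ^+ i)].

Definition derivation (D : F -> F) : Prop :=
  [/\ forall u v, D (u + v) = D u + D v,
      forall u v, D (u * v) = u * D v + v * D u
    & forall c, D (iota c) = 0].

Definition valuation_ring O : Prop :=
  [/\ forall c, O (iota c),
      forall u v, O u -> O v -> O (u - v),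
      forall u v, O u -> O v -> O (u * v)
    & forall u, O u \/ O u^-1].

(* [f] dx is a global section of Omega.  When x is a separating element, the
   differentials of F/L are the f dx with f in F, and du = D(u) dx for the
   derivation D of F/L with D(x) = 1; the stalk of Omega at the point with
   local ring O is spanned over O by the du with u in O. *)
Definition holomorphic x f : Prop :=
  exists D, [/\ derivation D, D x = 1 &
    forall O, valuation_ring O ->
      exists n (s u : 'I_n -> F),
        [/\ forall i, O (s i), forall i, O (u i) &
            f = \sum_i s i * D (u i)]].

Definition has_genus x g : Prop :=
  exists e : 'I_g -> F, is_basis constant (holomorphic x) e.

(* There is a morphism of degree [d] to the projective line. *)
Definition has_covering d : Prop :=
  exists y (e : 'I_d -> F), is_basis (adjoin [tuple y]) whole e.

(* To be used for genus at least 2, respectively for non-hyperelliptic curves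
   of genus at least 3, over an algebraically closed L. *)
Definition hyperelliptic : Prop := has_covering 2.
Definition trigonal : Prop := has_covering 3.

(* The condition [H.@[v] = 0] does not follow from the vanishing of the
   partial derivatives in characteristic 5.  L is algebraically closed. *)
Definition plane_quintic : Prop :=
  exists (H : {mpoly L[3]}) y z,
    [/\ H \is 5.-homog,
        forall v : 'I_3 -> L, H.@[v] = 0 ->
          (forall i, (H^`M(i)).@[v] = 0) -> forall i, v i = 0,
        mmap iota (tnth [tuple 1; y; z]) H = 0
      & forall w, adjoin [tuple y; z] w].

End FunctionField.

Section CanonicalIdeal.
Variables (p q l : nat).

(* N + 2 <= mu q rather than N <= mu q - 2, as the latter is truncated; the
   bounds N < p q and mu < p are implied by, resp. part of, the definition. *)
Definition index_set : {set 'I_(p * q) * 'I_p} :=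
  [set t : 'I_(p * q) * 'I_p |
    [&& (0 < t.2)%N, (t.2 * l %/ p <= t.1)%N & (t.1 + 2 <= t.2 * q)%N]].

Local Notation r := #|index_set|.

Definition iN (i : 'I_r) : nat := (enum_val i).1.
Definition imu (i : 'I_r) : nat := (enum_val i).2.

Definition multideg (t : 'X_{1..r}) : nat * nat * nat :=
  (mdeg t, (\sum_i t i * iN i)%N, (\sum_i t i * imu i)%N).

Definition T2 (t : 'X_{1..r}) : Prop := mdeg t = 2%N.

Definition jmin : nat := if l == 1%N then 0%N else p.-1.

Section Generators.
Variables (K : fieldType) (a : {poly K}).

Definition G1 (P : {mpoly K[r]}) : Prop :=
  exists t1 t2 : 'X_{1..r},
    [/\ T2 t1, T2 t2, multideg t1 = multideg t2 & P = 'X_[t1] - 'X_[t2]].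

Definition G2 (P : {mpoly K[r]}) : Prop :=
  exists (t t' : 'X_{1..r}) (s : nat -> 'X_{1..r}),
    [/\ T2 t, T2 t', multideg t' = multideg t + (0%N, l, p),
        forall j, (jmin <= j <= p.-1 * q)%N ->
          T2 (s j) /\ multideg (s j) = multideg t + (0%N, j, p.-1)
      & P = 'X_[t] - 'X_[t']
            - \sum_(jmin <= j < (p.-1 * q).+1) (a ^+ p.-1)`_j *: 'X_[s j]].

Variables (F : fieldType) (iota : {rmorphism K -> F}) (x X : F).

(* The element of index [i] of the basis of holomorphic differentials,
   divided by dx. *)
Definition cbasis (i : 'I_r) : F :=
  let ax := (map_poly iota a).[x] in
  x ^+ iN i * ax ^+ (p.-1 - imu i) * X ^+ (p.-1 - imu i) / ax ^+ p.-1.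

(* The n-differentials f dx^n of F are the monomials f 'X^n of {poly F}, that
   is, 'X stands for dx.  The direct sum of the H^0(Omega^n) is a graded
   subring of this ring, so that the kernel can be computed here. *)
Definition phi (P : {mpoly K[r]}) : {poly F} :=
  mmap (fun c => (iota c)%:P) (fun i => cbasis i *: 'X) P.

Definition canonical_ideal (P : {mpoly K[r]}) : Prop := phi P = 0.

End Generators.
End CanonicalIdeal.

(* Main.v *)
Require Import Defs.
From HB Require Import structures.
From mathcomp Require Import all_boot all_order all_algebra.
From mathcomp Require Import boolp mpoly.
From mathcomp Require Import zify ring.

(** Put Y = a(x) X and s = p - 1 - mu. Then Y^p = a(x)^(p-1) Y + x^l, and the
    basis element of index (N, mu) is x^N Y^s divided by a(x)^(p-1). So the
    image of a monomial of degree d is x^(sum of the N) Y^(sum of the s) up to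
    a factor that depends on d only: G1 identifies monomials with equal images,
    G2 is the equation of Y multiplied by x^N Y^(s - p), and both lie in the
    kernel ([phi_ideal]).

    For the converse, give each variable a weight. It is enough
    ([ideal_of_reduction]) that for each degree d and each weight w, modulo the
    ideal generated by G1 and G2, either all monomials of degree d and weight w
    are congruent to combinations of lighter ones, or any two of them are
    congruent up to lighter ones and the image of one of them is independent
    of the images of all lighter ones. Then the heaviest part of an element of
    the kernel can be removed, again and again.

    For l <> 1 the polynomial a vanishes at 0, and x^N Y^s has order p N + l s
    at the point x = Y = 0, because the terms a(x)^(p-1) Y of the equation have
    higher order. As weight take a constant minus p N + l s, namely
    p (q mu - 2 - N) + m s ([hw]). It maps the index set bijectively onto the
    elements at most 2 g - 2 = p m - p - m - 1 of the numerical semigroup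
    generated by p and m, since N >= [mu l / p] says exactly that the weight
    does not exceed that bound. Monomials of equal weight have proportional
    leading terms, which settles independence. Two products of two variables
    with the same weight either have the same multidegree (G1), or their sums of
    mu differ by p (G2, whose other terms are lighter). What is left is a
    statement on the semigroup ([weight_connected]): two lists of d weights with
    the same sum are connected by exchanges of pairs x, y for x', y' with
    x + y = x' + y'. It holds when both generators are at least 4 and are not 4
    and 5. One moves all but two entries to 0 or to 2 g - 2, which is a question
    on triples ([upP], [lowP]); a triple of sum 4 g - 3 admits no such move, and
    those are all connected to one particular triple.

    For l = 1 order the monomials by the sum of the s first. If it is at least p,
    a suitable choice of representative contains two variables with s + s' >= p
    ([tall_pair]), and G2 lowers it. If it is less than p, images are independent
    because 1, Y, ..., Y^(p-1) are independent over K(x), and G1 connects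
    monomials of equal multidegree ([linear_connected]), since the pairs
    (q mu - 2 - N, s) are all lattice points of a trapezoid.

    This needs p >= 5, m >= 4 if l <> 1, and p >= 7 if q = l = 1. In the other
    cases the curve over the algebraic closure is excluded by assumption: x is a
    covering of degree p; for q = 1 and l <> 1 the function X is one of degree
    m = p - l (if m = 1, the curve is rational and X^2 has degree 2); for
    q = l = 1 and p = 5 the curve is a smooth plane quintic
    ([linear_pole_quintic]). *)

Set Implicit Arguments.
Unset Strict Implicit.
Unset Printing Implicit Defensive.

Import GRing.Theory.

(** * Exchanges of pairs in lists *)
Section Swaps.
Variables (T : eqType) (R : T -> T -> T -> T -> Prop).

(** Lists stand for multisets; [R x y x' y'] allows to replace the entries [x], [y]
    by [x'], [y']. *)
Inductive swaps : seq T -> seq T -> Prop :=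
| swaps_perm s1 s2 : perm_eq s1 s2 -> swaps s1 s2
| swaps_pair x y x' y' s : R x y x' y' -> swaps [:: x, y & s] [:: x', y' & s]
| swaps_trans s1 s2 s3 : swaps s1 s2 -> swaps s2 s3 -> swaps s1 s3.

Lemma swaps_refl s : swaps s s.
Proof. exact: swaps_perm. Qed.

Lemma swaps_sym (Rsym : forall x y x' y', R x y x' y' -> R x' y' x y) s1 s2 :
  swaps s1 s2 -> swaps s2 s1.
Proof.
elim=> [{}s1 {}s2 s12|x y x' y' s xy|{}s1 {}s2 s3 _ s21 _ s32].
- by apply: swaps_perm; rewrite perm_sym.
- exact/swaps_pair/Rsym.
- exact: swaps_trans s32 s21.
Qed.

Lemma swaps_cons x s1 s2 : swaps s1 s2 -> swaps (x :: s1) (x :: s2).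
Proof.
elim=> [{}s1 {}s2 s12|y z y' z' s yz|{}s1 {}s2 s3 _ s12 _ s23].
- by apply: swaps_perm; rewrite perm_cons.
- have perm_x u v : perm_eq [:: x, u, v & s] [:: u, v, x & s].
    by rewrite (perm_catCA [:: x] [:: u; v] s).
  apply: (swaps_trans (swaps_perm (perm_x y z))).
  apply: (swaps_trans (swaps_pair (x :: s) yz)).
  by apply: swaps_perm; rewrite perm_sym.
- exact: swaps_trans s12 s23.
Qed.

Lemma swaps_catl s s1 s2 : swaps s1 s2 -> swaps (s ++ s1) (s ++ s2).
Proof. by move=> s12; elim: s => //= x s; apply: swaps_cons. Qed.

Lemma swaps_catr s s1 s2 : swaps s1 s2 -> swaps (s1 ++ s) (s2 ++ s).
Proof.
move=> /(swaps_catl s) s12.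
apply: (swaps_trans (swaps_perm (s2 := s ++ s1) _)); first by rewrite perm_catC.
by apply: (swaps_trans s12); apply: swaps_perm; rewrite perm_catC.
Qed.

End Swaps.

(** * Exchanges of pairs in a numerical semigroup *)
Section Semigroup.
Variables (M P : nat).
Hypotheses (coMP : coprime M P) (M4 : 4 <= M) (MP : M < P).
Hypothesis not45 : ~~ ((M == 4) && (P == 5)).

Definition sg x := exists n r, x = n * M + r * P.
(** A positive form of not being in the semigroup. In the class of [x] mod [M] there is
    exactly one multiple r P with r < M, the least element of the semigroup in that
    class; the gaps are the numbers below it. *)
Definition gap x := exists n r, r < M /\ x + n.+1 * M = r * P.

(** The largest gap. *)
Definition frob := M * P - M - P.
(** The number 2 g - 2, where g is the number of gaps. *)
Definition canon := frob.-1.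

Lemma frobE : frob + M + P = M * P.
Proof. rewrite /frob; nia. Qed.
Lemma canonE : canon.+1 = frob.
Proof. have := frobE; rewrite /canon; nia. Qed.

Lemma residue x : exists2 r, r < M & x = r * P %[mod M].
Proof.
have M0 : 0 < M by lia.
exists (chinese P M 0 x %/ P %% M); first by rewrite ltn_mod.
have coPM : coprime P M by rewrite coprime_sym.
have dvdP : P %| chinese P M 0 x.
  by apply/eqP; have := chinese_modl coPM 0 x; rewrite mod0n.
by rewrite modnMml divnK // chinese_modr.
Qed.

Lemma sg_or_gap x : sg x \/ gap x.
Proof.
have M0 : 0 < M by lia.
have [r rM xr] := residue x; have [le_rx|lt_xr] := leqP (r * P) x.
  left; move/eqP: xr; rewrite eqn_mod_dvd // => /dvdnP[n xE].
  by exists n, r; rewrite -xE subnK.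
right; move/esym/eqP: xr; rewrite eqn_mod_dvd 1?ltnW // => /dvdnP[[|n] xE].
  by move: xE; rewrite mul0n => /eqP; rewrite subn_eq0 leqNgt lt_xr.
by exists n, r; split=> //; rewrite -xE subnKC // ltnW.
Qed.

Lemma gap_nsg x : gap x -> ~ sg x.
Proof.
move=> [n [r [rM xE]]] [n' [r' xE']].
have lt_r : r' < r by nia.
have : M %| (r - r') * P.
  by apply/dvdnP; exists (n' + n.+1); rewrite mulnBl -xE xE'; nia.
by rewrite Gauss_dvdl // => /dvdn_leq; lia.
Qed.

Lemma sgD x y : sg x -> sg y -> sg (x + y).
Proof. by move=> [n [r ->]] [n' [r' ->]]; exists (n + n'), (r + r'); nia. Qed.

(** With [gap_frobB], the symmetry of a semigroup with two generators: x and frob - x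
    are never both in it, nor both outside. In coordinates, n M + r P corresponds to
    the pair -n - 1, M - 1 - r. *)
Lemma sg_frobB x : gap x -> sg (frob - x).
Proof.
move=> [n [r [rM xE]]]; have fE := frobE; exists n, (M - r.+1).
have MPE : M * P = (M - r.+1) * P + r * P + P by rewrite -mulnDl -mulSnr; congr (_ * _); lia.
rewrite mulSn in xE; nia.
Qed.

Lemma gap_frobB x : sg x -> x <= frob -> gap (frob - x).
Proof.
move=> [n [r xE]] lex; have fE := frobE; exists n, (M - r.+1).
have rM : r < M by rewrite ltnNge; apply/negP => Mr; have := leq_mul Mr (leqnn P); lia.
have MPE : M * P = (M - r.+1) * P + r * P + P by rewrite -mulnDl -mulSnr; congr (_ * _); lia.
by split; [lia|rewrite mulSn; nia].
Qed.

Lemma gap_le x : gap x -> x <= frob.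
Proof.
move=> [n [r [rM xE]]]; have fE := frobE.
have : r * P + P <= M * P by rewrite -mulSnr leq_mul2r rM orbT.
rewrite mulSn in xE; lia.
Qed.

Lemma gap_gt0 x : gap x -> 0 < x.
Proof.
move=> gx; case: x gx => // /gap_nsg[]; exists 0, 0; lia.
Qed.

Lemma gapB u h : gap u -> sg h -> h < u -> gap (u - h).
Proof.
move=> gu sh lt_hu; have [/sgD/(_ sh)|//] := sg_or_gap (u - h).
by rewrite subnK 1?ltnW // => /(gap_nsg gu).
Qed.

(** Below [P] the semigroup consists of the multiples of [M]. *)
Lemma gap_ltP x : x < P -> ~~ (M %| x) -> gap x.
Proof.
move=> xP Mx; have [[n [[|r] xE]]|//] := sg_or_gap x; last by rewrite mulSn in xE; lia.
by case/negP: Mx; rewrite xE addn0 dvdn_mull.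
Qed.

Lemma gap_small x : 0 < x < M -> gap x.
Proof. by move=> xM; apply: gap_ltP; [lia|rewrite gtnNdvd; lia]. Qed.

Lemma gap_multP x r k : r < M -> 0 < k -> x + k * M = r * P -> gap x.
Proof. by move=> rM; case: k => // k _ xE; exists k, r. Qed.

Lemma gap_multM x j : j < P -> x + P = j * M -> gap x.
Proof.
move=> jP xE; have M0 : 0 < M by lia.
apply: (@gap_multP x M.-1 (P - j)); [lia|lia|].
have -> : M.-1 * P = M * P - P by rewrite -{3}[P]mul1n -mulnBl subn1.
have : j * M <= P * M by rewrite leq_mul2r ltnW ?orbT.
rewrite mulnBl; nia.
Qed.

(** The weights of the variables; frob itself is a gap. *)
Definition W x := sg x /\ x <= canon.
Definition swapW x y x' y' := [/\ W x, W y, W x', W y' & x + y = x' + y'].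
Notation swap := (swaps swapW).

Lemma swapW_sym x y x' y' : swapW x y x' y' -> swapW x' y' x y.
Proof. by case. Qed.

Lemma frob_gt0 : 0 < frob.
Proof. have := frobE; nia. Qed.

Lemma W_gap u : gap u -> W (frob - u).
Proof.
move=> gu; split; first exact: sg_frobB.
by have := gap_gt0 gu; rewrite /canon; lia.
Qed.

Let tri u v w := [:: frob - u; frob - v; frob - w].
(** The triple of elements frob - u, frob - v, frob - w, where u, v, w are gaps, can be
    moved to one that contains [canon], the entry at distance 1 from frob. *)
Definition up u v w :=
  exists v' w', [/\ gap v', gap w' & swap (tri u v w) (tri 1 v' w')].

Lemma up_rot u v w : up v w u -> up u v w.
Proof.
move=> [v' [w' [gv gw s]]]; exists v', w'; split=> //.
by apply: swaps_trans s; apply: swaps_perm; rewrite -[tri v w u]/(rot 1 (tri u v w)) perm_sym perm_rot.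
Qed.

Lemma up_exch u v w : up u w v -> up u v w.
Proof.
move=> [v' [w' [gv gw s]]]; exists v', w'; split=> //.
apply: swaps_trans s; apply: swaps_perm; apply/permP => a /=; lia.
Qed.

Lemma up_swap u v w u' v' : gap u -> gap v -> gap u' -> gap v' ->
  u + v = u' + v' -> up u' v' w -> up u v w.
Proof.
move=> gu gv gu' gv' uv [v1 [w1 [gv1 gw1 s]]]; exists v1, w1; split=> //.
apply: swaps_trans s; apply: swaps_pair; split; try exact: W_gap.
by move: (gap_le gu) (gap_le gv) (gap_le gu') (gap_le gv'); lia.
Qed.

Lemma up1 v w : gap v -> gap w -> up 1 v w.
Proof. by move=> gv gw; exists v, w; split=> //; apply: swaps_refl. Qed.

(** The distances u, v are exchanged for 1 and u + v - 1. *)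
Lemma up_end u v w : gap u -> gap v -> gap w -> gap (u + v).-1 -> up u v w.
Proof.
move=> gu gv gw guv; apply: (@up_swap u v w 1 (u + v).-1) => //.
- by apply: gap_small; lia.
- by have := gap_gt0 gu; lia.
- exact: up1.
Qed.

Lemma up_bal u v w v' w' : gap u -> gap v -> gap w -> gap v' -> gap w' ->
  v + w = v' + w' -> up u v' w' -> up u v w.
Proof.
move=> gu gv gw gv' gw' vw h; apply/up_rot/(@up_swap v w u v' w') => //.
by apply/up_rot/up_rot.
Qed.

Lemma gap_frob u n r : frob = u + n * M + r * P -> gap u.
Proof.
move=> fE; have -> : u = frob - (n * M + r * P) by lia.
by apply: gap_frobB; [exists n, r|lia].
Qed.

Lemma modM0 r : 0 < r < M -> P * r %% M != 0.
Proof.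
by move=> rM; rewrite -/(_ %| _) Gauss_dvdr // gtnNdvd; lia.
Qed.

(** First case in which none of the moves of [upP] applies: v + w = M + 1, so that v + w - 1
    is not a gap, and v, w are too small to absorb a generator. All splittings i, M + 1 - i
    with 1 < i < M consist of gaps, so v, w can be rebalanced. One of them is chosen such
    that u + i - 1 is a gap, or such that u and i can be exchanged for u', i' with
    i' + (M + 1 - i) - 1 a gap; then [up_end] applies. Which one depends on u and on the
    position of [P] between multiples of [M]; it exists because M >= 4 and (M, P) is not
    (4, 5). *)
Lemma up_M u v w al be : gap u -> frob = u + al.+1 * M + be * P ->
  0 < v < M -> 0 < w < M -> v + w = M.+1 -> u + v + w <= frob -> up u v w.
Proof.
move=> gu fE vM wM vw sumf.
have gv := gap_small vM; have gw := gap_small wM; have u0 := gap_gt0 gu.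
have [->|u1] : u = 1 \/ 1 < u by lia.
  exact: up1.
have bal i : 1 < i < M -> up u i (M.+1 - i) -> up u v w.
  by move=> iM; apply: up_bal => //; [apply: gap_small; lia|apply: gap_small; lia|lia].
case: al fE => [|al] fE.
  case: be fE => [|b] fE; first by lia.
  have Pdiv := divn_eq P M; have ltr : P %% M < M by rewrite ltn_mod; lia.
  have r0 : P %% M != 0 by have := @modM0 1; rewrite muln1; apply; lia.
  set k := P %/ M in Pdiv; set r := P %% M in Pdiv ltr r0.
  have [rM|rM] : r = M.-1 \/ r < M.-1 by lia.
    apply: (bal 2); first by lia.
    apply: (@up_swap u 2 _ u.-1 3); rewrite ?gu //.
    - by apply: gap_small; lia.
    - by apply: (@gap_frob _ k.+2 b); rewrite !mulSn in fE *; lia.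
    - by apply: gap_small; lia.
    - by lia.
    apply: up_rot; apply: up_end.
    - by apply: gap_small; lia.
    - by apply: gap_small; lia.
    - by apply: (@gap_frob _ k.+2 b); rewrite !mulSn in fE *; lia.
    - apply: gap_ltP; first by have : M <= k * M; [rewrite leq_pmull // lt0n; apply: contraTneq MP => k0; rewrite k0 in Pdiv; lia|lia].
      have -> : (3 + (M.+1 - 2)).-1 = M + 1 by lia.
      by rewrite dvdn_addr // gtnNdvd; lia.
  apply: (bal M.-1); first by lia.
  have gu' : gap (u + M - (M - r)).
    by apply: (@gap_frob _ k.+1 b); rewrite !mulSn in fE *; lia.
  apply: (@up_swap u M.-1 _ (u + M - (M - r)) (M - r).-1) => //; try (by apply: gap_small; lia).
    by lia.
  by apply: up_rot; apply: up_end => //; apply: gap_small; lia.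
have [P2|P2] := ltnP (2 * M) P.
  have [uP|uP] := leqP u (P - 2 * M).
    have [i [i2 iN]] : exists i, 1 < i < 4 /\ ~~ (M %| u + i.-1).
      have [d|d] := boolP (M %| u + 1); last by exists 2.
      exists 3; split=> //; have -> : u + 3.-1 = u + 1 + 1 by lia.
      by rewrite dvdn_addr // gtnNdvd; lia.
    apply: (bal i); first by lia.
    apply: up_end => //; try (by apply: gap_small; lia).
    have -> : (u + i).-1 = u + i.-1 by lia.
    by apply: gap_ltP => //; lia.
  have [i [i2 iN]] : exists i, 1 < i < 4 /\ ~~ (M %| P + i).
    have [d|d] := boolP (M %| P + 2); last by exists 2.
    exists 3; split=> //; have -> : P + 3 = P + 2 + 1 by lia.
    by rewrite dvdn_addr // gtnNdvd; lia.
  apply: (bal i); first by lia.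
  have gu' : gap (u - (P - 2 * M)).
    by apply: (@gap_frob _ al be.+1); rewrite !mulSn in fE *; lia.
  have gi : gap (P - 2 * M + i).
    apply: gap_ltP; first by lia.
    rewrite -(@dvdn_addr (2 * M)) ?dvdn_mull //.
    by have -> : 2 * M + (P - 2 * M + i) = P + i by lia.
  apply: (@up_swap u i _ (u - (P - 2 * M)) (P - 2 * M + i)) => //; try (by apply: gap_small; lia).
    by lia.
  apply: up_rot; apply: up_end => //; try (by apply: gap_small; lia).
  by apply: (@gap_multP _ 1 1); lia.
have [PM1|PM1] : P = M.+1 \/ M.+1 < P by lia.
  case: be fE => [|b] fE.
    have [u2|u2] : u = 2 \/ 2 < u by lia.
      apply: (bal 2); first by lia.
      by subst u; apply: up_end => //; apply: gap_small; lia.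
    have M5 : 4 < M by move/negP: not45; lia.
    have gu' : gap (u - 2).
      by apply: (@gap_frob _ al 2); rewrite !mulSn in fE *; lia.
    apply: (bal 2); first by lia.
    apply: (@up_swap u 2 _ (u - 2) 4) => //; try (by apply: gap_small; lia).
      by lia.
    apply: up_rot; apply: up_end => //; try (by apply: gap_small; lia).
    by apply: (@gap_multP _ 2 1); lia.
  apply: (bal 2); first by lia.
  apply: up_end => //; try (by apply: gap_small; lia).
  by apply: (@gap_frob _ al.+3 b); rewrite !mulSn in fE *; lia.
have PN : P != 2 * M.
  apply/eqP => PE; move: coMP; rewrite PE coprime_sym /coprime gcdnC gcdnMl; lia.
apply: (bal M.-1); first by lia.
have gu' : gap (u + 2 * M - P).
  by apply: (@gap_frob _ al be.+1); rewrite !mulSn in fE *; lia.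
apply: (@up_swap u M.-1 _ (u + 2 * M - P) (P - M - 1)) => //; try (by apply: gap_small; lia).
  by lia.
by apply: up_rot; apply: up_end => //; apply: gap_small; lia.
Qed.

(** The same with v + w = P + 1, which forces [P] to be less than twice [M]. *)
Lemma up_P u v w al be : gap u -> frob = u + al.+1 * M + be * P ->
  0 < v < M -> 0 < w < M -> v + w = P.+1 -> u + v + w <= frob -> up u v w.
Proof.
move=> gu fE vM wM vw sumf.
have gv := gap_small vM; have gw := gap_small wM; have u0 := gap_gt0 gu.
have [->|u1] : u = 1 \/ 1 < u by lia.
  exact: up1.
have M5 : 4 < M by move/negP: not45; lia.
have bal i j : 0 < i < M -> 0 < j < M -> i + j = P.+1 -> up u i j -> up u v w.
  by move=> iM jM ij; apply: up_bal => //; [apply: gap_small|apply: gap_small|lia].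
have [uP|uP] := leqP u (P - M).
  have [y|y] := eqVneq (u + P + 1 - M) M; last first.
    apply: (bal (P + 2 - M) M.-1); try lia.
    apply: up_end => //; try (by apply: gap_small; lia).
    apply: gap_ltP; first by lia.
    have [yM|yM] := ltnP (u + P + 1 - M) M; first by rewrite gtnNdvd; lia.
    have -> : (u + (P + 2 - M)).-1 = M + (u + P + 1 - M - M) by lia.
    by rewrite dvdn_addr // gtnNdvd; lia.
  have gM1 : gap M.+1.
    by apply: gap_ltP; [lia|rewrite -addn1 dvdn_addr // gtnNdvd; lia].
  have [PM|PM] := ltnP (P + 3 - M) M.
    apply: (bal (P + 3 - M) (M - 2)); try lia.
    apply: up_end => //; try (by apply: gap_small; lia).
    by have -> : (u + (P + 3 - M)).-1 = M.+1 by lia.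
  apply: (@up_swap u v _ 3 (v - 1)) => //; try (by apply: gap_small; lia).
    by lia.
  apply: up_exch; apply: up_end => //; try (by apply: gap_small; lia).
  by have -> : (3 + w).-1 = M.+1 by lia.
have [PM1|PM1] : P = M.+1 \/ M.+1 < P by lia.
  apply: (bal 3 M.-1); try lia.
  have gu' : gap (u - 1).
    by apply: (@gap_frob _ al be.+1); rewrite !mulSn in fE *; lia.
  apply: (@up_swap u 3 _ (u - 1) 4) => //; try (by apply: gap_small; lia).
    by lia.
  apply: up_rot; apply: up_end => //; try (by apply: gap_small; lia).
  by apply: (@gap_multP _ 2 1); lia.
apply: (bal M.-1 (P + 2 - M)); try lia.
have gu' : gap (u - (P - M)).
  by apply: (@gap_frob _ al be.+1); rewrite !mulSn in fE *; lia.
have gP1 : gap P.-1.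
  apply: gap_ltP; first by lia.
  have -> : P.-1 = M + (P.-1 - M) by lia.
  by rewrite dvdn_addr // gtnNdvd; lia.
apply: (@up_swap u M.-1 _ (u - (P - M)) P.-1) => //; try (by apply: gap_small; lia).
  by lia.
apply: up_rot; apply: up_end => //; try (by apply: gap_small; lia).
by apply: (@gap_multP _ 2 1); lia.
Qed.

(** The remaining cases concern an entry frob - u that is a multiple of [P], so that v and w
    have room up to [P]. Here v + w - 1 is a multiple of [M]. If r = P mod M is not M - 1, the
    splitting r + 1, v + w - r - 1 works, since u + r differs from frob by a sum of
    multiples of [M] and [P]. Otherwise P + 1 is a multiple K M, so that u - 1 is a gap, and
    small exchanges with u - 1 suffice; M = 4 leaves less room and is treated apart. *)
Lemma up_aM u v w a b : gap u -> frob = u + b.+1 * P -> gap v -> gap w ->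
  v < P -> w < P -> 0 < a -> v + w = a * M + 1 -> u + v + w <= frob -> up u v w.
Proof.
move=> gu fE gv gw vP wP a0 vw sumf.
have u0 := gap_gt0 gu.
have [->|u1] : u = 1 \/ 1 < u by lia.
  exact: up1.
have bal i j : gap i -> gap j -> i + j = a * M + 1 -> up u i j -> up u v w.
  by move=> gi gj ij; apply: up_bal => //; lia.
have Pdiv := divn_eq P M; have ltr : P %% M < M by rewrite ltn_mod; lia.
have r0 : P %% M != 0 by have := @modM0 1; rewrite muln1; apply; lia.
set k := P %/ M in Pdiv; set r := P %% M in Pdiv ltr r0.
have akP : a + k < P.
  have : (a + k) * M < 3 * P by nia.
  by move=> akM; rewrite ltnNge; apply/negP => leP; have := leq_mul leP M4; lia.
have [rM|rM] : r < M.-1 \/ r = M.-1 by lia.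
  have gi : gap r.+1 by apply: gap_small; lia.
  have gj : gap ((a + k) * M - P) by apply: (@gap_multM _ (a + k)); nia.
  apply: (bal r.+1 ((a + k) * M - P)) => //; first by nia.
  apply: up_end => //; apply: (@gap_frob _ k b); rewrite mulSn in fE; lia.
set K := k.+1; have PK : P + 1 = K * M by rewrite /K mulSn; lia.
have gu1 : gap u.-1 by apply: (@gap_frob _ K b); rewrite mulSn in fE; lia.
have gend : gap (a * M + 1).
  by apply: (@gap_multM _ (a + K)); [rewrite /K addnS; nia|lia].
have [M5|M5] : 4 < M \/ M = 4 by lia.
  have gj : gap (a * M - 2).
    have aK : a < 2 * K by rewrite -(@ltn_pmul2r M); lia.
    by apply: (@gap_multP _ 2 (2 * K - a)); [lia|lia|rewrite mulnBl; nia].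
  apply: (bal 3 (a * M - 2)) => //; [by apply: gap_small; lia|nia|].
  apply: (@up_swap u 3 _ u.-1 4) => //; try (by apply: gap_small; lia).
    by lia.
  apply: up_rot; apply: up_end => //; try (by apply: gap_small; lia).
  by have -> : (4 + (a * M - 2)).-1 = a * M + 1 by nia.
have [aK|[aK|aK]] : a < K \/ K < a \/ a = K by lia.
- have gj : gap (a * M - 1).
    by apply: (@gap_multP _ 1 (K - a)); [lia|lia|rewrite mulnBl; nia].
  apply: (bal 2 (a * M - 1)) => //; [by apply: gap_small; lia|nia|].
  apply: (@up_swap u 2 _ u.-1 3) => //; try (by apply: gap_small; lia).
    by lia.
  apply: up_rot; apply: up_end => //; try (by apply: gap_small; lia).
  by have -> : (3 + (a * M - 1)).-1 = a * M + 1 by nia.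
- have gj : gap ((a - K) * M - 1).
    by apply: (@gap_multP _ 1 (2 * K - a)); [lia|lia|rewrite !mulnBl; nia].
  have gi : gap (P + 3) by apply: (@gap_multP _ 2 K.-1); lia.
  have gu' : gap (u + P) by apply: (@gap_frob _ 0 b); rewrite mulSn in fE; lia.
  apply: (bal (P + 3) ((a - K) * M - 1)) => //; first by nia.
  apply: (@up_swap u (P + 3) _ (u + P) 3) => //; try (by apply: gap_small; lia).
    by lia.
  apply: up_rot; apply: up_end => //; try (by apply: gap_small; lia).
  by apply: (@gap_multM _ a); nia.
have [K3|K2] : 2 < K \/ K = 2 by lia.
  have gi : gap 6 by apply: (@gap_multP _ 2 (2 * K - 2)); lia.
  have gi1 : gap 7 by apply: (@gap_multP _ 1 (K - 2)); lia.
  have gj : gap (P - 4) by apply: (@gap_multP _ 1 1); lia.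
  apply: (bal 6 (P - 4)) => //; first by lia.
  apply: (@up_swap u 6 _ u.-1 7) => //; first by lia.
  apply: up_rot; apply: up_end => //.
  by have -> : (7 + (P - 4)).-1 = a * M + 1 by lia.
have [P7 u3] : P = 7 /\ u = 3 by have := frobE; split; nia.
have g6 : gap 6 by apply: (@gap_multP _ 2 2); lia.
apply: (bal 3 6) => //; [by apply: gap_small; lia|by lia|].
have g5 : gap 5 by apply: (@gap_multP _ 3 4); lia.
by rewrite u3; apply: up_end => //; apply: gap_small; lia.
Qed.

(** Here v + w - 1 = P + a M. The argument is that of [up_aM], with the remainder of 2 P
    instead of that of [P]. *)
Lemma up_PaM u v w a b : gap u -> frob = u + b.+2 * P -> gap v -> gap w ->
  v < P -> w < P -> v + w = P + a * M + 1 -> u + v + w <= frob -> up u v w.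
Proof.
move=> gu fE gv gw vP wP vw sumf.
have u0 := gap_gt0 gu.
have [->|u1] : u = 1 \/ 1 < u by lia.
  exact: up1.
have bal i j : gap i -> gap j -> i + j = P + a * M + 1 -> up u i j -> up u v w.
  by move=> gi gj ij; apply: up_bal => //; lia.
have Pdiv := divn_eq (P * 2) M; have ltr : P * 2 %% M < M by rewrite ltn_mod; lia.
have r0 : P * 2 %% M != 0 by apply: modM0; lia.
set k := P * 2 %/ M in Pdiv; set r := P * 2 %% M in Pdiv ltr r0.
have akP : a + k < P.
  have : (a + k) * M < 3 * P by nia.
  by move=> akM; rewrite ltnNge; apply/negP => leP; have := leq_mul leP M4; lia.
have [rM|rM] : r < M.-1 \/ r = M.-1 by lia.
  have gi : gap r.+1 by apply: gap_small; lia.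
  have gj : gap ((a + k) * M - P) by apply: (@gap_multM _ (a + k)); nia.
  apply: (bal r.+1 ((a + k) * M - P)) => //; first by nia.
  apply: up_end => //; apply: (@gap_frob _ k b); rewrite !mulSn in fE; lia.
set K := k.+1; have PK : 2 * P + 1 = K * M by rewrite /K mulSn; lia.
have gu1 : gap u.-1 by apply: (@gap_frob _ K b); rewrite !mulSn in fE; lia.
have gend : gap (P + a * M + 1).
  apply: (@gap_multM _ (a + K)); last by lia.
  have : (a + K) * M < 4 * P by nia.
  by move=> akM; rewrite ltnNge; apply/negP => leP; have := leq_mul leP M4; lia.
have aK : a < K by rewrite -(@ltn_pmul2r M); lia.
have gj : gap (P + a * M - 1).
  by apply: (@gap_multP _ 3 (K - a)); [lia|lia|rewrite mulnBl; nia].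
apply: (bal 2 (P + a * M - 1)) => //; [by apply: gap_small; lia|nia|].
apply: (@up_swap u 2 _ u.-1 3) => //; try (by apply: gap_small; lia).
  by lia.
apply: up_rot; apply: up_end => //; try (by apply: gap_small; lia).
by have -> : (3 + (P + a * M - 1)).-1 = P + a * M + 1 by nia.
Qed.

(** Induction on the entry frob - u = al M + be P. If a generator h occurs in it and v > h,
    then h is moved to the entry frob - v. If v + w - 1 is a gap, [up_end] applies. When
    neither is possible, v + w - 1 = n M + r P with few possibilities, those of the four
    preceding lemmas. *)
Lemma upP u v w : gap u -> gap v -> gap w -> u + v + w <= frob -> up u v w.
Proof.
move=> gu; have [n] := ubnP (frob - u); elim: n => // n IH in u v w gu *.
move=> ltn gv gw sumf.
have [u0 v0 w0] := And3 (gap_gt0 gu) (gap_gt0 gv) (gap_gt0 gw).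
have [al [be fE]] := sg_frobB gu.
have {}fE : frob = u + al * M + be * P by lia.
have neM x : gap x -> x <> M by move=> /gap_nsg h xM; apply: h; exists 1, 0; lia.
have neP x : gap x -> x <> P by move=> /gap_nsg h xM; apply: h; exists 0, 1; lia.
have shift h x y : sg h -> gap (u + h) -> gap x -> gap y -> 0 < h < x ->
    u + x + y <= frob -> up u x y.
  move=> sh guh gx gy hx sumxy; have gxh : gap (x - h) by apply: gapB => //; lia.
  by apply: (@up_swap u x y (u + h) (x - h)) => //; [lia|apply: IH => //; lia].
have sM : sg M by exists 1, 0; lia.
have sP : sg P by exists 0, 1; lia.
have [gvw|svw] : gap (v + w).-1 \/ sg (v + w).-1 by have [] := sg_or_gap (v + w).-1; tauto.
  by apply/up_rot/up_end.
case: al fE => [|al] fE; last first.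
  have guM : gap (u + M) by apply: (@gap_frob _ al be); rewrite mulSn in fE; lia.
  have [vM|vM] := ltnP M v; first by apply: (shift M) => //; lia.
  have [wM|wM] := ltnP M w; first by apply/up_exch/(shift M) => //; lia.
  have vM' := neM _ gv; have wM' := neM _ gw.
  have [vwM|vwP] : v + w = M.+1 \/ v + w = P.+1.
    case: svw => [[|[|n']] [[|[|r]] vwE]]; rewrite ?mulSn in vwE; lia.
  
    by apply: (@up_M u v w al be) => //; lia.
  by apply: (@up_P u v w al be) => //; lia.
case: be fE => [|b] fE; first by lia.
have guP : gap (u + P) by apply: (@gap_frob _ 0 b); rewrite mulSn in fE; lia.
have [vP|vP] := ltnP P v; first by apply: (shift P) => //; lia.
have [wP|wP] := ltnP P w; first by apply/up_exch/(shift P) => //; lia.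
have vP' := neP _ gv; have wP' := neP _ gw.
case: svw => [a [[|[|r]] vwE]]; last by rewrite !mulSn in vwE; lia.
  case: a vwE => [|a] vwE; first by lia.
  by apply: (@up_aM u v w a.+1 b) => //; lia.
case: b fE guP => [|b] fE _; first by lia.
by apply: (@up_PaM u v w a b) => //; lia.
Qed.

Let special := [:: M; frob - 2; frob - M.-1].
Definition ends x y z := exists e y' z',
  [/\ e = 0 \/ e = canon, W y', W z' & swap [:: x; y; z] [:: e; y'; z']].
(** The sum 2 frob - 1 is exceptional: beside an entry 0 there would be two elements of [W]
    with sum 2 canon + 1, which is too large, and beside an entry [canon] two with sum frob,
    which the symmetry forbids. Such triples are connected to [special]. *)
Definition low x y z :=
  (x + y + z < frob.*2.-1 -> ends x y z) /\
  (x + y + z = frob.*2.-1 -> swap [:: x; y; z] special).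

Lemma low_perm x y z x' y' z' : perm_eq [:: x; y; z] [:: x'; y'; z'] ->
  low x' y' z' -> low x y z.
Proof.
move=> pe [lo sp]; have sumE : x + y + z = x' + y' + z'.
  by have := perm_sumn pe; rewrite /=; lia.
split; rewrite sumE => /[dup] sumxyz; last first.
  by move=> /sp; apply: swaps_trans; apply: swaps_perm.
move=> /lo[e [y1 [z1 [he wy wz s]]]]; exists e, y1, z1; split=> //.
by apply: swaps_trans s; apply: swaps_perm.
Qed.

Lemma low_exch x y z : low x z y -> low x y z.
Proof. by apply: low_perm; apply/permP => a /=; lia. Qed.

Lemma low_rot x y z : low y z x -> low x y z.
Proof. by apply: low_perm; apply/permP => a /=; lia. Qed.

Lemma low_swap x y z x' y' : W x -> W y -> W x' -> W y' -> x + y = x' + y' ->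
  low x' y' z -> low x y z.
Proof.
move=> wx wy wx' wy' xy [lo sp].
have s : swap [:: x; y; z] [:: x'; y'; z] by apply: swaps_pair.
split; rewrite xy; last by move=> /sp; apply: swaps_trans.
move=> /lo[e [y1 [z1 [he wy1 wz1 s1]]]]; exists e, y1, z1; split=> //.
exact: swaps_trans s s1.
Qed.

Lemma W_sg n r : n * M + r * P < frob -> W (n * M + r * P).
Proof. by move=> h; split; [exists n, r|rewrite /canon; lia]. Qed.

Lemma W_mulP r : r * P < frob -> W (r * P).
Proof. exact: (@W_sg 0). Qed.

Lemma W_mulM n : n * M < frob -> W (n * M).
Proof. by have := @W_sg n 0; rewrite mul0n addn0. Qed.

Lemma canon_gt : P + M < canon.
Proof. have := frobE; rewrite /canon; nia. Qed.

Lemma W0 : W 0. Proof. by split=> //; exists 0, 0. Qed.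
Lemma WM : W M. Proof. by split; [exists 1, 0; lia|have := canon_gt; lia]. Qed.
Lemma WP : W P. Proof. by split; [exists 0, 1; lia|have := canon_gt; lia]. Qed.
Lemma WD x y : W x -> W y -> x + y < frob -> W (x + y).
Proof. by move=> [sx _] [sy _] ?; split; [apply: sgD|rewrite /canon; lia]. Qed.
Lemma W_canon : W canon.
Proof. by rewrite /canon -subn1; apply/W_gap/gap_small; lia. Qed.
Lemma W_lt x : W x -> x < frob.
Proof. by move=> [_]; have := canonE; lia. Qed.

Lemma low_end x y z : W x -> W y -> W z -> x = 0 \/ x = canon ->
  x + y + z < frob.*2.-1 -> low x y z.
Proof.
move=> wx wy wz he lt; split; last by lia.
by move=> _; exists x, y, z; split=> //; apply: swaps_refl.
Qed.

(** The entries x, y are exchanged for 0 and x + y. *)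
Lemma low0 x y z : W x -> W y -> W z -> x + y < frob -> low x y z.
Proof.
move=> wx wy wz xy; have := canonE; have := W_lt wz => ? ?.
apply: (@low_swap x y z 0 (x + y)) => //; [exact: W0|exact: WD|].
by apply: low_end; [exact: W0|exact: WD|by []|by left|lia].
Qed.

Lemma gap_lt2M x : M < x < 2 * M -> x <> P -> gap x.
Proof.
move=> xM xP; have [[n [r xE]]|//] := sg_or_gap x.
by case: n r xE => [|[|n]] [|[|r]] xE; rewrite ?mulSn in xE; lia.
Qed.

(** If x + y >= frob, then x, y are exchanged for M and an element close to frob, whose
    distance to frob is less than [M] as well as that of z. The two elements
    close to frob are exchanged for [canon] and the rest, or, if the sum of the triple is
    2 frob - 1, for the corresponding entries of [special]. That fails only if the distance
    of the rest from frob happens to be [P], and then a detour through P is made. *)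
Lemma low_near x y e : W x -> W y -> 0 < e < M ->
  x + y + (frob - e) < frob.*2 -> low x y (frob - e).
Proof.
move=> wx wy eM lt2; have ge := gap_small eM; have we := W_gap ge.
have cE := canonE; have cgt := canon_gt.
have [xy|xy] := ltnP (x + y) frob; first exact: low0.
have xyf : x + y <> frob.
  move=> xyf; case: wx => sx _.
  have /gap_nsg[] : gap y by rewrite (_ : y = frob - x); [apply: gap_frobB => //; lia|lia].
  by case: wy.
have [g xyE] : exists g, x + y + 1 = frob + g by exists (x + y + 1 - frob); lia.
have gM : 1 < g < M by lia.
have gap1 : gap (M.+1 - g) by apply: gap_small; lia.
apply: (@low_swap x y _ M (frob - (M.+1 - g))) => //; [exact: WM|exact: W_gap|lia|].
have [eg|ge_] : e = g \/ g < e by lia.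
  apply: low_rot; apply: (@low_swap _ _ _ (frob - 2) (frob - M.-1)) => //; try exact: W_gap.
  - by apply: W_gap; apply: gap_small; lia.
  - by apply: W_gap; apply: gap_small; lia.
  - by lia.
  split; first by lia.
  by move=> _; apply: swaps_perm; apply/permP => a /=; lia.
have [PE|PE] := eqVneq P (M + e - g); last first.
  have gap2 : gap (M + e - g) by apply: gap_lt2M; [lia|move=> h; rewrite -h eqxx in PE].
  apply: low_rot; apply: (@low_swap _ _ _ canon (frob - (M + e - g))); try exact: W_gap; try lia.
    exact: W_canon.
  by apply: low_end; [exact: W_canon|exact: W_gap|exact: WM|right|lia].
have [g' [[g'1 g'M] g'e]] : exists g', [/\ 1 < g' & g' + (e - g) < M] /\ g' <> (e - g).+1.
  have [e1|e1] : e - g = 1 \/ 1 < e - g by lia.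
    by exists 3; move/negP: not45; lia.
  by exists 2; lia.
have gap2 : gap (M.+1 - g') by apply: gap_small; lia.
have gap3 : gap (P.+1 - g').
  apply: gap_ltP; first by lia.
  have [lt|le] := ltnP (P.+1 - g') M; first by rewrite gtnNdvd; lia.
  have -> : P.+1 - g' = M + (P.+1 - g' - M) by lia.
  by rewrite dvdn_addr // gtnNdvd; lia.
have gap4 : gap (g' + (e - g)) by apply: gap_small; lia.
have gap5 : gap (2 * P - M) by apply: (@gap_multP _ 2 1); lia.
apply: low_rot.
apply: (@low_swap _ _ _ (frob - (M.+1 - g')) (frob - (g' + (e - g)))); try exact: W_gap; try lia.
apply/low_rot/low_rot.
apply: (@low_swap _ _ _ P (frob - (P.+1 - g'))); try exact: W_gap; [exact: WM|exact: WP|lia|].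
apply: low_rot.
have le5 := gap_le gap5.
apply: (@low_swap _ _ _ canon (frob - (2 * P - M))); try exact: W_gap; [exact: W_canon|lia|].
by apply: low_end; [exact: W_canon|exact: W_gap|exact: WP|right|lia].
Qed.

(** The coefficient r of [P] in a multiple congruent to d avoids the two extreme values
    0 and M - 1, so that r P and its counterpart (M - 1 - r) P are both in [W]. *)
Lemma residueP d : ~~ (M %| d) -> ~~ (M %| d + P) -> d < P ->
  exists r n, 0 < r < M.-1 /\ r * P = d + n * M.
Proof.
move=> Md MdP dP; have [r rM hr] := residue d.
have r0 : 0 < r.
  by rewrite lt0n; apply: contraNneq Md => r0; rewrite /dvdn hr r0 mul0n mod0n.
have le_dr : d < r * P by have := leq_mul r0 (leqnn P); lia.
move/esym/eqP: hr; rewrite eqn_mod_dvd 1?ltnW // => /dvdnP[n rP].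
exists r, n; split; last by lia.
have rM1 : r != M.-1.
  apply: contraNneq MdP => rE; apply/dvdnP; exists (P - n).
  have : r * P + P = M * P by rewrite -mulSnr rE prednK //; lia.
  by rewrite mulnBl [P * M]mulnC; lia.
lia.
Qed.

Lemma dvdn_add_excl x i j : i < j < i + M -> M %| x + i -> ~~ (M %| x + j).
Proof.
move=> ij Mi; have -> : x + j = x + i + (j - i) by lia.
by rewrite dvdn_addr // gtnNdvd; lia.
Qed.

(** Among 1, 2, 3 at most one j has M | P + j and at most one has M | f - j. *)
Lemma shift_choice f : 1 < f -> ~~ ((f == 2) && (M %| P + 1)) ->
  exists j, [/\ 0 < j < 4, j < f, ~~ (M %| P + j) & ~~ (M %| f - j)].
Proof.
move=> f1 ok.
have [f2|f2] : f = 2 \/ 2 < f by lia.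
  by exists 1; move: ok; rewrite f2 eqxx /= => ->; split=> //; rewrite gtnNdvd; lia.
have leM j : j < f -> M %| f - j -> M <= f - j by move=> jf; apply: dvdn_leq; lia.
have excl i j : i < j < 4 -> i < 3 -> M %| f - i -> ~~ (M %| f - j).
  move=> ij i3 Mi; have := leM _ (leq_trans i3 f2) Mi => leMi.
  have -> : f - j = f - i - (j - i) by lia.
  by rewrite dvdn_subr // ?gtnNdvd; lia.
have exclP i j : i < j < 4 -> M %| P + i -> ~~ (M %| P + j).
  by move=> ij; apply: dvdn_add_excl; lia.
have [P1|P1] := boolP (M %| P + 1).
  have [h|h] := boolP (M %| f - 2); last by exists 2; rewrite (exclP 1).
  have := leM _ f2 h; exists 3; split=> //; first by lia.
    exact: (exclP 1).
  exact: (excl 2).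
have [h|h] := boolP (M %| f - 1); last by exists 1; split=> //; lia.
have lef := leM _ (ltnW f2) h.
have [P2|P2] := boolP (M %| P + 2); last by exists 2; rewrite (excl 1).
exists 3; split=> //; [by lia|exact: (exclP 2)|exact: (excl 1)].
Qed.

(** Let x = r P, y = s P. If r + s < M - 1, the sum x + y is less than frob. Otherwise
    x + y = (M - 1) P = frob + M, and x, y may be rebalanced as t P, (M - 1 - t) P. One
    chooses t with t P = d + n M and moves d from this entry to z = frob - e. The first two
    entries now have the sum frob + M - d: for d > M this is less than frob, and if
    e = M + 1 one takes d = 2 or 3, so that e - d < M as in [low_near]. In the remaining
    case e = M + 2 and M | P + 1 an explicit chain of exchanges reaches [canon]. *)
Lemma low_mid x y e r s : W x -> W y -> x = r * P -> y = s * P -> gap e ->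
  M < e < P -> x + y + (frob - e) < frob.*2 -> low x y (frob - e).
Proof.
move=> wx wy xE yE ge eM lt2; have we := W_gap ge.
have cE := canonE; have cgt := canon_gt; have fE := frobE.
have ltx := W_lt wx; have lty := W_lt wy.
have xy : x + y = (r + s) * P by rewrite mulnDl xE yE.
have rsM : r + s < M.
  by rewrite ltnNge; apply/negP => le; have := leq_mul le (leqnn P); lia.
have predP : M.-1 * P + P = M * P by rewrite -mulSnr prednK //; lia.
have [rs|rs] : r + s = M.-1 \/ r + s < M.-1 by lia.
  have row t : t < M.-1 -> W (t * P).
    move=> tM; apply: W_mulP.
    have := leq_mul tM (leqnn P); rewrite mulSn; lia.
  have rM : r < M.-1.
    rewrite ltnNge; apply/negP => le; have := leq_mul le (leqnn P); lia.
  have sM : s < M.-1.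
    rewrite ltnNge; apply/negP => le; have := leq_mul le (leqnn P); lia.
  have bal t z : 0 < t < M.-1 -> low (t * P) ((M.-1 - t) * P) z -> low x y z.
    move=> tM; apply: low_swap => //; [by apply: row; lia|by apply: row; lia|].
    by rewrite -mulnDl xy rs subnKC //; lia.
  have move d : ~~ (M %| d) -> ~~ (M %| d + P) -> d < e -> gap (e - d) ->
      (forall x' y', W x' -> W y' -> x' + y' + d = x + y -> low x' y' (frob - (e - d))) ->
      low x y (frob - e).
    move=> Md MdP de ged lowd; have [|t [n [tM tE]]] := residueP Md MdP; first by lia.
    have wt : W (t * P) by apply: row; lia.
    have wt' : W ((M.-1 - t) * P) by apply: row; lia.
    have wn : W (n * M).
      by apply: W_mulM; have := W_lt wt; lia.
    have sumt : t * P + (M.-1 - t) * P = x + y by rewrite -mulnDl xy rs subnKC //; lia.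
    apply: (bal t) => //; apply: low_exch.
    apply: (@low_swap _ _ _ (n * M) (frob - (e - d))) => //; first exact: W_gap.
      by lia.
    by apply: low_exch; apply: lowd => //; lia.
  have [eM1|eM1] : e = M.+1 \/ M.+1 < e by lia.
    have [d [d2 Md]] : exists d, 1 < d < 4 /\ ~~ (M %| P + d).
      have [h|h] := boolP (M %| P + 2); last by exists 2.
      by exists 3; split=> //; apply: (dvdn_add_excl _ h); lia.
    apply: (move d); rewrite 1?[d + P]addnC //; try lia.
    - by rewrite gtnNdvd; lia.
    - by apply: gap_small; lia.
    by move=> x' y' wx' wy' xy'; apply: low_near => //; lia.
  have [/andP[/eqP eM2 MP1]|ok] := boolP ((e == M.+2) && (M %| P + 1)).
    have [K PK] := dvdnP MP1.
    have K2 : 2 * K + 2 <= P by have := leq_mul (leqnn K) M4; lia.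
    have KM : 2 * K * M = 2 * P + 2 by rewrite -mulnA -PK; lia.
    have PM2 : 2 * M + 2 * P + 2 <= P * M by have := leq_mul (leqnn P) M4; lia.
    have w2 : W (2 * P) by apply: row; lia.
    have w1 : W ((M.-1 - 1) * P) by apply: row; lia.
    have wn : W ((P - 2 * K - 2) * M).
      apply: W_mulM.
      by rewrite !mulnBl; lia.
    apply: (bal 1); first by lia.
    apply: low_exch.
    apply: (@low_swap _ _ _ (2 * P) ((P - 2 * K - 2) * M)) => //; first by apply: row; lia.
      by rewrite !mulnBl; lia.
    apply: low_exch.
    have wK : W (K.+1 * M).
      by apply: W_mulM; rewrite mulSn; lia.
    apply: (@low_swap _ _ _ canon (K.+1 * M)) => //; first exact: W_canon.
      by rewrite mulSn mulnBl; lia.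
    apply: low_end => //; [exact: W_canon|by right|].
    by rewrite mulSn !mulnBl; lia.
  have [j [j4 je jP jN]] : exists j, [/\ 0 < j < 4, j < e - M, ~~ (M %| P + j) & ~~ (M %| e - M - j)].
    by apply: shift_choice; [lia|apply: contra ok => /andP[/eqP eM2 ->]; rewrite andbT; lia].
  have NMj : ~~ (M %| M + j) by rewrite dvdn_addr // gtnNdvd; clear -j4 M4; lia.
  have NPj : ~~ (M %| M + j + P) by rewrite -addnA dvdn_addr // addnC.
  have ltMj : M + j < e by rewrite -ltn_subRL.
  have ged : gap (e - (M + j)).
    by rewrite subnDA; apply: gap_ltP => //; rewrite -subnDA; clear -eM; lia.
  apply: (move (M + j)) => //.
  move=> x' y' wx' wy' xy'; apply: low0 => //; first exact: W_gap.
  by clear -xy' j4 xy rs predP fE M4 MP; rewrite rs in xy; lia.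
apply: low0 => //; rewrite xy.
have : (r + s).+1 * P <= M.-1 * P by rewrite leq_mul2r; lia.
rewrite mulSn; lia.
Qed.

(** Induction on the distance e of z from frob: a generator less than e that occurs in x or
    y is moved to z. If e < M there is none to move, if e < P the generator [P] cannot be
    moved, and if e > P then no generator is left and x = y = 0. *)
Lemma lowP x y z : W x -> W y -> W z -> x + y + z < frob.*2 -> low x y z.
Proof.
have [n] := ubnP (frob - z); elim: n => // n IH in x y z *; move=> ltn wx wy wz.
have ltz := W_lt wz; have cE := canonE.
have gz : gap (frob - z) by apply: gap_frobB; [case: wz|lia].
set e := frob - z in gz ltn; have -> : z = frob - e by lia.
have e0 := gap_gt0 gz => sumlt.
have neM : e <> M by move=> h; apply: (gap_nsg gz); exists 1, 0; lia.
have neP : e <> P by move=> h; apply: (gap_nsg gz); exists 0, 1; lia.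
have [eM|eM] := ltnP e M; first by apply: low_near => //; lia.
have shift h u v : sg h -> 0 < h < e -> h <= u -> sg (u - h) -> W u -> W v ->
    u + v + (frob - e) < frob.*2 -> low u v (frob - e).
  move=> sh he hu suh wu wv lt2; apply: low_exch.
  have ltu := W_lt wu.
  have weh : W (frob - (e - h)) by apply: W_gap; apply: gapB => //; lia.
  apply: (@low_swap _ _ _ (u - h) (frob - (e - h))) => //.
  - by apply: W_gap.
  - by split=> //; rewrite /canon; lia.
  - by lia.
  by apply: low_exch; apply: IH => //; [lia|split=> //; rewrite /canon; lia|lia].
have exch u v : low v u (frob - e) -> low u v (frob - e).
  by apply: low_perm; apply/permP => a /=; lia.
have sM : sg M by exists 1, 0; lia.
have sP : sg P by exists 0, 1; lia.
have [[n1 [r1 xE]] _] := wx; have [[n2 [r2 yE]] _] := wy.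
have [n10|n10] := posnP n1; last first.
  apply: (shift M) => //; [lia|by case: (n1) xE n10 => // ? ->; rewrite mulSn; lia|].
  by exists n1.-1, r1; case: (n1) xE n10 => // ? ->; rewrite mulSn /=; lia.
have [n20|n20] := posnP n2; last first.
  apply/exch/(shift M) => //; [lia|by case: (n2) yE n20 => // ? ->; rewrite mulSn; lia| |lia].
  by exists n2.-1, r2; case: (n2) yE n20 => // ? ->; rewrite mulSn /=; lia.
rewrite n10 n20 !mul0n !add0n in xE yE.
have [eP|eP] := ltnP e P; first by apply: (low_mid wx wy xE yE) => //; lia.
have [r10|r10] := posnP r1; last first.
  apply: (shift P) => //; [lia|by case: (r1) xE r10 => // ? ->; rewrite mulSn; lia|].
  by exists 0, r1.-1; case: (r1) xE r10 => // ? ->; rewrite mulSn /=; lia.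
have [r20|r20] := posnP r2; last first.
  apply/exch/(shift P) => //; [lia|by case: (r2) yE r20 => // ? ->; rewrite mulSn; lia| |lia].
  by exists 0, r2.-1; case: (r2) yE r20 => // ? ->; rewrite mulSn /=; lia.
have we : W (frob - e) by apply: W_gap.
by apply: low_end => //; [left|]; rewrite xE r10 ?yE ?r20 ?mul0n; lia.
Qed.

Lemma W1 : ~ W 1.
Proof. by case=> [[[|n] [[|r] h]] _]; rewrite ?mulSn in h; lia. Qed.

Lemma W_frob x y : W x -> W y -> x + y <> frob.
Proof.
move=> [sx _] [sy _] xy; have /gap_nsg[] : gap (frob - x).
  by apply: gap_frobB => //; lia.
by rewrite -xy addKn.
Qed.

Lemma swap_size X Y : swap X Y -> size X = size Y.
Proof.
elim=> [s1 s2 /perm_size //|x y x' y' s _|s1 s2 s3 _ -> _ -> //]; exact: erefl.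
Qed.

Lemma swap_sum X Y : swap X Y -> sumn X = sumn Y.
Proof.
elim=> [s1 s2 /perm_sumn //|x y x' y' s [_ _ _ _ xy] /=|s1 s2 s3 _ -> _ -> //].
by rewrite !addnA xy.
Qed.

(** Sums from 2 frob on are the subject of [upP], smaller ones that of [lowP]. *)
Lemma endsP x y z : W x -> W y -> W z -> x + y + z <> frob.*2.-1 -> ends x y z.
Proof.
move=> wx wy wz ne; have [lt|le] := ltnP (x + y + z) frob.*2.
  by have [lo _] := lowP wx wy wz lt; apply: lo; lia.
have g t : W t -> gap (frob - t) by move=> wt; apply: gap_frobB; [case: wt|have := W_lt wt; lia].
have [ltx lty ltz] := And3 (W_lt wx) (W_lt wy) (W_lt wz).
have [|v [w [gv gw s]]] := upP (g _ wx) (g _ wy) (g _ wz); first by lia.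
exists canon, (frob - v), (frob - w); split; [by right|exact: W_gap|exact: W_gap|].
by move: s; rewrite /tri (subKn (ltnW ltx)) (subKn (ltnW lty)) (subKn (ltnW ltz)) subn1.
Qed.

Lemma specialP x y z : W x -> W y -> W z -> x + y + z = frob.*2.-1 ->
  swap [:: x; y; z] special.
Proof.
move=> wx wy wz e; have lt : x + y + z < frob.*2 by have := frob_gt0; lia.
by have [_] := lowP wx wy wz lt; apply.
Qed.

(** The normal form of a list: all entries but two are 0 or [canon], or all but three that
    form [special]. *)
Definition normal X := exists i j C,
  swap X (nseq i 0 ++ nseq j canon ++ C) /\
  ((exists a b, [/\ W a, W b & C = [:: a; b]]) \/ C = special).

Lemma normal_end e X : e = 0 \/ e = canon -> normal X -> normal (e :: X).
Proof.
move=> he [i [j [C [s hC]]]]; case: he => ->.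
  by exists i.+1, j, C; split=> //; apply: swaps_cons.
exists i, j.+1, C; split=> //; apply: swaps_trans (swaps_cons canon s) _.
by apply: swaps_perm; rewrite -cat1s perm_catCA.
Qed.

Lemma normal_swap X Y : swap X Y -> normal Y -> normal X.
Proof.
by move=> sXY [i [j [C [s hC]]]]; exists i, j, C; split=> //; apply: swaps_trans s.
Qed.

Lemma normal3 x y z : W x -> W y -> W z -> normal [:: x; y; z].
Proof.
move=> wx wy wz; have [e|ne] := eqVneq (x + y + z) frob.*2.-1.
  by exists 0, 0, special; split; [exact: specialP|right].
have [e [y' [z' [he wy' wz' s]]]] := endsP wx wy wz (elimN eqP ne).
apply: normal_swap s _; apply: normal_end => //.
by exists 0, 0, [:: y'; z']; split; [exact: swaps_refl|left; exists y', z'].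
Qed.

Lemma W_special2 : W (frob - 2) /\ W (frob - M.-1).
Proof. by split; apply: W_gap; apply: gap_small; lia. Qed.

(** Two suitable entries of [special] together with x form a triple whose sum is not
    2 frob - 1; it can be given an end, and the rest is a triple again. *)
Lemma normal4 x : W x -> normal (x :: special).
Proof.
move=> wx; have [w2 w3] := W_special2; have cgt := canon_gt; have cE := canonE.
have step y z t : W y -> W z -> W t -> x + y + z <> frob.*2.-1 ->
    perm_eq (x :: special) [:: x; y; z; t] -> normal (x :: special).
  move=> wy wz wt ne pe; have [e [y' [z' [he wy' wz' s]]]] := endsP wx wy wz ne.
  apply: normal_swap (swaps_perm _ pe) _.
  apply: normal_swap (swaps_catr [:: t] s) _; apply: normal_end => //=.
  exact: normal3.
have [xE|xE] := eqVneq x (frob - M.-1).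
  apply: (@step (frob - 2) (frob - M.-1) M) => //; [exact: WM|lia|].
  by apply/permP => a /=; lia.
by apply: (@step M (frob - 2) (frob - M.-1)) => //; [exact: WM|lia].
Qed.

Lemma normal_cons x X : W x -> normal X -> normal (x :: X).
Proof.
move=> wx [i [j [C [s hC]]]].
have nC : normal (x :: C).
  by case: hC => [[a [b [wa wb ->]]]|->]; [exact: normal3|exact: normal4].
apply: normal_swap (swaps_cons x s) _.
apply: (@normal_swap _ (nseq i 0 ++ nseq j canon ++ x :: C)).
  by apply: swaps_perm; apply/permP => a; rewrite /= !count_cat /=; lia.
elim: i {s} => [|i IH] /=; last by apply: normal_end => //; left.
by elim: j => [|j IH] //=; apply: normal_end => //; right.
Qed.

Lemma normalP X : {in X, forall x, W x} -> 1 < size X -> normal X.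
Proof.
elim: X => // x X IH wX; have wx : W x by apply: wX; rewrite mem_head.
have {}wX : {in X, forall y, W y} by move=> y yX; apply: wX; rewrite inE yX orbT.
case: X IH wX => [|y [|z X]] // IH wX _; last by apply: normal_cons => //; apply: IH.
exists 0, 0, [:: x; y]; split; first exact: swaps_refl.
by left; exists x, y; split=> //; apply: wX; rewrite mem_head.
Qed.

(** As a + b <= 2 canon, the numbers of entries [canon] differ by at most 2. If they differ
    by 1, then a, b are exchanged for [canon], a' + b' and then 0, a' + b' for a', b'. *)
Lemma normal_form2 i j a b i' j' a' b' : W a -> W b -> W a' -> W b' ->
  i + j = i' + j' -> j * canon + (a + b) = j' * canon + (a' + b') -> j <= j' ->
  swap (nseq i 0 ++ nseq j canon ++ [:: a; b]) (nseq i' 0 ++ nseq j' canon ++ [:: a'; b']).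
Proof.
move=> wa wb wa' wb' ij sums lejj; have cgt := canon_gt.
have [[_ lea] [_ leb]] := (wa, wb).
have [d jE] : exists d, j' = j + d by exists (j' - j); lia.
have abE : a + b = d * canon + (a' + b') by move: sums; rewrite jE mulnDl; lia.
have iE : i = i' + d by lia.
rewrite jE iE !nseqD.
case: d abE {jE iE} => [|[|[|d]]] abE; last by rewrite !mulSn in abE; lia.
- rewrite !cats0; do 2 apply: swaps_catl; apply: swaps_pair; split=> //.
- apply: (@swaps_trans _ _ _ (nseq i' 0 ++ nseq j canon ++ [:: a; b; 0])).
    by apply: swaps_perm; apply/permP => f; rewrite !count_cat /=; lia.
  apply: (@swaps_trans _ _ _ (nseq i' 0 ++ nseq j canon ++ [:: canon; a' + b'; 0])).
    do 2 apply: swaps_catl; apply: swaps_pair; split=> //; first exact: W_canon.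
      by apply: WD => //; have := canonE; lia.
    by lia.
  apply: (@swaps_trans _ _ _ (nseq i' 0 ++ nseq j canon ++ [:: 0; a' + b'; canon])).
    by apply: swaps_perm; apply/permP => f; rewrite !count_cat /=; lia.
  apply: (@swaps_trans _ _ _ (nseq i' 0 ++ nseq j canon ++ [:: a'; b'; canon])).
    do 2 apply: swaps_catl; apply: swaps_pair; split=> //; first exact: W0.
    by apply: WD => //; have := canonE; lia.
  by apply: swaps_perm; apply/permP => f; rewrite !count_cat /=; lia.
have [aE bE a'E b'E] : [/\ a = canon, b = canon, a' = 0 & b' = 0].
  by rewrite !mulSn mul0n in abE; split; lia.
by apply: swaps_perm; rewrite aE bE a'E b'E; apply/permP => f; rewrite !count_cat /=; lia.
Qed.

(** Two lists in normal form with equal size and sum are connected: for two pairs this is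
    [normal_form2], and a pair cannot occur against [special], since its sum would be
    1 mod canon, hence 1 or frob, and neither is a sum of two elements of [W]. *)
Theorem weight_connected X Y : {in X, forall x, W x} -> {in Y, forall y, W y} ->
  size X = size Y -> sumn X = sumn Y -> swap X Y.
Proof.
move=> wX wY sz sm; have [X1|X1] := leqP (size X) 1.
  move: sz sm X1; case: X {wX} => [|x [|? ?]] //; case: Y {wY} => [|y [|? ?]] //=.
    by move=> *; apply: swaps_refl.
  by move=> _ + _; rewrite !addn0 => ->; apply: swaps_refl.
have [i [j [C [sX hC]]]] := normalP wX X1.
have [|i' [j' [C' [sY hC']]]] := normalP wY; first by rewrite -sz.
apply: (swaps_trans sX); apply: (swaps_sym swapW_sym); apply: (swaps_trans sY).
have szE := etrans (etrans (esym (swap_size sX)) sz) (swap_size sY).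
have smE := etrans (etrans (esym (swap_sum sX)) sm) (swap_sum sY).
rewrite !size_cat !size_nseq in szE; rewrite !sumn_cat !sumn_nseq !mul0n !add0n in smE.
have cgt := canon_gt; have cE := canonE; have [w2 w3] := W_special2.
have sum_special : sumn special = canon.*2.+1 by rewrite /=; lia.
apply: (swaps_sym swapW_sym).
have mixed a b i1 j1 i2 j2 : W a -> W b -> i1 + (j1 + 2) = i2 + (j2 + 3) ->
    canon * j1 + (a + b) = canon * j2 + canon.*2.+1 -> False.
  move=> wa wb _ sE; have [[_ lea] [_ leb]] := (wa, wb); have nfr := W_frob wa wb.
  have [j2E|[d j2E]] : j2 + 2 < j1 \/ exists d, j2 + 2 = j1 + d.
  - by have [|] := leqP j1 (j2 + 2); [right; exists (j2 + 2 - j1); lia|left].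
  - have : canon * (j2 + 2).+1 <= canon * j1 by rewrite leq_mul2l j2E orbT.
    by rewrite mulnS mulnDr; lia.
  have : canon * (j2 + 2) = canon * (j1 + d) by rewrite j2E.
  rewrite !mulnDr => E; case: d j2E E => [|[|d]] _; rewrite ?mulnS => E; try lia.
  have ab1 : a + b = 1 by lia.
  by apply: W1; have [<-|<-] : a = 1 \/ b = 1 by lia.
case: hC szE smE => [[a [b [wa wb ->]]]|->]; case: hC' => [[a' [b' [wa' wb' ->]]]|->];
  rewrite ?sum_special /= => szE smE.
- have [jj|jj] := leqP j j'.
    by apply: normal_form2 => //; lia.
  by apply: (swaps_sym swapW_sym); apply: normal_form2 => //; lia.
- by case: (@mixed a b i j i' j') => //; lia.
- by case: (@mixed a' b' i' j' i j) => //; lia.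
have jE : j = j' by apply/eqP; rewrite -(@eqn_pmul2l canon); lia.
have -> : i = i' by lia.
by rewrite jE; apply: swaps_refl.
Qed.

End Semigroup.

(** * Exchanges of pairs in a trapezoid *)
Section LinearRows.
Variables (q S C : nat).
Hypothesis qS : q * S <= C.

(** The lattice points (n, s) with n, s >= 0, n + q s <= C and s <= S. *)
Definition valid (u : nat * nat) := (u.1 + q * u.2 <= C) && (u.2 <= S).
Definition swapL u v u' v' := [/\ valid u, valid v, valid u' & valid v'] /\
  (u.1 + v.1 = u'.1 + v'.1 /\ u.2 + v.2 = u'.2 + v'.2).
Notation swap := (swaps swapL).
Notation sum1 X := (sumn (map fst X)).
Notation sum2 X := (sumn (map snd X)).

Lemma swapL_sym u v u' v' : swapL u v u' v' -> swapL u' v' u v.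
Proof. by case=> [[? ? ? ?] [? ?]]; split. Qed.

Lemma swapL_inv X Y : swap X Y ->
  [/\ size X = size Y, sum1 X = sum1 Y, sum2 X = sum2 Y & all valid X = all valid Y].
Proof.
elim=> [s1 s2 s12|u v u' v' s [[vu vv vu' vv'] [e1 e2]] /=|s1 s2 s3 _ [-> -> -> ->] _ //].
  rewrite (perm_size s12) (perm_all _ s12).
  by split=> //; apply/perm_sumn/perm_map.
by rewrite vu vv vu' vv' !addnA e1 e2.
Qed.

(** By exchanges with the others, the first point takes as much of the total of the second
    coordinates as it can; [fill_cols] does the same for the first coordinate in the
    row reached. *)
Lemma fill_rows (u : nat * nat) X : all valid (u :: X) ->
  exists (u' : nat * nat) (X' : seq (nat * nat)), swap (u :: X) (u' :: X') /\ u'.2 = minn S (sum2 (u :: X)).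
Proof.
elim: X u => [|v X IH] u /=.
  case/andP=> /andP[_ uS] _; exists u, [::]; split; first exact: swaps_refl.
  by lia.
case/and3P=> vu vv vX.
pose s1 := minn S (u.2 + v.2); pose n1 := minn (u.1 + v.1) (C - q * s1).
pose u1 := (n1, s1); pose v1 := (u.1 + v.1 - n1, u.2 + v.2 - s1).
have qs1 : q * s1 <= C by apply: leq_trans qS; rewrite leq_mul2l geq_minl orbT.
have s1E : q * s1 + q * (u.2 + v.2 - s1) = q * u.2 + q * v.2.
  by rewrite -!mulnDr subnKC // geq_minr.
have s1S : s1 <= S by rewrite geq_minl.
have s1uv : s1 <= u.2 + v.2 by rewrite geq_minr.
have [vu1 vv1] : valid u1 /\ valid v1.
  have restS : u.2 + v.2 - s1 <= S by move: vu vv; rewrite /valid /s1; lia.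
  have : q * (u.2 + v.2 - s1) <= C by apply: leq_trans qS; rewrite leq_mul2l restS orbT.
  by move: vu vv; rewrite /valid /= /n1; lia.
have uv1 : swapL u v u1 v1 by split; [split|rewrite /= /n1; split; lia].
have [|u' [X' [sX u'2]]] := IH u1; first by rewrite /= vu1.
exists u', (v1 :: X'); split; last by rewrite u'2 /= /s1; lia.
apply: swaps_trans (swaps_pair X uv1) _.
apply: (swaps_trans (s2 := v1 :: u1 :: X)); first by apply: swaps_perm; apply/permP=> a /=; lia.
apply: swaps_trans (swaps_cons v1 sX) _.
by apply: swaps_perm; apply/permP=> a /=; lia.
Qed.

Lemma fill_cols (u : nat * nat) X : all valid (u :: X) ->
  exists X' : seq (nat * nat), swap (u :: X) ((minn (C - q * u.2) (sum1 (u :: X)), u.2) :: X').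
Proof.
elim: X u => [|v X IH] u /=.
  case/andP=> /andP[uC _] _; exists [::]; rewrite [X in (X, _)](_ : _ = u.1) -?surjective_pairing.
    exact: swaps_refl.
  by lia.
case/and3P=> vu vv vX.
pose n1 := minn (u.1 + v.1) (C - q * u.2).
pose u1 := (n1, u.2); pose v1 := (u.1 + v.1 - n1, v.2).
have [vu1 vv1] : valid u1 /\ valid v1 by move: vu vv; rewrite /valid /= /n1; lia.
have uv1 : swapL u v u1 v1 by split; [split|rewrite /= /n1; split; lia].
have [|X' sX] := IH u1; first by rewrite /= vu1.
exists (v1 :: X').
apply: swaps_trans (swaps_pair X uv1) _.
apply: (swaps_trans (s2 := v1 :: u1 :: X)); first by apply: swaps_perm; apply/permP=> a /=; lia.
apply: swaps_trans (swaps_cons v1 sX) _; rewrite /=.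
rewrite [X in (X, _)](_ : _ = minn (C - q * u.2) (u.1 + (v.1 + sum1 X))); last by rewrite /n1; lia.
by apply: swaps_perm; apply/permP=> a /=; lia.
Qed.

(** After filling, the first point depends only on the totals; the rest follows by
    induction. *)
Theorem linear_connected X Y : all valid X -> all valid Y -> size X = size Y ->
  sum1 X = sum1 Y -> sum2 X = sum2 Y -> swap X Y.
Proof.
have [n] := ubnP (size X); elim: n => // n IH in X Y *.
case: X => [|u X]; case: Y => [|v Y] //; first by move=> *; apply: swaps_refl.
move=> ltn vX vY sz e1 e2.
have [u1 [X1 [sX u12]]] := fill_rows vX; have [v1 [Y1 [sY v12]]] := fill_rows vY.
have [zX x1 x2 vX1] := swapL_inv sX; have [zY y1 y2 vY1] := swapL_inv sY.
have [|X2 sX2] := @fill_cols u1 X1; first by rewrite -vX1.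
have [|Y2 sY2] := @fill_cols v1 Y1; first by rewrite -vY1.
have {}sX := swaps_trans sX sX2; have {}sY := swaps_trans sY sY2.
rewrite -x1 u12 in sX; rewrite -y1 v12 -e1 -e2 in sY.
have [zX2 x1' x2' vX2] := swapL_inv sX; have [zY2 y1' y2' vY2] := swapL_inv sY.
apply: (swaps_trans sX); apply: (swaps_sym swapL_sym); apply: (swaps_trans sY).
apply: swaps_cons; apply: (swaps_sym swapL_sym).
move: vX2 vY2; rewrite vX vY => /esym/andP[_ vX2] /esym/andP[_ vY2].
move: sz zX2 zY2 ltn => /= sz zX2 zY2 ltn.
rewrite /= in e1 e2 x1' x2' y1' y2'; clear sX sY sX2 sY2.
by apply: IH => //; lia.
Qed.

(** Two points filled one after the other have second coordinates of sum 2 S, or the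
    whole total. *)
Lemma tall_pair t X : all valid X -> 1 < size X -> t <= 2 * S -> t <= sum2 X ->
  exists (u v : nat * nat) (X' : seq (nat * nat)), swap X [:: u, v & X'] /\ t <= u.2 + v.2.
Proof.
case: X => [|u [|v X]] // vX _ tS tX.
have [u1 [X1 [sX u12]]] := fill_rows vX; have [zX x1 x2 vX1] := swapL_inv sX.
case: X1 sX zX x1 x2 vX1 => // v1 X1 sX zX x1 x2 vX1.
have [|v2 [X2 [sX2 v22]]] := @fill_rows v1 X1; first by move: vX1; rewrite vX => /esym/andP[].
exists u1, v2, X2; split; first exact: swaps_trans sX (swaps_cons _ sX2).
by rewrite /= in u12 v22 x2 tX; clear -u12 v22 x2 tX tS; lia.
Qed.

End LinearRows.

Local Open Scope ring_scope.

(** * Ideals and reduction to lighter monomials *)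
Section IdealGen.
Variables (S : comNzRingType) (G : S -> Prop).

Lemma ideal_gen0 : ideal_gen G 0.
Proof. by exists 0, (fun=> 0), (fun=> 0); split; [case|rewrite big_ord0]. Qed.

Lemma ideal_genG P : G P -> ideal_gen G P.
Proof. by move=> GP; exists 1, (fun=> 1), (fun=> P); rewrite big_ord1 mul1r. Qed.

Lemma ideal_genD P Q : ideal_gen G P -> ideal_gen G Q -> ideal_gen G (P + Q).
Proof.
move=> [n [c [h [Gh ->]]]] [n' [c' [h' [Gh' ->]]]].
exists (n + n')%N, (fun i => match split i with inl j => c j | inr j => c' j end).
exists (fun i => match split i with inl j => h j | inr j => h' j end).
split=> [i|]; first by case: (split i).
rewrite big_split_ord; congr (_ + _); apply: eq_bigr => i _.
  by rewrite (unsplitK (inl i : 'I_n + 'I_n')).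
by rewrite (unsplitK (inr i : 'I_n + 'I_n')).
Qed.

Lemma ideal_genMl Q P : ideal_gen G P -> ideal_gen G (Q * P).
Proof.
move=> [n [c [h [Gh ->]]]]; exists n, (fun i => Q * c i), h; split=> //.
by rewrite mulr_sumr; apply: eq_bigr => i _; rewrite mulrA.
Qed.

Lemma ideal_genN P : ideal_gen G P -> ideal_gen G (- P).
Proof. by rewrite -mulN1r; apply: ideal_genMl. Qed.

End IdealGen.

Section Reduction.
Variables (K : fieldType) (r : nat) (G : {mpoly K[r]} -> Prop) (om : 'I_r -> nat).
Implicit Types (P Q : {mpoly K[r]}) (t : 'X_{1..r}) (X Y : seq 'I_r).
Notation I := (ideal_gen G).

Definition wt t := (\sum_i t i * om i)%N.

Lemma wtD t1 t2 : wt (t1 + t2)%MM = (wt t1 + wt t2)%N.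
Proof. by rewrite /wt -big_split; apply: eq_bigr => i _; rewrite mnmDE mulnDl. Qed.

Lemma wt1 i : wt U_(i)%MM = om i.
Proof.
rewrite /wt (bigD1 i) //= mnm1E eqxx mul1n big1 ?addn0 // => j ji.
by rewrite mnm1E eq_sym (negPf ji).
Qed.

Definition lighter d w Q := forall t, Q@_t != 0 -> mdeg t = d /\ (wt t < w)%N.
(** Congruent to a lighter combination modulo the ideal. *)
Definition red d w P := exists2 Q, lighter d w Q & I (P - Q).

Lemma lighter0 d w : lighter d w 0.
Proof. by move=> t; rewrite mcoeff0 eqxx. Qed.

Lemma lowD d w P Q : lighter d w P -> lighter d w Q -> lighter d w (P + Q).
Proof.
move=> hP hQ t; rewrite mcoeffD; have [P0|/hP //] := eqVneq P@_t 0.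
by rewrite P0 add0r => /hQ.
Qed.

Lemma lowZ d w c P : lighter d w P -> lighter d w (c *: P).
Proof. by move=> hP t; rewrite mcoeffZ mulf_eq0 negb_or => /andP[_ /hP]. Qed.

Lemma low_sum d w (J : Type) (s : seq J) (p : pred J) (E : J -> {mpoly K[r]}) :
  (forall j, p j -> lighter d w (E j)) -> lighter d w (\sum_(j <- s | p j) E j).
Proof. by move=> h; apply: big_ind => //; [exact: lighter0|exact: lowD]. Qed.

Lemma lowX d w t : mdeg t = d -> (wt t < w)%N -> lighter d w 'X_[t].
Proof. by move=> dt wtt t'; rewrite mcoeffX; case: (eqVneq t t') => [<-//|_]; rewrite /= mulr0n eqxx. Qed.

Lemma lowMX d w t Q : lighter d w Q -> lighter (mdeg t + d) (wt t + w) ('X_[t] * Q).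
Proof.
move=> hQ t'; rewrite -mcoeff_msupp mulrC => h.
have := msuppMX Q t => /perm_mem/(_ t'); rewrite h => /esym/mapP[u].
by rewrite mcoeff_msupp => /hQ[du wu ->]; rewrite mdegD wtD ltn_add2l; split; rewrite ?du.
Qed.

Lemma red_low d w Q : lighter d w Q -> red d w Q.
Proof. by exists Q; rewrite ?subrr //; apply: ideal_gen0. Qed.

Lemma red_ideal d w P : I P -> red d w P.
Proof. by exists 0; rewrite ?subr0 //; apply: lighter0. Qed.

Lemma redD d w P Q : red d w P -> red d w Q -> red d w (P + Q).
Proof.
move=> [P' lP IP] [Q' lQ IQ]; exists (P' + Q'); first exact: lowD.
by rewrite opprD addrACA; apply: ideal_genD.
Qed.

Lemma redZ d w c P : red d w P -> red d w (c *: P).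
Proof.
move=> [Q lQ IQ]; exists (c *: Q); first exact: lowZ.
by rewrite -scalerBr -mul_mpolyC; apply: ideal_genMl.
Qed.

Lemma red_sum d w (J : Type) (s : seq J) (p : pred J) (E : J -> {mpoly K[r]}) :
  (forall j, p j -> red d w (E j)) -> red d w (\sum_(j <- s | p j) E j).
Proof.
move=> h; apply: big_ind => //; [exact/red_low/lighter0|exact: redD].
Qed.

Lemma redMX d w t P : red d w P -> red (mdeg t + d) (wt t + w) ('X_[t] * P).
Proof.
move=> [Q lQ IQ]; exists ('X_[t] * Q); first exact: lowMX.
by rewrite -mulrBr; apply: ideal_genMl.
Qed.

Definition mnm X : 'X_{1..r} := (\sum_(i <- X) U_(i))%MM.

Lemma mnm_nil : mnm [::] = 0%MM.
Proof. by rewrite /mnm big_nil. Qed.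

Lemma mnm_cons i X : mnm (i :: X) = (U_(i) + mnm X)%MM.
Proof. by rewrite /mnm big_cons. Qed.

Lemma mdeg_mnm X : mdeg (mnm X) = size X.
Proof.
elim: X => [|i X IH]; first by rewrite /mnm big_nil mdeg0.
by rewrite mnm_cons mdegD mdeg1 IH.
Qed.

Lemma wt_mnm X : wt (mnm X) = sumn (map om X).
Proof.
elim: X => [|i X IH]; first by rewrite /mnm big_nil /wt big1 // => j _; rewrite mnm0E.
by rewrite mnm_cons wtD wt1 IH.
Qed.

Lemma mnm_perm X Y : perm_eq X Y -> mnm X = mnm Y.
Proof. by move=> XY; apply: perm_big. Qed.

Lemma mnm_surj t : exists X, mnm X = t.
Proof.
exists (flatten [seq nseq (t i) i | i <- enum 'I_r]).
rewrite /mnm big_flatten big_map /= [RHS]multinomUE_id big_enum.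
apply: eq_bigr => i _; rewrite big_nseq.
by elim: (t i) => [|n IH] /=; rewrite ?mulm0n // IH mulmS.
Qed.

Lemma mnm_cat X Y : mnm (X ++ Y) = (mnm X + mnm Y)%MM.
Proof. by rewrite /mnm big_cat. Qed.

(** A congruence for pairs, multiplied by the monomial of the unchanged entries, gives one
    for each exchange; hence it propagates along chains of exchanges. *)
Lemma swaps_red (T : eqType) (f : T -> 'I_r) (R : T -> T -> T -> T -> Prop) :
  (forall x y x' y', R x y x' y' ->
     (om (f x) + om (f y) = om (f x') + om (f y'))%N /\
     red 2 (om (f x) + om (f y)) ('X_[mnm [:: f x; f y]] - 'X_[mnm [:: f x'; f y']])) ->
  forall A B, swaps R A B -> let X := map f A in let Y := map f B in
    [/\ size X = size Y, sumn (map om X) = sumn (map om Y) &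
        red (size X) (sumn (map om X)) ('X_[mnm X] - 'X_[mnm Y])].
Proof.
move=> hR A B; elim=> {A B} [A B AB|x y x' y' A /hR[wE rE]|A B C _ [s1 w1 r1] _ [s2 w2 r2]] /=.
- rewrite !size_map (perm_size AB) (mnm_perm (perm_map f AB)) subrr.
  split=> //; first by apply/perm_sumn/perm_map/perm_map.
  exact/red_low/lighter0.
- rewrite !addnA wE; split=> //.
  set Z := map f A; rewrite -[[:: f x, f y & Z]]/([:: f x; f y] ++ Z) -[[:: f x', f y' & Z]]/([:: f x'; f y'] ++ Z).
  rewrite !mnm_cat !mpolyXD -mulrBl mulrC.
  have := redMX (mnm Z) rE; rewrite wt_mnm mdeg_mnm wE.
  by rewrite addn2 [X in red _ X _]addnC.
- split; [exact: etrans s2|exact: etrans w2|].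
  have -> : 'X_[mnm (map f A)] - 'X_[mnm (map f C)] =
      ('X_[mnm (map f A)] - 'X_[mnm (map f B)]) + ('X_[mnm (map f B)] - 'X_[mnm (map f C)])
    :> {mpoly K[r]} by rewrite addrA subrK.
  by apply: redD => //; rewrite s1 w1.
Qed.

(** Induction on a strict bound w + 1 for the weights in P. The part of weight w is lighter
    modulo the ideal, or it is congruent to c t0 for one monomial t0 of weight w and a scalar
    c, and then c = 0 because [phi] maps P to 0. Either way P is congruent to a combination
    of weights less than w. *)
Lemma ideal_of_reduction (A : zmodType) (phi : {additive {mpoly K[r]} -> A}) d :
  (forall P, I P -> phi P = 0) ->
  (forall w, (forall t, mdeg t = d -> wt t = w -> red d w 'X_[t]) \/
     ((forall t t', mdeg t = d -> mdeg t' = d -> wt t = w -> wt t' = w ->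
          red d w ('X_[t] - 'X_[t'])) /\
      (forall t Q c, mdeg t = d -> wt t = w -> lighter d w Q ->
          phi (c *: 'X_[t] + Q) = 0 -> c = 0))) ->
  forall P, (forall t, P@_t != 0 -> mdeg t = d) -> phi P = 0 -> I P.
Proof.
move=> Iphi hw P dP.
have {dP} : lighter d (\max_(t <- msupp P) wt t).+1 P.
  move=> t tP; split; first exact: dP.
  by rewrite ltnS; apply: (@leq_bigmax_seq _ _ predT); rewrite ?mcoeff_msupp.
move: (_.+1) => w; elim: w P => [|w IH] P lP P0.
  suff -> : P = 0 by apply: ideal_gen0.
  by apply/mpolyP => t; rewrite mcoeff0; apply/eqP/negPn/negP => /lP[].
pose top := \sum_(t <- msupp P | wt t == w) P@_t *: 'X_[t].
pose rest := \sum_(t <- msupp P | wt t != w) P@_t *: 'X_[t].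
have PE : P = top + rest by rewrite {1}[P]mpolyE (bigID (fun t => wt t == w)).
have restl : lighter d w rest.
  rewrite /rest big_seq_cond; apply: low_sum => t /andP[]; rewrite mcoeff_msupp => /lP[dt wtt] nw.
  by apply/lowZ/lowX => //; rewrite ltn_neqAle nw.
have finish Q : lighter d w Q -> I (P - Q) -> I P.
  move=> lQ IQ; rewrite -[P](subrK Q); apply: ideal_genD => //.
  by apply: IH => //; have := Iphi _ IQ; rewrite raddfB P0 sub0r => /eqP; rewrite oppr_eq0 => /eqP.
have [hr|[hc hi]] := hw w.
  have [Q lQ IQ] : red d w top.
    rewrite /top big_seq_cond; apply: red_sum => t /andP[]; rewrite mcoeff_msupp => /lP[dt _] /eqP wtt.
    exact/redZ/hr.
  by apply: (finish (Q + rest)); [exact: lowD|rewrite PE opprD addrACA subrr addr0].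
have [/hasP[t0 t0P /eqP wt0]|/hasPn none] := boolP (has (fun t => wt t == w) (msupp P)); last first.
  apply: (finish rest) => //; rewrite PE /top big_seq_cond big_pred0 ?add0r ?subrr; first exact: ideal_gen0.
  by move=> t; apply/negP => /andP[/none/negPf->].
move: t0P; rewrite mcoeff_msupp => /lP[dt0 _].
pose c := \sum_(t <- msupp P | wt t == w) P@_t.
have [Q lQ IQ] : red d w (top - c *: 'X_[t0]).
  rewrite /top /c scaler_suml -sumrB big_seq_cond; apply: red_sum => t /andP[].
  rewrite mcoeff_msupp => /lP[dt _] /eqP wtt.
  by rewrite -scalerBr; apply/redZ/hc.
have PQ : P - (c *: 'X_[t0] + (Q + rest)) = top - c *: 'X_[t0] - Q.
  by rewrite PE; ring.
have c0 : c = 0.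
  apply: (hi t0 (Q + rest)) => //; first exact: lowD.
  have := Iphi _ IQ; rewrite -PQ raddfB P0 sub0r => /eqP.
  by rewrite oppr_eq0 => /eqP.
apply: (finish (Q + rest)); first exact: lowD.
by move: IQ; rewrite -PQ c0 scale0r add0r.
Qed.

End Reduction.

(** * Subfields generated by finitely many elements *)
Section Adjoin.
Variables (L F : fieldType) (iota : {rmorphism L -> F}).

Section Tuple.
Variables (n : nat) (s : n.-tuple F).
Notation ev := (mmap iota (tnth s)).
Notation Ls := (adjoin iota s).

Lemma adjoin_mpoly P : Ls (ev P).
Proof. by exists P, 1; rewrite rmorph1 oner_eq0 divr1. Qed.

Lemma adjoinC c : Ls (iota c).
Proof. by have := adjoin_mpoly c%:MP; rewrite mmapC. Qed.

Lemma adjoin_tnth i : Ls (tnth s i).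
Proof. by have := adjoin_mpoly 'X_i; rewrite mmapX mmap1U. Qed.

Lemma adjoinD z1 z2 : Ls z1 -> Ls z2 -> Ls (z1 + z2).
Proof.
move=> [P1 [Q1 [n1 ->]]] [P2 [Q2 [n2 ->]]]; exists (P1 * Q2 + P2 * Q1), (Q1 * Q2).
by rewrite !(rmorphD, rmorphM) mulf_neq0 // addf_div.
Qed.

Lemma adjoinM z1 z2 : Ls z1 -> Ls z2 -> Ls (z1 * z2).
Proof.
move=> [P1 [Q1 [n1 ->]]] [P2 [Q2 [n2 ->]]]; exists (P1 * P2), (Q1 * Q2).
by rewrite !rmorphM mulf_neq0 // mulf_div.
Qed.

Lemma adjoinV z : Ls z -> Ls z^-1.
Proof.
move=> [P [Q [Q0 ->]]]; have [P0|P0] := eqVneq (ev P) 0.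
  by rewrite P0 mul0r invr0 -(rmorph0 iota); apply: adjoinC.
by exists Q, P; rewrite invf_div.
Qed.

Lemma adjoinN z : Ls z -> Ls (- z).
Proof. by rewrite -mulN1r -(rmorphN1 iota); apply: adjoinM; apply: adjoinC. Qed.

Lemma adjoinX z k : Ls z -> Ls (z ^+ k).
Proof.
move=> hz; elim: k => [|k IH]; last by rewrite exprS; apply: adjoinM.
by rewrite expr0 -(rmorph1 iota); apply: adjoinC.
Qed.

End Tuple.

Variable y : F.

Lemma adjoin_poly P : adjoin iota [tuple y] (map_poly iota P).[y].
Proof.
have hy : adjoin iota [tuple y] y by have := adjoin_tnth [tuple y] ord0; rewrite tnth0.
elim/poly_ind: P => [|P c IH]; first by rewrite rmorph0 horner0 -(rmorph0 iota); apply: adjoinC.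
rewrite rmorphD rmorphM /= map_polyX map_polyC hornerD hornerMX hornerC.
by apply: adjoinD; [apply: adjoinM|apply: adjoinC].
Qed.

(** The field L(y) consists of fractions of polynomials in one indeterminate. *)
Lemma adjoin1P z : adjoin iota [tuple y] z ->
  exists P Q : {poly L}, (map_poly iota Q).[y] != 0 /\ z = (map_poly iota P).[y] / (map_poly iota Q).[y].
Proof.
pose uni (P : {mpoly L[1]}) := mmap (@polyC L) (fun=> 'X) P.
have uniE P : (map_poly iota (uni P)).[y] = mmap iota (tnth [tuple y]) P.
  rewrite /uni /mmap rmorph_sum horner_sum; apply: eq_bigr => t _ /=.
  rewrite /mmap1 !big_ord1 tnth0.
  by rewrite rmorphM rmorphXn /= map_polyC map_polyX hornerM hornerC hornerXn.
by move=> [P [Q [Q0 ->]]]; exists (uni P), (uni Q); rewrite !uniE.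
Qed.

End Adjoin.

(** * The index set *)
Section IndexSet.
Local Open Scope nat_scope.
Variables (p q l : nat).
Notation r := #|index_set p q l|.
Implicit Types (i j k : 'I_r).

Lemma indexP i : [/\ (0 < imu i < p), (imu i * l %/ p <= iN i) & (iN i + 2 <= imu i * q)].
Proof.
have := enum_valP i; rewrite inE => /and3P[mu0 leN Nle].
by split=> //; rewrite mu0 ltn_ord.
Qed.

Lemma index_inj i j : iN i = iN j -> imu i = imu j -> i = j.
Proof.
move=> Ne mue; apply/enum_val_inj; move: Ne mue; rewrite /iN /imu.
case: (enum_val i) => [[? ?] [? ?]]; case: (enum_val j) => [[? ?] [? ?]] /= *.
by subst; congr (_, _); apply: val_inj.
Qed.

Lemma index_ex N mu : (0 < mu < p) -> (mu * l %/ p <= N) -> (N + 2 <= mu * q) ->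
  exists i, iN i = N /\ imu i = mu.
Proof.
move=> /andP[mu0 mup] leN Nle.
have Npq : (N < p * q) by have := leq_mul (ltnW mup) (leqnn q); lia.
pose t := (Ordinal Npq, Ordinal mup).
have tA : t \in index_set p q l by rewrite inE /= mu0 leN.
by exists (enum_rank_in tA t); rewrite /iN /imu enum_rankK_in.
Qed.

Definition sumN (A : seq 'I_r) := sumn (map (@iN p q l) A).
Definition summu (A : seq 'I_r) := sumn (map (@imu p q l) A).

Definition deg (A : seq 'I_r) := size A.

Lemma mdeg_deg (A : seq 'I_r) : mdeg (mnm A) = deg A.
Proof. exact: mdeg_mnm. Qed.

Lemma multidegE (A : seq 'I_r) : multideg (mnm A) = (deg A, sumN A, summu A).
Proof. by rewrite /multideg mdeg_deg /sumN /summu -!wt_mnm. Qed.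

Hypotheses (p0 : (0 < p)) (lp : (0 < l < p)) (lq : (l.+1 <= p.-1 * q)).
Let q0 : 0 < q. Proof. by case: (q) lq; rewrite ?muln0. Qed.

(** The N that occur with a given mu form an interval, which for mu = p - 1 begins at l - 1.
    The sums of elements of two intervals form an interval. *)
Lemma two_rows mu N : (0 < mu < p) -> (l.-1 + mu * l %/ p <= N) ->
  (N + 4 <= (p.-1 + mu) * q) -> (mu * l %/ p + 2 <= mu * q) ->
  exists i j, (iN i + iN j = N) /\ (imu i + imu j = p.-1 + mu).
Proof.
move=> mup leN Nle ne.
have rowp : (p.-1 * l %/ p = l.-1).
  have -> : (p.-1 * l = l.-1 * p + (p - l)).
    have [l' lE] : exists l', l = l'.+1 by exists l.-1; lia.
    have [p1 p1E] : exists p1, p = (p1 + l').+2 by exists (p - l'.+2); lia.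
    by rewrite lE p1E /=; nia.
  by rewrite divnMDl // divn_small ?addn0 //; lia.
pose n2 := minn (N - l.-1) (mu * q - 2).
rewrite mulnDl in Nle.
have ifl := @index_ex n2 mu mup; set fl := mu * l %/ p in ifl leN ne.
have [||j [jN jmu]] := ifl; [rewrite /n2; lia|rewrite /n2; lia|].
have [|||i [iN' imu']] := @index_ex (N - n2) p.-1; [lia|rewrite rowp /n2; lia|rewrite /n2; lia|].
exists i, j; rewrite jN jmu iN' imu'; split=> //; rewrite /n2; lia.
Qed.

(** The floor of a sum exceeds the sum of the floors by at most 1. *)
Lemma low_sum_rows i j : (imu i + imu j) * l %/ p <= (iN i + iN j).+1.
Proof.
have [_ hi _] := indexP i; have [_ hj _] := indexP j.
have di := divn_eq (imu i * l) p; have dj := divn_eq (imu j * l) p.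
have mi := ltn_pmod (imu i * l) p0; have mj := ltn_pmod (imu j * l) p0.
rewrite mulnDl -ltnS ltn_divLR //.
apply: (@leq_trans ((imu i * l %/ p + imu j * l %/ p).+2 * p)); first by rewrite !mulSn mulnDl; lia.
by rewrite leq_mul2r; lia.
Qed.

Lemma floor1 mu : l = 1 -> mu < p -> mu * l %/ p = 0.
Proof. by move=> -> mup; rewrite muln1 divn_small. Qed.

Definition pairsum i j := (iN i + iN j, imu i + imu j).

(** The monomials under the sum of a G2 relation exist for every pair of variables whose sum
    of mu is at most p - 2; take them from the rows p - 1 and mu + mu'. For l <> 1 the bound
    h >= p - 1 makes up for the rounding in [low_sum_rows]. *)
Lemma G2_terms i j h : imu i + imu j + 2 <= p -> jmin p l <= h <= p.-1 * q ->
  exists i' j', pairsum i' j' = (iN i + iN j + h, imu i + imu j + p.-1).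
Proof.
move=> mup hh; have lo := low_sum_rows i j.
have [mi hi Hi] := indexP i; have [mj hj Hj] := indexP j.
have [||||i' [j' [eN emu]]] := @two_rows (imu i + imu j) (iN i + iN j + h).
- by lia.
- move: hh; rewrite /jmin; case: eqP => [l1|/eqP l1] hh; last by lia.
  by rewrite floor1 //; lia.
- by rewrite !mulnDl; lia.
- by move: lo; rewrite [(_ + _) * q]mulnDl; lia.
by exists i', j'; rewrite /pairsum eN emu; congr (_, _); lia.
Qed.

(** For l = 1 the monomial of degree shifted by (0, l, p) exists as well, from the rows
    p - 1 and mu + mu' + 1. *)
Lemma G2_last i j : l = 1 -> imu i + imu j + 2 <= p ->
  exists i' j', pairsum i' j' = (iN i + iN j + l, imu i + imu j + p).
Proof.
move=> l1 mup.
have [mi hi Hi] := indexP i; have [mj hj Hj] := indexP j.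
have [||||i' [j' [eN emu]]] := @two_rows (imu i + imu j).+1 (iN i + iN j + l).
- by lia.
- by rewrite floor1 //; lia.
- have -> : p.-1 + (imu i + imu j).+1 = p + imu i + imu j by lia.
  by rewrite !mulnDl; have := leq_pmulr p q0; lia.
- by rewrite floor1 // ?mulSn ?mulnDl; lia.
by exists i', j'; rewrite /pairsum eN emu; congr (_, _); lia.
Qed.

End IndexSet.

(** * Monomials in x and Y on the curve *)
Section Curve.
Variables (K F : fieldType) (iota : {rmorphism K -> F}) (p q l : nat).
Variables (a : {poly K}) (x X : F).
Hypotheses (p0 : (0 < p)%N) (lp : (0 < l < p)%N) (q0 : (0 < q)%N).
Hypothesis hF : AS_function_field iota p l a x X.
Hypotheses (a_neq0 : a != 0) (a_size : (size a <= q.+1)%N).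
Hypothesis a_dvd : l != 1%N -> 'X %| a.

Let ax := (map_poly iota a).[x].
(** The function Y = a(x) X, integral over K[x]. *)
Definition Yf := ax * X.
Notation Y := Yf.

Lemma ax_neq0 : ax != 0.
Proof. by case: hF => h _ _; apply: h. Qed.

Lemma Y_rel : Y ^+ p = ax ^+ p.-1 * Y + x ^+ l.
Proof.
case: hF => _ h _; rewrite /Yf exprMn.
have -> : X ^+ p = X + x ^+ l / ax ^+ p by rewrite -h addrCA subrr addr0.
rewrite mulrDr mulrCA divff ?mulr1 ?expf_neq0 ?ax_neq0 //.
by rewrite mulrA -exprSr prednK.
Qed.

Lemma axpE : ax ^+ p.-1 = \sum_(jmin p l <= h < (p.-1 * q).+1) iota (a ^+ p.-1)`_h * x ^+ h.
Proof.
have hsz : (size (map_poly iota (a ^+ p.-1)) <= (p.-1 * q).+1)%N.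
  rewrite size_map_poly; apply: leq_trans (size_poly_exp_leq _ _) _.
  by rewrite ltnS mulnC leq_mul2l; case: (size a) a_size => [|n]; rewrite ?orbT // ltnS => ->; rewrite orbT.
rewrite /ax -horner_exp -rmorphXn /= (horner_coef_wide _ hsz).
have jle : (jmin p l <= (p.-1 * q).+1)%N.
  by rewrite /jmin; case: eqP => // _; rewrite (leq_trans _ (leqnSn _)) // leq_pmulr.
rewrite -(big_mkord xpredT (fun h => (map_poly iota (a ^+ p.-1))`_h * x ^+ h)).
rewrite (big_cat_nat (leq0n _) jle) /= big1_seq ?add0r => [|h].
  by apply: eq_bigr => h _; rewrite coef_map.
rewrite mem_index_iota /jmin /= coef_map; case: eqP => [|/eqP/a_dvd/dvdpP[b ->]] //= hp.
by rewrite exprMn coefMXn hp rmorph0 mul0r.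
Qed.

Definition mono N s := x ^+ N * Y ^+ s.

(** The equation of Y, multiplied by x^N Y^(s - p). *)
Lemma mono_rel N s : (p <= s)%N -> mono N s = mono (N + l) (s - p)
  + \sum_(jmin p l <= h < (p.-1 * q).+1) iota (a ^+ p.-1)`_h * mono (N + h) (s - p.-1).
Proof.
move=> ps; rewrite /mono; have {1}-> : s = (s - p + p)%N by lia.
rewrite exprD Y_rel axpE; set S := \sum_(_ <= h < _) _.
transitivity (x ^+ (N + l) * Y ^+ (s - p) + S * (x ^+ N * Y ^+ (s - p) * Y)).
  by rewrite exprD; ring.
congr (_ + _); rewrite /S mulr_suml; apply: eq_bigr => h _.
have -> : (s - p.-1 = s - p + 1)%N by lia.
by rewrite !exprD; ring.
Qed.

(** The combinations of the x^N Y^s with s < p and [C N s], which are independent over K.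
    The coefficients of Y^s are collected in a polynomial in x. *)
Definition spanned (C : nat -> nat -> bool) z := exists Q : nat -> {poly K},
  z = \sum_(s < p) (map_poly iota (Q s)).[x] * Y ^+ s /\
  forall s N, (s < p)%N -> (Q s)`_N != 0 -> C N s.

Lemma spannedD C z1 z2 : spanned C z1 -> spanned C z2 -> spanned C (z1 + z2).
Proof.
move=> [Q1 [-> h1]] [Q2 [-> h2]]; exists (fun s => Q1 s + Q2 s); split.
  by rewrite -big_split; apply: eq_bigr => s _; rewrite rmorphD hornerD mulrDl.
move=> s N sp; rewrite coefD; have [e|/(h1 _ _ sp) //] := eqVneq (Q1 s)`_N 0.
by rewrite e add0r; apply: h2.
Qed.

Lemma spannedZ C c z : spanned C z -> spanned C (iota c * z).
Proof.
move=> [Q [-> h]]; exists (fun s => c *: Q s); split.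
  rewrite mulr_sumr; apply: eq_bigr => s _.
  by rewrite -mul_polyC rmorphM /= map_polyC hornerM hornerC mulrA.
by move=> s N sp; rewrite coefZ mulf_eq0 negb_or => /andP[_]; apply: h.
Qed.

Lemma spannedN C z : spanned C z -> spanned C (- z).
Proof. by move=> /(spannedZ (-1)); rewrite rmorphN1 mulN1r. Qed.

Lemma spanned0 C : spanned C 0.
Proof.
exists (fun=> 0); split; last by move=> s N _; rewrite coef0 eqxx.
by rewrite big1 // => s _; rewrite rmorph0 horner0 mul0r.
Qed.

Lemma spanned_sum C (J : Type) (s : seq J) (P : pred J) (E : J -> F) :
  (forall t, P t -> spanned C (E t)) -> spanned C (\sum_(t <- s | P t) E t).
Proof. by move=> h; apply: big_ind => //; [exact: spanned0|exact: spannedD]. Qed.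

Lemma spanned_mono (C : nat -> nat -> bool) N s : (s < p)%N -> C N s -> spanned C (mono N s).
Proof.
move=> sp CNs; exists (fun s' => if s' == s then 'X^N else 0); split.
  rewrite (bigD1 (Ordinal sp)) //= eqxx map_polyXn hornerXn big1 ?addr0 // => i /negPf ne.
  by rewrite -[(i : nat) == s]/(i == Ordinal sp) ne rmorph0 horner0 mul0r.
move=> s' N' _; case: (eqVneq s' s) => [->|]; last by rewrite coef0 eqxx.
by rewrite coefXn; case: (eqVneq N' N) => [->|] //; rewrite eqxx.
Qed.

Lemma spanned_free (Q : nat -> {poly K}) :
  \sum_(s < p) (map_poly iota (Q s)).[x] * Y ^+ s = 0 -> forall s, (s < p)%N -> Q s = 0.
Proof.
case: (hF) => xtr _ [_ _ free] sum0 s sp.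
have := free (fun t => (map_poly iota (Q t * a ^+ t)).[x]) (fun t => adjoin_poly _ _ _).
move=> /(_ _ (Ordinal sp)) /= h.
have {}h : (map_poly iota (Q s * a ^+ s)).[x] = 0.
  apply: h; rewrite -{}[RHS]sum0; apply: eq_bigr => i _.
  by rewrite rmorphM rmorphXn hornerM horner_exp /Yf exprMn mulrA.
apply/eqP; have : Q s * a ^+ s == 0 by apply: contraT => /xtr; rewrite h eqxx.
by rewrite mulf_eq0 expf_eq0 (negPf a_neq0) andbF orbF.
Qed.

Lemma spanned_notin (C : nat -> nat -> bool) c N s : (s < p)%N -> ~~ C N s ->
  spanned C (iota c * mono N s) -> c = 0.
Proof.
move=> sp nC [Q [QE hQ]].
pose R s' := Q s' - (if s' == s then c *: 'X^N else 0).
have /spanned_free/(_ _ sp) : \sum_(s' < p) (map_poly iota (R s')).[x] * Y ^+ s' = 0.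
  under eq_bigr do rewrite /R rmorphB hornerD hornerN mulrBl.
  rewrite sumrB -QE (bigD1 (Ordinal sp)) //= eqxx big1 ?addr0 => [|i ne].
    by rewrite -mul_polyC rmorphM /= map_polyC map_polyXn hornerM hornerC hornerXn /mono mulrA subrr.
  by rewrite -[(i : nat) == s]/(i == Ordinal sp) (negPf ne) rmorph0 horner0 mul0r.
rewrite /R eqxx => /eqP; rewrite subr_eq0 => /eqP Qs.
apply/eqP; apply: contraNT nC => c0; apply: hQ => //.
by rewrite Qs coefZ coefXn eqxx mulr1.
Qed.

(** Rewriting Y^p replaces (N, s) by (N + l, s - p), of equal order p N + l s, or by
    (N + h, s - p + 1) with h >= p - 1, of higher order. *)
Lemma mono_high v N s : l != 1%N -> (v < p * N + l * s)%N ->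
  spanned (fun N' s' => v < p * N' + l * s')%N (mono N s).
Proof.
move=> l1; have [n] := ubnP s; elim: n => // n IH in N s *.
move=> sn hv; have [sp|ps] := ltnP s p; first exact: spanned_mono.
rewrite mono_rel //; apply: spannedD; first by apply: IH; nia.
rewrite big_nat_cond; apply: spanned_sum => h /andP[/andP[hj _] _].
apply: spannedZ; apply: IH; first by lia.
by move: hj; rewrite /jmin (negPf l1); nia.
Qed.

(** Only the term x^l of Y^p keeps the order p N + l s; using it s / p times leaves the
    leading term. *)
Lemma mono_lead N s : l != 1%N ->
  spanned (fun N' s' => p * N + l * s < p * N' + l * s')%N
    (mono N s - mono (N + l * (s %/ p)) (s %% p)).
Proof.
move=> l1; have [n] := ubnP s; elim: n => // n IH in N s *.
move=> sn; have [sp|ps] := ltnP s p.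
  by rewrite divn_small // modn_small // muln0 addn0 subrr; apply: spanned0.
rewrite {1}mono_rel // addrAC; apply: spannedD.
  have := IH (N + l)%N (s - p)%N.
  have -> : (p * (N + l) + l * (s - p) = p * N + l * s)%N by nia.
  have -> : ((s - p) %% p = s %% p)%N by rewrite -{2}(subnK ps) modnDr.
  have -> : (N + l + l * ((s - p) %/ p) = N + l * (s %/ p))%N.
    by rewrite -{2}(subnK ps) divnDr // divnn p0 mulnDr muln1; lia.
  by apply; lia.
rewrite big_nat_cond; apply: spanned_sum => h /andP[/andP[hj _] _].
apply: spannedZ; apply: mono_high => //.
by move: hj; rewrite /jmin (negPf l1); nia.
Qed.

(** Functions of distinct orders at x = Y = 0 are independent. *)
Lemma mono_free (J : finType) (c : J -> K) (N s : J -> nat) : l != 1%N ->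
  injective (fun t => p * N t + l * s t)%N ->
  \sum_t iota (c t) * mono (N t) (s t) = 0 -> forall t, c t = 0.
Proof.
move=> l1 inj sum0 t; apply/eqP/negPn/negP => ct.
case: (@arg_minnP _ t (fun t => c t != 0) (fun t => p * N t + l * s t)%N ct) => t0 ct0 tmin.
pose v := (p * N t0 + l * s t0)%N; pose C N' s' := (v < p * N' + l * s')%N.
have st0 : spanned C (iota (c t0) * mono (N t0) (s t0)).
  move: sum0; rewrite (bigD1 t0) //= => /eqP; rewrite addr_eq0 => /eqP->.
  apply/spannedN/spanned_sum => t1 ne; have [->|ct1] := eqVneq (c t1) 0.
    by rewrite rmorph0 mul0r; apply: spanned0.
  apply/spannedZ/mono_high => //; rewrite ltn_neqAle tmin // andbT.
  by rewrite eq_sym; apply: contra ne => /eqP/inj->.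
have /spannedN h := spannedZ (c t0) (mono_lead (N t0) (s t0) l1).
have := spannedD st0 h; rewrite -mulrN -mulrDr opprB addrC subrK => h'.
move/eqP: ct0; apply; apply: spanned_notin h'; first by rewrite ltn_mod.
by rewrite /C -leqNgt /v {3}(divn_eq (s t0) p) !mulnDr; lia.
Qed.

(** * Images of monomials in the canonical ring *)
Section Canonical.
Hypothesis lq : (l.+1 <= p.-1 * q)%N.
Notation r := #|index_set p q l|.
Implicit Types (i j k : 'I_r) (A : seq 'I_r).

Definition G12 (Q : {mpoly K[r]}) := G1 Q \/ G2 a Q.
Definition irow i := (p.-1 - imu i)%N.
Definition sumrow A := sumn (map irow A).

Notation pairX i j := ('X_[mnm [:: i; j]] : {mpoly K[r]}).

Lemma irowE i : (irow i + imu i = p.-1)%N.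
Proof. by rewrite /irow; have [mi _ _] := indexP i; lia. Qed.

Lemma G1_pair i j i' j' : pairsum i j = pairsum i' j' ->
  ideal_gen G12 (pairX i j - pairX i' j').
Proof.
move=> [eN emu]; apply: ideal_genG; left.
exists (mnm [:: i; j]), (mnm [:: i'; j']); split=> //.
- by rewrite /Defs.T2 mdeg_deg.
- by rewrite /Defs.T2 mdeg_deg.
by rewrite !multidegE /sumN /summu /= !addn0 eN emu.
Qed.

Lemma G2_pair i j i' j' : pairsum i' j' = (iN i + iN j + l, imu i + imu j + p)%N ->
  exists s : nat -> 'I_r * 'I_r,
    (forall h, (jmin p l <= h <= p.-1 * q)%N ->
       pairsum (s h).1 (s h).2 = (iN i + iN j + h, imu i + imu j + p.-1)%N) /\
    G12 (pairX i j - pairX i' j'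
         - \sum_(jmin p l <= h < (p.-1 * q).+1) (a ^+ p.-1)`_h *: pairX (s h).1 (s h).2).
Proof.
move=> [eN emu].
have mup : (imu i + imu j + 2 <= p)%N.
  by have := irowE i'; have := irowE j'; lia.
have /choice[s hs] : forall h, exists s : 'I_r * 'I_r, (jmin p l <= h <= p.-1 * q)%N ->
    pairsum s.1 s.2 = (iN i + iN j + h, imu i + imu j + p.-1)%N.
  move=> h; have [hh|//] := boolP (jmin p l <= h <= p.-1 * q)%N; last by exists (i, j).
  by have [i1 [j1 e]] := G2_terms p0 lp lq mup hh; exists (i1, j1).
exists s; split=> //; right.
exists (mnm [:: i; j]), (mnm [:: i'; j']), (fun h => mnm [:: (s h).1; (s h).2]); split=> //.
- by rewrite /Defs.T2 mdeg_deg.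
- by rewrite /Defs.T2 mdeg_deg.
- by rewrite !multidegE /sumN /summu /= !addn0 eN emu.
move=> h /hs[eN' emu']; split; first by rewrite /Defs.T2 mdeg_deg.
by rewrite !multidegE /sumN /summu /= !addn0 eN' emu'.
Qed.

(** Modulo G2 the difference of the two leading products is a combination of the products
    under the sum; if these are lighter than w, so is the difference. *)
Lemma G2_red (om : 'I_r -> nat) w i j i' j' :
  pairsum i' j' = (iN i + iN j + l, imu i + imu j + p)%N ->
  (forall k k' h, (jmin p l <= h)%N ->
     pairsum k k' = (iN i + iN j + h, imu i + imu j + p.-1)%N -> (om k + om k' < w)%N) ->
  red G12 om 2 w (pairX i j - pairX i' j').
Proof.
move=> e hw; have [s [hs Gs]] := G2_pair e.
rewrite -[X in red _ _ _ _ X](subrK (\sum_(jmin p l <= h < (p.-1 * q).+1) (a ^+ p.-1)`_h *: pairX (s h).1 (s h).2)).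
apply: redD; first exact/red_ideal/ideal_genG.
rewrite big_nat_cond; apply: red_sum => h /andP[hh _].
apply/redZ/red_low/lowX; rewrite ?mdeg_mnm // wt_mnm /= addn0.
by apply: (hw _ _ h); [case/andP: hh|apply: hs; lia].
Qed.

Lemma cbasisE i : cbasis a iota x X i = x ^+ iN i * Y ^+ irow i / ax ^+ p.-1.
Proof. by rewrite /cbasis /Yf exprMn !mulrA. Qed.

Lemma prod_cbasis A : \prod_(i <- A) cbasis a iota x X i =
  mono (sumN A) (sumrow A) / ax ^+ (p.-1 * deg A).
Proof.
elim: A => [|i A IH]; first by rewrite big_nil /mono muln0 !expr0 mulr1 divr1.
by rewrite big_cons IH cbasisE /mono /= mulnS !exprD mulf_div mulrACA.
Qed.

Definition phiM : {rmorphism {mpoly K[r]} -> {poly F}} :=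
  mmap (polyC \o iota) (fun i => cbasis a iota x X i *: 'X).

Lemma phiME P : phi a iota x X P = phiM P. Proof. by []. Qed.

Lemma phiX A : phi a iota x X 'X_[mnm A] =
  (mono (sumN A) (sumrow A) / ax ^+ (p.-1 * deg A)) *: 'X^(deg A).
Proof.
rewrite phiME -prod_cbasis.
elim: A => [|i A IH]; first by rewrite mnm_nil mpolyX0 rmorph1 big_nil scale1r.
rewrite mnm_cons mpolyXD rmorphM IH big_cons /phiM /= mmapX mmap1U exprS.
by rewrite -scalerAl -scalerAr scalerA.
Qed.

Lemma phiZ c (P : {mpoly K[r]}) : phi a iota x X (c *: P) = iota c *: phi a iota x X P.
Proof. by rewrite phiME /phiM /= mmapZ mul_polyC. Qed.

Lemma sum_irow A : (sumrow A + summu A = p.-1 * deg A)%N.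
Proof.
rewrite /summu /sumrow /deg; elim: A => [|j A IH] /=; first by rewrite muln0.
by rewrite mulnS -IH -(irowE j) addnACA.
Qed.

(** Both kinds of generators map to 0: G1 because the image depends on the multidegree
    only, G2 by [mono_rel]. *)
Lemma phi_ideal P : ideal_gen G12 P -> phi a iota x X P = 0.
Proof.
move=> [n [c [h [Gh ->]]]]; rewrite phiME rmorph_sum big1 // => i _.
rewrite rmorphM -!phiME /=.
suff -> : phi a iota x X (h i) = 0 by rewrite mulr0.
case: (Gh i) => [[t1 [t2 [T1 T2 e ->]]]|[t [t' [s [T1 T2 e hs ->]]]]].
  have [A1 E1] : exists A, mnm A = t1 :> 'X_{1..r} := mnm_surj t1; have [A2 E2] : exists A, mnm A = t2 :> 'X_{1..r} := mnm_surj t2; subst t1 t2.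
  move: e; rewrite !multidegE => -[sE NE muE].
  have muE' : sumrow A1 = sumrow A2.
    by have := sum_irow A1; have := sum_irow A2; rewrite muE sE; lia.
  by rewrite phiME rmorphB -!phiME !phiX sE NE muE' subrr.
have [A E] : exists A, mnm A = t :> 'X_{1..r} := mnm_surj t; have [A' E'] := mnm_surj t'; subst t t'.
have rowA := sum_irow A; have rowA' := sum_irow A'.
move: e T1; rewrite !multidegE /Defs.T2 mdeg_deg => -[sE NE muE] s2.
have s2' : deg A' = 2%N by rewrite sE s2.
have {}NE : sumN A' = (sumN A + l)%N := NE.
have {}muE : summu A' = (summu A + p)%N := muE.
rewrite phiME !rmorphB rmorph_sum -!phiME !phiX s2 s2' NE /=.
set D := ax ^+ _.
rewrite (@mono_rel _ (sumrow A)); last by lia.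
have -> : (sumrow A - p = sumrow A')%N by lia.
rewrite mulrDl scalerDl (addrC (_ *: _)) addrK mulr_suml scaler_suml -sumrB big1_seq // => h' /andP[_].
rewrite mem_index_iota ltnS => /hs[Th eh].
have [B EB] : exists A, mnm A = (s h') :> 'X_{1..r} := mnm_surj (s h'); rewrite -EB in Th eh *.
move: eh Th; rewrite !multidegE /Defs.T2 mdeg_deg => -[_ NB muB] sB.
have rowB := sum_irow B.
have {}NB : sumN B = (sumN A + h')%N := NB.
have {}muB : summu B = (summu A + p.-1)%N := muB.
rewrite -phiME phiZ phiX sB NB -/D.
have -> : sumrow B = (sumrow A - p.-1)%N by lia.
by rewrite scalerA mulrA subrr.
Qed.

Definition monot (t : 'X_{1..r}) := mono (wt (@iN p q l) t) (wt irow t).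

Lemma phi_monomial (t : 'X_{1..r}) :
  phi a iota x X 'X_[t] = (monot t / ax ^+ (p.-1 * mdeg t)) *: 'X^(mdeg t).
Proof.
have [A <-] : exists A : seq 'I_r, mnm A = t by apply: mnm_surj.
by rewrite phiX /monot !wt_mnm mdeg_mnm.
Qed.

Lemma phi_homog d (P : {mpoly K[r]}) : (forall t, P@_t != 0 -> mdeg t = d) ->
  phi a iota x X P = ((\sum_(t <- msupp P) iota P@_t * monot t) / ax ^+ (p.-1 * d)) *: 'X^d.
Proof.
move=> hP; rewrite {1}[P]mpolyE phiME rmorph_sum mulr_suml scaler_suml big_seq [RHS]big_seq.
apply: eq_bigr => t; rewrite mcoeff_msupp => /hP dt.
by rewrite -phiME phiZ phi_monomial dt scalerA mulrA.
Qed.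

(** In degree d, division by the common power of a(x) turns a relation between images
    into one between monomials in x and Y. *)
Lemma phi_lead (C : nat -> nat -> bool) d (t : 'X_{1..r}) (Q : {mpoly K[r]}) c : mdeg t = d ->
  (forall t', Q@_t' != 0 -> mdeg t' = d /\ spanned C (monot t')) ->
  phi a iota x X (c *: 'X_[t] + Q) = 0 -> spanned C (iota c * monot t).
Proof.
move=> dt hQ; rewrite phiME rmorphD -!phiME phiZ phi_monomial dt.
rewrite (phi_homog (fun t' h => (hQ t' h).1)) scalerA mulrA -scalerDl -mulrDl => /eqP.
rewrite scaler_eq0 -size_poly_eq0 size_polyXn orbF mulf_eq0 invr_eq0 expf_eq0 (negPf ax_neq0) andbF orbF.
rewrite addr_eq0 => /eqP->; apply/spannedN; rewrite big_seq; apply: spanned_sum => t'.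
by rewrite mcoeff_msupp => /hQ[_ st']; apply: spannedZ.
Qed.

Lemma phi_component d (P : {mpoly K[r]}) : phi a iota x X P = 0 ->
  phi a iota x X (\sum_(t <- msupp P | mdeg t == d) P@_t *: 'X_[t]) = 0.
Proof.
move=> P0; transitivity ((phi a iota x X P)`_d *: 'X^d); last by rewrite P0 coef0 scale0r.
rewrite [in RHS](mpolyE P) !phiME !rmorph_sum /= coef_sum scaler_suml.
rewrite [RHS](bigID (fun t => mdeg t == d)) /= [X in _ = _ + X]big1 ?addr0 => [|t td].
  apply: eq_bigr => t /eqP td; rewrite -phiME phiZ phi_monomial td.
  by rewrite scalerA coefZ coefXn eqxx mulr1.
by rewrite -phiME phiZ phi_monomial scalerA coefZ coefXn eq_sym (negPf td) mulr0 scale0r.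
Qed.

(** The image of P has the images of its homogeneous components as coefficients. *)
Lemma ideal_of_components (P : {mpoly K[r]}) :
  (forall d (Q : {mpoly K[r]}), (forall t, Q@_t != 0 -> mdeg t = d) ->
     phi a iota x X Q = 0 -> ideal_gen G12 Q) ->
  phi a iota x X P = 0 -> ideal_gen G12 P.
Proof.
move=> hd P0.
have -> : P = \sum_(d < msize P) \sum_(t <- msupp P | mdeg t == d) P@_t *: 'X_[t].
  rewrite (exchange_big_dep xpredT) //= {1}[P]mpolyE big_seq [RHS]big_seq.
  apply: eq_bigr => t tP; have td := msize_mdeg_lt tP.
  by rewrite (big_pred1 (Ordinal td)).
apply: (big_ind (ideal_gen G12)) => [||d _]; [exact: ideal_gen0|exact: ideal_genD|].
apply: (hd d); last exact: phi_component.
move=> t; apply: contraNeq => td; rewrite raddf_sum big1 // => t' /eqP dt'.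
rewrite /= mcoeffZ mcoeffX; case: (eqVneq t' t) => [e|]; last by rewrite mulr0.
by rewrite -e dt' eqxx in td.
Qed.

(** * The kernel for l different from 1 *)
Section WeightCore.
Variable m : nat.
Hypotheses (m_eq : (m + l = p * q)%N) (coPm : coprime p m) (l1 : l != 1%N).
Hypothesis pm : (p + m < p * m)%N.
Hypothesis conn : forall s1 s2, {in s1, forall y, W p m y} -> {in s2, forall y, W p m y} ->
  size s1 = size s2 -> sumn s1 = sumn s2 -> swaps (swapW p m) s1 s2.
Local Open Scope nat_scope.

(** Up to a constant, - (p N + l s); see [hwE]. In this form it is visibly an element of
    the semigroup generated by p and m. *)
Definition hw i := p * (q * imu i - 2 - iN i) + m * irow i.

Lemma hwE i : hw i + p * iN i + l * irow i = p * (q * p.-1 - 2).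
Proof.
have [mi hi Hi] := indexP i; rewrite /hw -(irowE i).
have [e eE] : exists e, imu i * q = iN i + 2 + e by exists (imu i * q - iN i - 2); lia.
have -> : q * imu i - 2 - iN i = e by lia.
have -> : q * (irow i + imu i) - 2 = q * irow i + iN i + e by rewrite mulnDr; lia.
have : m * irow i + l * irow i = p * q * irow i by rewrite -mulnDl m_eq.
by rewrite !mulnDr mulnA; lia.
Qed.

Lemma hw_W i : W p m (hw i).
Proof.
have [mi hi Hi] := indexP i; split.
  by exists (q * imu i - 2 - iN i), (irow i); rewrite /hw; lia.
have lt : imu i * l < p * (iN i).+1 by rewrite [p * _]mulnC -ltn_divLR.
have E := hwE i; have Es := irowE i.
have pE : p * m - p - m = m * p.-1 - p by have [p' ->] : exists p', p = p'.+1 by [exists p.-1; lia]; rewrite /= mulSn mulnC; lia.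
rewrite /canon /frob pE -Es.
have [e eE] : exists e, imu i * q = iN i + 2 + e by exists (imu i * q - iN i - 2); lia.
have hE : hw i = p * e + m * irow i by rewrite /hw; congr (p * _ + _); lia.
have : p * (imu i * q) = m * imu i + l * imu i by rewrite mulnCA -m_eq; lia.
rewrite eE hE !mulnDr; lia.
Qed.

Lemma hw_surj y : W p m y -> exists i, hw i = y.
Proof.
move=> [[n [s yE]] yle]; have {}yle : p + m + y < p * m by rewrite /canon /frob in yle; lia.
have sp : s.+1 < p by rewrite -(@ltn_pmul2r m) ?mulSn; lia.
pose mu := p.-1 - s.
have bound : p * n.+1 + mu * l < p * (mu * q).
  have -> : p * (mu * q) = mu * m + mu * l by rewrite mulnCA -m_eq mulnDr.
  have : mu * m + s * m + m = p * m by rewrite -!mulnDl -mulSnr; congr (_ * _); rewrite /mu; lia.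
  by rewrite mulnS mulnC yE in yle *; lia.
have nq : n.+2 <= mu * q by rewrite -(@ltn_pmul2l p) //; lia.
have [|||i [iNE imuE]] := @index_ex p q l (mu * q - 2 - n) mu; rewrite ?/mu; try lia.
  rewrite -ltnS ltn_divLR // mulnC.
  have -> : (mu * q - 2 - n).+1 = mu * q - n.+1 by lia.
  by rewrite mulnBr; lia.
exists i; rewrite /hw /irow iNE imuE yE.
have -> : p.-1 - mu = s by rewrite /mu; lia.
have -> : q * mu - 2 - (mu * q - 2 - n) = n by lia.
by lia.
Qed.

Lemma coprime_pl : coprime p l.
Proof.
rewrite /coprime -dvdn1 -(eqP coPm) dvdn_gcd dvdn_gcdl /=.
by rewrite -(dvdn_addl m (dvdn_gcdr p l)) m_eq dvdn_mulr // dvdn_gcdl.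
Qed.

(** As p and l are coprime, s is determined mod p by p N + l s. *)
Lemma row_shift N s N' s' : s' <= s -> p * N + l * s = p * N' + l * s' ->
  exists u : nat, s = s' + u * p /\ N' = N + u * l.
Proof.
move=> ss e; have : p %| l * (s - s').
  by apply/dvdnP; exists (N' - N); rewrite mulnBr mulnBl; lia.
rewrite Gauss_dvdr ?coprime_pl // => /dvdnP[k sE].
have {}sE : s = s' + k * p by lia.
exists k; split=> //; apply/eqP; rewrite -(eqn_pmul2l p0).
by move: e; rewrite sE !mulnDr; lia.
Qed.

Lemma hw_inj : injective hw.
Proof.
move=> i j eh; have Ei := hwE i; have Ej := hwE j; have ri := irowE i; have rj := irowE j.
have [mi _ _] := indexP i; have [mj _ _] := indexP j.
have lin : p * iN i + l * irow i = p * iN j + l * irow j by lia.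
have re : irow i = irow j.
  have [le|/ltnW le] := leqP (irow i) (irow j).
    by have [[|k] [sE _]] := row_shift le (esym lin); lia.
  by have [[|k] [sE _]] := row_shift le lin; lia.
have Ne : iN i = iN j by move: lin; rewrite re => /addIn/eqP; rewrite eqn_pmul2l // => /eqP.
have mue : imu i = imu j by lia.
exact: index_inj.
Qed.

(** A shift by (0, h, p - 1) changes p N + l s by p h - l (p - 1), which is positive. *)
Lemma hw_lt i j k k' h : p.-1 <= h ->
  pairsum k k' = (iN i + iN j + h, imu i + imu j + p.-1) -> hw k + hw k' < hw i + hw j.
Proof.
move=> hh [eN emu].
have := (hwE i); have := (hwE j); have := (hwE k); have := (hwE k').
have := irowE i; have := irowE j; have := irowE k; have := irowE k'.
move=> rk' rk rj ri Ek' Ek Ej Ei.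
have rE : irow i + irow j = irow k + irow k' + p.-1 by lia.
have lE : l * irow i + l * irow j = l * irow k + l * irow k' + l * p.-1 by rewrite -!mulnDr rE.
have NE : p * iN k + p * iN k' = p * iN i + p * iN j + p * h by rewrite -!mulnDr eN.
have : l * p.-1 < p * h.
  have pp := leq_mul (leqnn p) hh; have : l * p.-1 < p * p.-1 by rewrite ltn_pmul2r; lia.
  by lia.
by lia.
Qed.

(** Two products of equal weight differ by a shift (0, k l, k p) of the multidegree with k
    = 0 or 1 up to sign, as sums of two exponents s are less than 2 p - 1: the case of G1,
    respectively of G2. *)
Lemma hw_red i j i' j' : hw i + hw j = hw i' + hw j' ->
  red G12 hw 2 (hw i + hw j) (pairX i j - pairX i' j')%R.
Proof.
wlog le : i j i' j' / irow i' + irow j' <= irow i + irow j => [hwlog|] eh.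
  have [le|/ltnW le] := leqP (irow i' + irow j') (irow i + irow j); first exact: hwlog.
  rewrite -[X in red _ _ _ _ X]opprB -scaleN1r eh; apply: redZ.
  exact: hwlog le (esym eh).
have [Ei Ej Ei' Ej'] := And4 (hwE i) (hwE j) (hwE i') (hwE j').
have [ri rj ri' rj'] := And4 (irowE i) (irowE j) (irowE i') (irowE j').
have [k [sE NE]] := @row_shift (iN i + iN j) _ (iN i' + iN j') _ le ltac:(by rewrite !mulnDr; lia).
have [mi hi Hi] := indexP i; have [mj hj Hj] := indexP j.
case: k sE NE => [|[|k]] sE NE; last by rewrite !mulSn in sE; lia.
  by apply/red_ideal/G1_pair; rewrite /pairsum; congr (_, _); lia.
apply: G2_red; first by rewrite /pairsum; congr (_, _); lia.
by move=> k k' h; rewrite /jmin (negPf l1) => hh /hw_lt; apply.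
Qed.

Lemma wt_hwE (t : 'X_{1..r}) :
  wt hw t + p * wt (@iN p q l) t + l * wt irow t = p * (q * p.-1 - 2) * mdeg t.
Proof.
rewrite /wt mpoly.mdegE !big_distrr /= -!big_split /=; apply: eq_bigr => i _.
by rewrite -(hwE i); lia.
Qed.

Theorem canonical_ideal_weight (P : {mpoly K[r]}) :
  phi a iota x X P = 0%R -> ideal_gen G12 P.
Proof.
apply: ideal_of_components => d {}P hP.
apply: (ideal_of_reduction (om := hw) (phi := phiM) phi_ideal) hP => w; right; split.
  move=> t t' dt dt' wt_t wt_t'.
  have [A AE] : exists A : seq 'I_r, mnm A = t by apply: mnm_surj.
  have [A' AE'] : exists A : seq 'I_r, mnm A = t' by apply: mnm_surj.
  have /choice[f fP] : forall y, exists i, W p m y -> hw i = y.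
    move=> y; have [wy|nwy] := pselect (W p m y); first by have [i <-] := hw_surj wy; exists i.
    have [i _] : exists i, hw i = 0.
      by apply: hw_surj; split=> //; exists 0, 0.
    by exists i.
  have fhw B : map f (map hw B) = B.
    by rewrite -map_comp map_id_in // => i _ /=; apply: hw_inj; rewrite fP //; apply: hw_W.
  have wB B : {in map hw B, forall y, W p m y} by move=> _ /mapP[i _ ->]; apply: hw_W.
  rewrite -AE -AE' !mdeg_mnm !wt_mnm in dt dt' wt_t wt_t'.
  have s := conn (wB A) (wB A') ltac:(by rewrite !size_map dt dt') ltac:(by rewrite wt_t wt_t').
  have hf y1 y2 y1' y2' : swapW p m y1 y2 y1' y2' ->
      hw (f y1) + hw (f y2) = hw (f y1') + hw (f y2') /\
      red G12 hw 2 (hw (f y1) + hw (f y2)) (pairX (f y1) (f y2) - pairX (f y1') (f y2'))%R.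
    move=> [w1 w2 w1' w2' e]; have eh : hw (f y1) + hw (f y2) = hw (f y1') + hw (f y2') by rewrite !fP.
    by split=> //; apply: hw_red.
  by have [_ _] := swaps_red hf s; rewrite !fhw -AE -AE' wt_t dt.
move=> t Q c dt wt_t lQ phi0.
have E := wt_hwE t; rewrite wt_t dt in E.
pose v := p * wt (@iN p q l) t + l * wt irow t.
pose C N' s' := v < p * N' + l * s'.
have lead := mono_lead (wt (@iN p q l) t) (wt irow t) l1.
have := @phi_lead C d t Q c dt _ phi0.
rewrite -[monot t](subrK (mono (wt (@iN p q l) t + l * (wt irow t %/ p)) (wt irow t %% p))) mulrDr.
have sQ t' : (Q@_t' != 0)%R -> mdeg t' = d /\ spanned C (monot t').
  move=> /lQ[dt' wt_t']; split=> //; apply: mono_high => //.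
  by have E' := wt_hwE t'; rewrite dt' in E'; rewrite /v; lia.
move=> /(_ sQ) h.
apply: (@spanned_notin C c (wt (@iN p q l) t + l * (wt irow t %/ p)) (wt irow t %% p)).
- by rewrite ltn_mod.
- by rewrite /C /v -leqNgt {3}(divn_eq (wt irow t) p) !mulnDr; lia.
have /spannedN h' := spannedZ c lead.
by have := spannedD h h'; rewrite -/C addrAC subrr add0r.
Qed.

End WeightCore.

(** * The kernel for l equal to 1 *)
Section LinearCore.
Local Open Scope nat_scope.
Hypotheses (l1 : l = 1) (p5 : 4 < p) (p6 : q = 1 -> 5 < p).

(** With n = q mu - 2 - N, the conditions on an index become n >= 0, n + q s <= colmax (that
    is N >= 0, as [mu l / p] = 0 for l = 1) and q (p - 1 - s) >= 2. *)
Definition rowmax := if q == 1 then p - 3 else p - 2.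
Definition colmax := q * p.-1 - 2.
Definition point i := (q * imu i - 2 - iN i, irow i).

Lemma rowmax_col : q * rowmax <= colmax.
Proof.
rewrite /rowmax /colmax; case: eqP => [->|q1]; first by lia.
have -> : p.-1 = (p - 2).+1 by lia.
by rewrite mulnS; lia.
Qed.

Lemma rowmax_half : p <= 2 * rowmax.
Proof. by rewrite /rowmax; case: eqP => [/p6|]; lia. Qed.

Lemma pointE i : (point i).1 + iN i + q * irow i = colmax.
Proof.
have [mi hi Hi] := indexP i; have ri := irowE i; rewrite /point /colmax -ri mulnDr /=.
by rewrite mulnC in Hi; lia.
Qed.

Lemma point_valid i : valid q rowmax colmax (point i).
Proof.
have [mi hi Hi] := indexP i; have pE := pointE i; have ri := irowE i.
rewrite /valid /=; apply/andP; split; first by move: pE; rewrite /=; lia.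
rewrite /rowmax; case: eqP => [q1|_]; last by lia.
have : imu i * q = imu i by rewrite [X in _ * X]q1 muln1.
by lia.
Qed.

Lemma point_surj u : valid q rowmax colmax u -> exists i, point i = u.
Proof.
case: u => n s /andP[/= nC sS].
have sp : s <= p - 2 by move: sS; rewrite /rowmax; case: eqP; lia.
pose mu := p.-1 - s.
have muE : q * mu + q * s = q * p.-1 by rewrite -mulnDr; congr (_ * _); rewrite /mu; lia.
have nmu : n + 2 <= q * mu.
  have : 2 <= q * mu.
    move: sS; rewrite /rowmax; case: eqP => [->|q1] sS; first by rewrite /mu; lia.
    by have := @leq_mul 2 1 q mu; rewrite muln1; apply; rewrite /mu; lia.
  by rewrite /colmax in nC; lia.
have [|||i [iNE imuE]] := @index_ex p q l (q * mu - 2 - n) mu.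
- by rewrite /mu; lia.
- by rewrite floor1 //; rewrite /mu; lia.
- by rewrite mulnC; lia.
exists i; rewrite /point /irow iNE imuE; congr (_, _); [by lia|by rewrite /mu; lia].
Qed.

Lemma point_inj : injective point.
Proof.
move=> i j e; have := congr1 fst e; have := congr1 snd e => /= re ne.
have := (pointE i); have := (pointE j); rewrite e -{1}re => Ej Ei.
have Ne : iN i = iN j by move: Ei; rewrite re; lia.
have mue : imu i = imu j by have := irowE i; have := irowE j; rewrite re; lia.
exact: index_inj.
Qed.

Lemma G1_point i j i' j' :
  (point i).1 + (point j).1 = (point i').1 + (point j').1 ->
  (point i).2 + (point j).2 = (point i').2 + (point j').2 ->
  pairsum i j = pairsum i' j'.
Proof.
move=> e1 e2; have [Ei Ej Ei' Ej'] := And4 (pointE i) (pointE j) (pointE i') (pointE j').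
have [ri rj ri' rj'] := And4 (irowE i) (irowE j) (irowE i') (irowE j').
have : q * irow i + q * irow j = q * irow i' + q * irow j' by rewrite -!mulnDr; congr (_ * _).
by move: e2; rewrite /pairsum /= => e2 qe; congr (_, _); lia.
Qed.

Theorem canonical_ideal_linear (P : {mpoly K[r]}) :
  phi a iota x X P = 0%R -> ideal_gen G12 P.
Proof.
apply: ideal_of_components => d {}P hP.
(* B exceeds every sum of d values of N, so that this weight orders by the exponent of Y first. *)
pose B := (d * (p * q)).+1; pose om i := B * irow i + iN i.
have wtE (t : 'X_{1..r}) : wt om t = B * wt irow t + wt (@iN p q l) t.
  by rewrite /wt big_distrr /= -big_split /=; apply: eq_bigr => i _; rewrite /om; lia.
have iN_lt i : iN i < p * q by rewrite /iN ltn_ord.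
have N_lt (t : 'X_{1..r}) : mdeg t = d -> wt (@iN p q l) t < B.
  move=> dt; rewrite ltnS -dt mpoly.mdegE /wt big_distrl /=.
  by apply: leq_sum => i _; rewrite leq_mul2l ltnW ?orbT.
have coords (t : 'X_{1..r}) : mdeg t = d ->
    wt irow t = wt om t %/ B /\ wt (@iN p q l) t = wt om t %% B.
  move=> dt; rewrite wtE [B * _]mulnC divnMDl // modnMDl.
  by rewrite divn_small ?modn_small ?addn0 // N_lt.
have /choice[f fP] : forall u, exists i, valid q rowmax colmax u -> point i = u.
  move=> u; have [vu|nvu] := boolP (valid q rowmax colmax u).
    by have [i <-] := point_surj vu; exists i.
  have [i _] : exists i, point i = (0, 0).
    by apply: point_surj; rewrite /valid /=; have := rowmax_col; lia.
  by exists i.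
have fpt A : map f (map point A) = A.
  rewrite -map_comp map_id_in // => i _ /=; apply: point_inj; rewrite fP //.
  exact: point_valid.
have vpt A : all (valid q rowmax colmax) (map point A).
  by apply/allP => _ /mapP[i _ ->]; apply: point_valid.
have frow u : valid q rowmax colmax u -> irow (f u) = u.2 by move=> vu; have /= := congr1 snd (fP u vu).
have hf u v u' v' : swapL q rowmax colmax u v u' v' ->
    om (f u) + om (f v) = om (f u') + om (f v') /\
    red G12 om 2 (om (f u) + om (f v)) (pairX (f u) (f v) - pairX (f u') (f v'))%R.
  move=> [[vu vv vu' vv'] [e1 e2]].
  have ps : pairsum (f u) (f v) = pairsum (f u') (f v') by apply: G1_point; rewrite !fP.
  split; last by apply/red_ideal/G1_pair.
  have re : irow (f u) + irow (f v) = irow (f u') + irow (f v').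
    by rewrite !frow.
  have : B * irow (f u) + B * irow (f v) = B * irow (f u') + B * irow (f v') by rewrite -!mulnDr re.
  by case: ps => Ne _; rewrite /om; lia.
apply: (ideal_of_reduction (om := om) (phi := phiM) phi_ideal) hP => w.
(* w %/ B is the exponent of Y for all monomials of degree d and weight w. *)
have [tall|short] := leqP p (w %/ B); [left|right].
  move=> t dt wt_t; have [rowt _] := coords t dt; rewrite wt_t in rowt.
  have [A AE] : exists A : seq 'I_r, mnm A = t by apply: mnm_surj.
  have A2 : 1 < size A.
    have rowA : p <= sumn (map irow A) by rewrite -wt_mnm AE rowt.
    have rlt i : irow i < p by rewrite /irow; lia.
    case: (A) rowA => [|i [|j A']] //=; first by lia.
    by rewrite addn0 leqNgt rlt.
  have sumpt : p <= sumn (map snd (map point A)) by rewrite -map_comp -wt_mnm AE rowt.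
  have [|u [v [X' [sX uv]]]] := @tall_pair q rowmax colmax rowmax_col p _ (vpt A) _ rowmax_half sumpt.
    by rewrite size_map.
  have [szX _ _ vX'] := swapL_inv sX.
  move: vX'; rewrite vpt /= => /esym/and3P[vu vv vX'].
  have [sz wE redX] := swaps_red hf sX.
  rewrite fpt in sz wE redX.
  have dA : size A = d by rewrite -dt -AE mdeg_mnm.
  have wA : sumn (map om A) = w by rewrite -wt_t -AE wt_mnm.
  rewrite dA wA AE in redX; rewrite dA in sz; rewrite wA in wE.
  rewrite -[X in red _ _ _ _ X](subrK 'X_[mnm (map f [:: u, v & X'])])%R; apply: redD => //.
  set i := f u; set j := f v; set A' := map f X'.
  rewrite -[map f _]/([:: i; j] ++ A') mnm_cat mpolyXD mulrC.
  have -> : d = mdeg (mnm A') + 2 by rewrite mdeg_mnm sz addn2.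
  have -> : w = wt om (mnm A') + (om i + om j) by rewrite wt_mnm wE /= addnA addnC.
  apply: redMX.
  have rowij : p <= irow i + irow j by rewrite !frow.
  have mup : imu i + imu j + 2 <= p by have := irowE i; have := irowE j; lia.
  have drop k k' e : 0 < e -> irow k + irow k' + e = irow i + irow j -> om k + om k' < om i + om j.
    move=> e0 re; have : B * irow k + B * irow k' + B * e = B * irow i + B * irow j.
      by rewrite -!mulnDr re.
    have : iN k + iN k' < B.
      have [Nk Nk'] := (iN_lt k, iN_lt k').
      have := leq_mul A2 (leqnn (p * q)); rewrite dA /B; move: Nk Nk'; set pq := p * q.
      by clear; lia.
    have : B <= B * e by rewrite leq_pmulr.
    by rewrite /om; clear; lia.
  have [i' [j' ps]] := G2_last p0 lp lq l1 mup.
  rewrite -[X in red _ _ _ _ X](subrK (pairX i' j'))%R; apply: redD.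
    apply: G2_red => // k k' h _ [_ emu]; apply: (drop k k' p.-1); first by lia.
    have [ri rj rk rk'] := And4 (irowE i) (irowE j) (irowE k) (irowE k'); move: rk rk'.
    by clear -emu ri rj; lia.
  apply/red_low/lowX; first by rewrite mdeg_mnm.
  rewrite wt_mnm /= addn0; apply: (drop i' j' p) => //; case: ps => _ emu.
  have [ri rj rk rk'] := And4 (irowE i) (irowE j) (irowE i') (irowE j'); move: rk rk'.
  by clear -emu ri rj; lia.
split.
  move=> t t' dt dt' wt_t wt_t'.
  have [rt Nt] := coords t dt; have [rt' Nt'] := coords t' dt'.
  have [A AE] : exists A : seq 'I_r, mnm A = t by apply: mnm_surj.
  have [A' AE'] : exists A : seq 'I_r, mnm A = t' by apply: mnm_surj.
  have dA : size A = d by rewrite -dt -AE mdeg_mnm.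
  have dA' : size A' = d by rewrite -dt' -AE' mdeg_mnm.
  have wA : sumn (map om A) = w by rewrite -wt_t -AE wt_mnm.
  have rows : sumn (map irow A) = sumn (map irow A').
    by rewrite -!wt_mnm AE AE' rt rt' wt_t wt_t'.
  have cols : sumn (map (@iN p q l) A) = sumn (map (@iN p q l) A').
    by rewrite -!wt_mnm AE AE' Nt Nt' wt_t wt_t'.
  have sumcol A1 : sumn (map fst (map point A1)) + sumn (map (@iN p q l) A1)
      + q * sumn (map irow A1) = colmax * size A1.
    elim: A1 => [|i A1 IH] /=; first by rewrite !muln0.
    by rewrite mulnS -IH mulnDr -(pointE i) /=; lia.
  have s : swaps (swapL q rowmax colmax) (map point A) (map point A').
    apply: linear_connected => //; first exact: rowmax_col.
    - by rewrite !size_map dA dA'.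
    - have := sumcol A; have := sumcol A'; rewrite rows cols dA dA' => <-.
      by move=> /addIn/addIn.
    - by rewrite -!map_comp.
  by have [_ _] := swaps_red hf s; rewrite !fpt dA wA AE AE'.
move=> t Q c dt wt_t lQ phi0.
have [rt Nt] := coords t dt; rewrite wt_t in rt Nt.
pose C N s := (N, s) != (w %% B, w %/ B).
apply: (@spanned_notin C c (w %% B) (w %/ B)) => //; first by rewrite /C eqxx.
rewrite -rt -Nt; apply: (@phi_lead C d t Q) => // t' /lQ[dt' wt_t']; split=> //.
have [rt' Nt'] := coords t' dt'.
apply: spanned_mono; first by rewrite rt'; apply: leq_ltn_trans short; apply/leq_div2r/ltnW.
rewrite /C rt' Nt'; apply: contraTneq wt_t' => -[e1 e2].
by rewrite (divn_eq (wt om t') B) e1 e2 -divn_eq ltnn.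
Qed.

End LinearCore.

End Canonical.
End Curve.

(** * Coverings of small degree *)
Section PowerSpan.
Variables (L F : fieldType) (iota : {rmorphism L -> F}) (y t : F) (d : nat).
Notation E := (adjoin iota [tuple y]).
Hypotheses (d0 : (0 < d)%N) (td : E (t ^+ d)).

Definition pspan z := exists2 c : 'I_d -> F, (forall i, E (c i)) & z = \sum_i c i * t ^+ i.

Lemma pspanD z1 z2 : pspan z1 -> pspan z2 -> pspan (z1 + z2).
Proof.
move=> [c1 E1 ->] [c2 E2 ->]; exists (fun i => c1 i + c2 i) => [i|]; first exact: adjoinD.
by rewrite -big_split; apply: eq_bigr => i _; rewrite mulrDl.
Qed.

Lemma adjoin0 : E 0. Proof. by rewrite -(rmorph0 iota); apply: adjoinC. Qed.
Lemma adjoin1 : E 1. Proof. by rewrite -(rmorph1 iota); apply: adjoinC. Qed.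

(** The exponent of t is reduced mod d, since t^d is in the field E. *)
Lemma pspan_pow c k : E c -> pspan (c * t ^+ k).
Proof.
move=> Ec; have kd : (k %% d < d)%N by rewrite ltn_mod.
exists (fun i => if i == Ordinal kd then c * t ^+ d ^+ (k %/ d) else 0) => [i|].
  by case: ifP => _; [apply: adjoinM => //; apply: adjoinX|apply: adjoin0].
rewrite (bigD1 (Ordinal kd)) //= eqxx big1 ?addr0 => [|i /negPf->]; last by rewrite mul0r.
by rewrite -mulrA -exprM -exprD mulnC -divn_eq.
Qed.

Lemma pspan_gen : pspan t.
Proof. by have := pspan_pow 1 adjoin1; rewrite mul1r expr1. Qed.

Lemma pspan_sum (J : Type) (s : seq J) (P : pred J) (f : J -> F) :
  (forall j, P j -> pspan (f j)) -> pspan (\sum_(j <- s | P j) f j).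
Proof.
move=> h; apply: big_ind => //; last exact: pspanD.
by rewrite -(mul0r (t ^+ 0)); apply/pspan_pow/adjoin0.
Qed.

Lemma pspan_adjoin c : E c -> pspan c.
Proof. by move=> Ec; rewrite -[c]mulr1 -(expr0 t); apply: pspan_pow. Qed.

Lemma pspanM z1 z2 : pspan z1 -> pspan z2 -> pspan (z1 * z2).
Proof.
move=> [c1 E1 ->] [c2 E2 ->]; rewrite mulr_suml; apply: pspan_sum => i _.
rewrite mulr_sumr; apply: pspan_sum => j _.
rewrite mulrACA -exprD; apply: pspan_pow; exact: adjoinM.
Qed.

End PowerSpan.

(** Over an algebraically closed field the denominators are products of linear factors. *)
Lemma adjoin1_subring (L : closedFieldType) (F : fieldType) (iota : {rmorphism L -> F}) (y : F)
    (V : F -> Prop) :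
  (forall c, V (iota c)) -> V y ->
  (forall z1 z2, V z1 -> V z2 -> V (z1 + z2)) -> (forall z1 z2, V z1 -> V z2 -> V (z1 * z2)) ->
  (forall c, V (y - iota c)^-1) -> forall z, adjoin iota [tuple y] z -> V z.
Proof.
move=> Vc Vy VD VM Vi.
have V1 : V 1 by rewrite -(rmorph1 iota).
have Vp P : V (map_poly iota P).[y].
  elim/poly_ind: P => [|P c IH]; first by rewrite rmorph0 horner0 -(rmorph0 iota).
  rewrite rmorphD rmorphM /= map_polyX map_polyC hornerD hornerMX hornerC.
  by apply: (VD); [apply: (VM)|apply: Vc].
have Vq Q : V (map_poly iota Q).[y]^-1.
  have [s ->] := closed_field_poly_normal Q.
  rewrite -mul_polyC rmorphM rmorph_prod /= map_polyC hornerM hornerC horner_prod invfM.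
  apply: (VM); first by rewrite -fmorphV.
  rewrite -prodfV; apply: (big_ind V) => [|z1 z2|c _]; [exact: V1|exact: (VM)|].
  by rewrite rmorphB /= map_polyX map_polyC hornerD hornerN hornerX hornerC; apply: (Vi).
by move=> z /adjoin1P[P [Q [_ ->]]]; apply: (VM).
Qed.

(** Denominators are cleared by multiplying with their product. *)
Lemma free_of_poly (L F : fieldType) (iota : {rmorphism L -> F}) (y : F) d (e : 'I_d -> F) :
  (forall P : 'I_d -> {poly L}, \sum_i (map_poly iota (P i)).[y] * e i = 0 ->
     forall i, (map_poly iota (P i)).[y] = 0) ->
  forall c, (forall i, adjoin iota [tuple y] (c i)) -> \sum_i c i * e i = 0 -> forall i, c i = 0.
Proof.
move=> hP c hc sum0.
have /choice[PQ hPQ] : forall i, exists PQ : {poly L} * {poly L},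
    (map_poly iota PQ.2).[y] != 0 /\ c i = (map_poly iota PQ.1).[y] / (map_poly iota PQ.2).[y].
  by move=> i; have [P [Q h]] := adjoin1P (hc i); exists (P, Q).
pose R i := (PQ i).1 * \prod_(j | j != i) (PQ j).2.
pose D := \prod_j (map_poly iota (PQ j).2).[y].
have RE i : (map_poly iota (R i)).[y] = D * c i.
  have [n0 ->] := hPQ i; rewrite /R /D rmorphM rmorph_prod hornerM horner_prod [in RHS](bigD1 i) //=.
  by rewrite [RHS]mulrC mulrA mulfVK.
move=> i; have := hP R; rewrite (eq_bigr (fun i => D * (c i * e i))) => [|j _]; last by rewrite RE mulrA.
rewrite -mulr_sumr sum0 mulr0 => /(_ erefl i)/eqP; rewrite RE mulf_eq0 => /orP[|/eqP//].
by move=> /prodf_eq0[j _]; have [/negPf->] := hPQ j.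
Qed.

Section Coverings.
Variables (L : closedFieldType) (F : fieldType) (iota : {rmorphism L -> F}) (p l : nat).
Variables (a : {poly L}) (x X : F).
Hypothesis hF : AS_function_field iota p l a x X.

Lemma covering_p : has_covering iota p.
Proof. by case: hF => _ _ hb; exists x, (fun i : 'I_p => X ^+ i). Qed.

Lemma whole_of_subring (V : F -> Prop) :
  (forall c, V (iota c)) -> V x -> V X ->
  (forall z1 z2, V z1 -> V z2 -> V (z1 + z2)) -> (forall z1 z2, V z1 -> V z2 -> V (z1 * z2)) ->
  (forall c, V (x - iota c)^-1) -> forall z, V z.
Proof.
move=> Vc Vx VX VD VM Vi.
have VE k z : V z -> V (z ^+ k).
  move=> Vz; elim: k => [|k IH]; last by rewrite exprS; apply: (VM).
  by rewrite expr0 -(rmorph1 iota).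
move=> z; case: hF => _ _ [_ span _].
have [c Ec ->] := span z I; apply: (big_ind V) => [|z1 z2|i _]; [|exact: (VD)|].
  by rewrite -(rmorph0 iota).
by apply: (VM); [apply: adjoin1_subring (Ec i)|apply: VE].
Qed.

Section OneRoot.
Hypotheses (aX : a = 'X) (lp : (0 < l < p)%N) (co : coprime p (p - l)).
Local Notation m := (p - l)%N.
Local Notation t := (x^-1).

Lemma x_neq0 : x != 0.
Proof. by case: hF => h _ _; have := h 'X; rewrite polyX_eq0 map_polyX hornerX; apply. Qed.

(** The equation of the curve in terms of t = 1/x when a(x) = x. *)
Lemma root_rel : X ^+ p - X = t ^+ m.
Proof.
case: hF => _ -> _; rewrite aX map_polyX hornerX.
have -> : p = (m + l)%N by lia.
rewrite exprD [_ ^+ (_ + _ - _)]exprVn; have -> : (m + l - l)%N = m by lia.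
by rewrite invfM mulrCA divff ?mulr1 // expf_neq0 ?x_neq0.
Qed.

(** Multiplied by a power of x, the X^k t^i become monomials in x and Y = x X, of orders
    that are distinct because p i + m k determines i < m and k for coprime p and m. *)
Lemma root_free (l1 : l != 1%N) (P : 'I_m -> {poly L}) :
  \sum_i (map_poly iota (P i)).[X] * t ^+ i = 0 -> forall i, P i = 0.
Proof.
move=> sum0; pose n := \max_i size (P i).
pose c (u : 'I_m * 'I_n) := (P u.1)`_u.2.
pose N (u : 'I_m * 'I_n) := (m + n - u.1 - u.2)%N; pose s (u : 'I_m * 'I_n) := (u.2 : nat).
have inj : injective (fun u => p * N u + l * s u)%N.
  have key (i1 i2 : 'I_m) (k1 k2 : 'I_n) : (i1 <= i2)%N ->
      (p * i1 + m * k1 = p * i2 + m * k2)%N -> i1 = i2 /\ k1 = k2.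
    move=> le e; have /dvdnP[u iu] : (m %| i2 - i1)%N.
      rewrite -(@Gauss_dvdr m p) 1?coprime_sym //; apply/dvdnP; exists (k1 - k2)%N.
      by rewrite mulnBr mulnBl; lia.
    have u0 : u = 0%N.
      have := ltn_ord i2; case: u iu => // u iu; have := leq_addr (u * (p - l)) (p - l).
      by rewrite -mulSn -iu; lia.
    have ie : i1 = i2 by apply: val_inj => /=; rewrite u0 mul0n in iu; lia.
    split=> //; apply: val_inj => /=; apply/eqP; rewrite -(@eqn_pmul2l m); last by lia.
    by rewrite ie in e; apply/eqP; lia.
  move=> [i1 k1] [i2 k2]; rewrite /N /s /= => e.
  have {}e : (p * i1 + m * k1 = p * i2 + m * k2)%N.
    have [h1 h2] := (ltn_ord i1, ltn_ord i2); have [h3 h4] := (ltn_ord k1, ltn_ord k2).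
    move: e; rewrite !mulnBr !mulnBl.
    have := leq_mul (leqnn p) (ltnW h1); have := leq_mul (leqnn p) (ltnW h2).
    have := leq_mul (leqnn p) (ltnW h3); have := leq_mul (leqnn p) (ltnW h4).
    have := leq_mul (ltnW (proj2 (andP lp))) (leqnn k1); have := leq_mul (ltnW (proj2 (andP lp))) (leqnn k2).
    by rewrite !mulnDr; lia.
  have [le|/ltnW le] := leqP i1 i2; first by have [-> ->] := key _ _ _ _ le e.
  by have [-> ->] := key _ _ _ _ le (esym e).
have p0 : (0 < p)%N by lia.
have a0 : a != 0 by rewrite aX polyX_eq0.
have asz : (size a <= 2)%N by rewrite aX size_polyX.
have ad : l != 1%N -> 'X %| a by rewrite aX dvdpp.
have x0 := x_neq0.
have /(_ _)-h := @mono_free L F iota p 1 l a x X p0 lp isT hF a0 asz ad _ c N s l1 inj.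
have szP i : (size (P i) <= n)%N by apply: leq_bigmax.
suff /h c0 : \sum_u iota (c u) * mono iota a x X (N u) (s u) = 0.
  move=> i; apply/polyP => k; rewrite coef0.
  have [nk|kn] := leqP n k; first by rewrite nth_default // (leq_trans (szP i)).
  by have := c0 (i, Ordinal kn).
transitivity (x ^+ (m + n) * \sum_i (map_poly iota (P i)).[X] * t ^+ i); last by rewrite sum0 mulr0.
rewrite mulr_sumr -(pair_bigA _ (fun (i : 'I_m) (k : 'I_n) => iota (P i)`_k * mono iota a x X (m + n - i - k) k)) /=.
apply: eq_bigr => i _.
rewrite (horner_coef_wide X (n := n)) ?size_map_poly // mulr_suml mulr_sumr.
apply: eq_bigr => k _; rewrite coef_map /mono /Yf aX map_polyX hornerX exprMn.
have -> : (m + n = m + n - i - k + k + i)%N by have := ltn_ord i; have := ltn_ord k; lia.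
have -> : (m + n - i - k + k + i - i - k = m + n - i - k)%N by lia.
rewrite [x ^+ (_ + i)]exprD [x ^+ (_ + k)]exprD exprVn.
have xi : x ^+ i != 0 by rewrite expf_neq0.
by rewrite [RHS]mulrACA mulfV // mulr1 [RHS]mulrCA -!mulrA.
Qed.

Lemma root_neq_const c : t ^+ m != iota c.
Proof.
case: hF => tr _ _; have x0 := x_neq0; have m0 : (0 < m)%N by lia.
have /tr : c *: 'X^m - 1 != 0 :> {poly L}.
  apply/eqP => /(congr1 (fun P : {poly L} => P`_0)) /eqP.
  by rewrite coefB coefZ coefXn coef1 eqxx ltn_eqF // mulr0 coef0 sub0r oppr_eq0 oner_eq0.
rewrite rmorphB rmorph1 -mul_polyC rmorphM /= map_polyC map_polyXn !(hornerD, hornerN, hornerC, hornerXn, hornerM).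
apply: contraNneq => e; by rewrite /= -e exprVn mulVf ?subrr // expf_neq0.
Qed.

(** By t^m = X^p - X, the span contains x = t^(m-1) / t^m, and 1 / (x - c) = t / (1 - c t) by
    the identity (1 - u) (1 + u + ... + u^(m-1)) = 1 - u^m for u = c t, where u^m lies in
    L(X). *)
Lemma root_span z : pspan iota X t m z.
Proof.
have x0 := x_neq0; have m0 : (0 < m)%N by lia.
have EX : adjoin iota [tuple X] X by have := adjoin_tnth iota [tuple X] ord0; rewrite tnth0.
have td : adjoin iota [tuple X] (t ^+ m).
  by rewrite -root_rel; apply: adjoinD; [apply: adjoinX|apply: adjoinN].
apply: whole_of_subring => [c|||||c].
- by apply: pspan_adjoin => //; apply: adjoinC.
- have e : x = (t ^+ m)^-1 * t ^+ m.-1.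
    by rewrite -{1}(prednK m0) exprS invfM invrK mulfVK // expf_neq0 // invr_eq0.
  by rewrite [X in pspan _ _ _ _ X]e; apply: pspan_pow => //; apply: adjoinV.
- by apply: pspan_adjoin.
- by move=> *; apply: pspanD.
- by move=> *; apply: pspanM.
have cm := root_neq_const; have [->|c0] := eqVneq c 0.
  by rewrite rmorph0 subr0; apply: pspan_gen.
have E1 : (1 - iota c * t) * \sum_(i < m) (iota c * t) ^+ i = 1 - iota c ^+ m * t ^+ m.
  by rewrite -[LHS]opprK -mulNr opprB -subrX1 opprB exprMn.
have n0 : 1 - iota c ^+ m * t ^+ m != 0.
  rewrite subr_eq0; apply: contra (cm (c ^- m)) => /eqP e.
  by rewrite fmorphV rmorphXn -[X in _ == X]mulr1 e mulKf // expf_neq0 // fmorph_eq0.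
have -> : (x - iota c)^-1 = \sum_(i < m) ((1 - iota c ^+ m * t ^+ m)^-1 * iota c ^+ i) * t ^+ i.+1.
  have -> : x - iota c = x * (1 - iota c * t) by rewrite mulrBr mulr1 mulrCA divff ?mulr1.
  have n1 : 1 - iota c * t != 0 by apply: contraNneq n0 => e; rewrite -E1 e mul0r.
  rewrite invfM.
  have -> : (1 - iota c * t)^-1 = (1 - iota c ^+ m * t ^+ m)^-1 * \sum_(i < m) (iota c * t) ^+ i.
    apply: (mulfI n1); rewrite mulrCA E1 mulfV // mulVf //.
  rewrite mulrCA !mulr_sumr; apply: eq_bigr => i _.
  by rewrite exprMn exprS -!mulrA; congr (_ * _); rewrite mulrCA.
apply: pspan_sum => // i _; apply: pspan_pow => //; apply: adjoinM; last exact/adjoinX/adjoinC.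
apply: adjoinV; apply: adjoinD; first exact: adjoin1.
by apply/adjoinN/adjoinM => //; apply/adjoinX/adjoinC.
Qed.

(** The function t = 1/x has degree m over L(X), with the equation of [root_rel]. *)
Lemma covering_root : l != 1%N -> has_covering iota m.
Proof.
move=> l1; exists X, (fun i : 'I_m => t ^+ i); split=> // [z _|]; first exact: root_span.
by apply: free_of_poly => P /(root_free l1) P0 i; rewrite P0 rmorph0 horner0.
Qed.

Lemma even_odd_free (P0 P1 : {poly L}) : P0 \Po 'X^2 + (P1 \Po 'X^2) * 'X = 0 -> P0 = 0 /\ P1 = 0.
Proof.
move=> e; split; apply/polyP => i; rewrite coef0.
  have /(congr1 (fun P : {poly L} => P`_(i * 2))) := e.
  rewrite coefD coefMX !coef_comp_poly_Xn // dvdn_mull // mulnK // coef0.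
  by case: i => [|i]; rewrite ?addr0 //=; case: ifP; rewrite ?addr0 // => /dvdnP[u]; lia.
have /(congr1 (fun P : {poly L} => P`_(i * 2).+1)) := e.
rewrite coefD coefMX !coef_comp_poly_Xn // dvdn_mull // mulnK // coef0.
by case: ifP; rewrite ?add0r // => /dvdnP[u]; lia.
Qed.

(** For m = 1 the field is L(X), of degree 2 over L(X^2); denominators X - c are made even
    by multiplication with X + c. *)
Lemma covering_rational : l != 1%N -> m = 1%N -> has_covering iota 2.
Proof.
move=> l1 m1.
have trX (P : {poly L}) : (map_poly iota P).[X] = 0 -> P = 0.
  move=> P0; have m0 : (0 < m)%N by rewrite m1.
  apply: (root_free l1 (P := fun=> P) _ (Ordinal m0)).
  by apply: big1 => i _; rewrite P0 mul0r.
have E2 : adjoin iota [tuple X ^+ 2] (X ^+ 2).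
  by have := adjoin_tnth iota [tuple X ^+ 2] ord0; rewrite tnth0.
exists (X ^+ 2), (fun i : 'I_2 => X ^+ i); split=> // [z _|].
  have [c Ec ->] := root_span z.
  apply: (pspan_sum (iota := iota) (y := X ^+ 2)) => // i _.
  have -> : i = 0%N :> nat by have := ltn_ord i; lia.
  rewrite expr0 mulr1; move: (Ec i); apply: (adjoin1_subring (V := pspan iota (X ^+ 2) X 2)) => [c'||||c'].
  - by apply: pspan_adjoin => //; apply: adjoinC.
  - exact: pspan_gen.
  - by move=> *; apply: pspanD.
  - by move=> *; apply: pspanM.
  have n0 : X ^+ 2 - iota (c' ^+ 2) != 0.
    apply/eqP => e; have /trX/eqP : (map_poly iota ('X^2 - (c' ^+ 2)%:P)).[X] = 0.
      by rewrite rmorphB /= map_polyXn map_polyC hornerD hornerN hornerXn hornerC.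
    by rewrite -size_poly_eq0 size_XnsubC.
  have -> : (X - iota c')^-1 = (X ^+ 2 - iota (c' ^+ 2))^-1 * X ^+ 1 + (X ^+ 2 - iota (c' ^+ 2))^-1 * iota c' * X ^+ 0.
    move: n0; rewrite rmorphXn subr_sqr mulf_eq0 negb_or => /andP[n1 n2].
    by rewrite expr1 mulr1 -mulrDr invfM mulfVK.
  have EV : adjoin iota [tuple X ^+ 2] (X ^+ 2 - iota (c' ^+ 2))^-1.
    by apply/adjoinV/adjoinD => //; apply/adjoinN/adjoinC.
  by apply: pspanD; apply: pspan_pow => //; apply: adjoinM => //; apply: adjoinC.
apply: free_of_poly => P; rewrite !big_ord_recl big_ord0 addr0 /= mulr1 expr1 => e.
have evE Q : (map_poly iota Q).[X ^+ 2] = (map_poly iota (Q \Po 'X^2)).[X].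
  by rewrite map_comp_poly horner_comp map_polyXn hornerXn.
have [P0 P1] : P ord0 = 0 /\ P (lift ord0 ord0) = 0.
  apply: even_odd_free; apply: trX.
  by rewrite rmorphD rmorphM /= map_polyX hornerD hornerMX -!evE.
move=> i; suff -> : P i = 0 by rewrite rmorph0 horner0.
by case: (unliftP ord0 i) => [j|] ->; rewrite ?(ord1 j).
Qed.

End OneRoot.

End Coverings.

(** * A plane quintic *)
Section Quintic.
Variables (L : closedFieldType) (F : fieldType) (iota : {rmorphism L -> F}).
Variables (theta : L) (x X : F).
Hypotheses (char5 : 5%N \in [pchar L]).
Hypothesis hF : AS_function_field iota 5 1 ('X + theta%:P) x X.

Lemma mderiv_var n (R : nzRingType) (i j : 'I_n) : ('X_i : {mpoly R[n]})^`M(j) = (i == j)%:R.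
Proof.
rewrite mderivX mnm1E; case: eqP => [->|_]; last by rewrite scale0r.
by rewrite scale1r -[X in (X - _)%MM]add0m addmK mpolyX0.
Qed.

Lemma mderiv_exp n (R : comNzRingType) (P : {mpoly R[n]}) d j :
  (P ^+ d.+1)^`M(j) = P ^+ d * P^`M(j) *+ d.+1.
Proof.
elim: d => [|d IH]; first by rewrite expr0 mul1r.
by rewrite exprS mderivM IH [in RHS]mulrSr mulrnAr mulrA -exprS [X in _ = _ + X]mulrC addrC mulrC.
Qed.

(** The homogeneous form of Z^5 - Z - t^4 + eta t, in the coordinates 1, t, Z. *)
Definition quintic (eta : L) : {mpoly L[3]} :=
  let v0 := 'X_ord0 in let v1 := 'X_(inord 1) in let v2 := 'X_(inord 2) in
  v2 ^+ 5 - v2 * v0 ^+ 4 - v1 ^+ 4 * v0 + eta *: (v1 * v0 ^+ 4).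

(** In characteristic 5 the derivative in v2 is - v0^4. At v0 = 0 the derivative in v0 is
    - v1^4, and at v0 = v1 = 0 the equation is v2^5 = 0. *)
Lemma quintic_smooth eta (v : 'I_3 -> L) : (quintic eta).@[v] = 0 ->
  (forall i, ((quintic eta)^`M(i)).@[v] = 0) -> forall i, v i = 0.
Proof.
have e5 : 5%:R = 0 :> L := pcharf0 char5.
have ne12 : inord 1 != inord 2 :> 'I_3 by rewrite -val_eqE /= !inordK.
have ne01 : ord0 != inord 1 :> 'I_3 by rewrite -val_eqE /= !inordK.
have ne02 : ord0 != inord 2 :> 'I_3 by rewrite -val_eqE /= !inordK.
move=> H0 dH; have v0 : v ord0 = 0.
  have := dH (inord 2); rewrite /quintic !(mderiv_exp, mderivD, mderivN, mderivM, mderivZ, mderiv_var).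
  rewrite eqxx (negPf ne12) (negPf ne02) /= !(mulr0n, mulr1n, mulr0, mulr1, mul0rn, addr0) !(mevalD, mevalN, mevalMn, rmorphXn, mevalM, mevalZ, mevalXU, meval1, meval0) /= !mevalXU.
  rewrite [X in X = 0 -> _](_ : _ = 5%:R * v (inord 2) ^+ 4 - v ord0 ^+ 4); last by ring.
  by rewrite e5 mul0r sub0r => /eqP; rewrite oppr_eq0 expf_eq0 /= => /eqP.
have v1 : v (inord 1) = 0.
  have := dH ord0; rewrite /quintic !(mderiv_exp, mderivD, mderivN, mderivM, mderivZ, mderiv_var).
  rewrite eqxx ![_ == ord0]eq_sym (negPf ne01) (negPf ne02) /= !(mulr0n, mulr1n, mulr0, mulr1, mul0rn, addr0) !(mevalD, mevalN, mevalMn, rmorphXn, mevalM, mevalZ, mevalXU, meval1, meval0) /= !mevalXU v0.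
  rewrite [X in X = 0 -> _](_ : _ = - v (inord 1) ^+ 4); last by ring.
  by move/eqP; rewrite oppr_eq0 expf_eq0 /= => /eqP.
have v2 : v (inord 2) = 0.
  move: H0; rewrite /quintic !(mevalD, mevalN, rmorphXn, mevalM, mevalZ) /= !mevalXU v0 v1.
  rewrite [X in X = 0 -> _](_ : _ = v (inord 2) ^+ 5); last by ring.
  by move/eqP; rewrite expf_eq0 /= => /eqP.
move=> i; have : i \in [:: ord0; inord 1; inord 2].
  by rewrite !inE -!val_eqE /= !inordK //; case: i => [[|[|[|]]]].
by rewrite !inE => /or3P[] /eqP->.
Qed.

Lemma quintic_homog eta : quintic eta \is 5.-homog.
Proof.
have hX i : ('X_i : {mpoly L[3]}) \is 1.-homog by rewrite dhomogX /= mdeg1.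
have hE i d : ('X_i : {mpoly L[3]}) ^+ d \is d.-homog.
  elim: d => [|d IH]; first by rewrite expr0 dhomog1.
  by rewrite exprS; apply: (dhomogM (d := 1%N) (e := d)).
have hM (P Q : {mpoly L[3]}) d e : P \is d.-homog -> Q \is e.-homog -> P * Q \is (d + e).-homog.
  exact: dhomogM.
apply: rpredD; last by apply: rpredZ; apply: (hM _ _ 1%N 4%N); rewrite ?hE.
apply: rpredB; last by apply: (hM _ _ 4%N 1%N); rewrite ?hE.
by apply: rpredB; [rewrite hE|apply: (hM _ _ 1%N 4%N); rewrite ?hE].
Qed.

(** Let t = 1 / (x + theta). Then x t^5 = t^4 - theta t^5, so X^5 - X = t^4 - theta t^5. The
    term with t^5 is removed by passing to Z = X + eta t with eta^5 = theta, which gives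
    Z^5 - Z = t^4 - eta t. *)
Lemma linear_pole_quintic : plane_quintic iota.
Proof.
have e5 : 5%:R = 0 :> F by rewrite -(rmorph_nat iota) (pcharf0 char5) rmorph0.
have [eta etaE] : exists eta, eta ^+ 5 = theta.
  have [eta] := @solve_monicpoly L 5%N (fun i => if i == 0%N then theta else 0) isT.
  by rewrite !big_ord_recl big_ord0 /= => e; exists eta; rewrite e; ring.
pose b := x + iota theta; pose t := b^-1; pose Z := X + iota eta * t.
case: (hF) => tr rel _.
have bE c : x + iota c != 0.
  have /tr : 'X + c%:P != 0 :> {poly L} by rewrite -size_poly_eq0 size_XaddC.
  by rewrite rmorphD /= map_polyX map_polyC hornerD hornerX hornerC.
have b0 : b != 0 by apply: bE.
have relZ : Z ^+ 5 - Z - t ^+ 4 + iota eta * t = 0.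
  have -> : Z ^+ 5 = X ^+ 5 + iota theta * t ^+ 5.
    rewrite /Z -etaE rmorphXn.
    transitivity (X ^+ 5 + iota eta ^+ 5 * t ^+ 5 + 5%:R * (X ^+ 4 * (iota eta * t) + 2%:R * X ^+ 3 * (iota eta * t) ^+ 2 + 2%:R * X ^+ 2 * (iota eta * t) ^+ 3 + X * (iota eta * t) ^+ 4)); first by ring.
    by rewrite e5 mul0r addr0.
  have : X ^+ 5 = X + x * t ^+ 5.
    by rewrite -[LHS](subrK X) rel rmorphD /= map_polyX map_polyC hornerD hornerX hornerC expr1 addrC exprVn.
  move=> ->; have -> : x = b - iota theta by rewrite addrK.
  rewrite /Z mulrBl exprS mulrA divff // mul1r; ring.
exists (quintic eta), t, Z; split.
- exact: quintic_homog.
- exact: quintic_smooth.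
  rewrite /quintic mmapD !mmapB mmapZ !(rmorphXn, rmorphM) /= !mmapX !mmap1U.
  rewrite !(tnth_nth 0) /= !inordK //= -[RHS]relZ; ring.
pose E := adjoin iota [tuple t; Z].
have Et : E t by have := adjoin_tnth iota [tuple t; Z] ord0; rewrite tnth0.
have EZ : E Z by have := adjoin_tnth iota [tuple t; Z] (lift ord0 ord0); rewrite (tnth_nth 0).
have Ex : E x.
  have -> : x = t^-1 - iota theta by rewrite invrK addrK.
  by apply: adjoinD; [apply: adjoinV|apply/adjoinN/adjoinC].
apply: (whole_of_subring hF) => [c|||||c].
- exact: adjoinC.
- exact: Ex.
- have -> : X = Z - iota eta * t by rewrite addrK.
  by apply: adjoinD => //; apply/adjoinN/adjoinM => //; apply: adjoinC.
- exact: adjoinD.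
- exact: adjoinM.
by apply/adjoinV/adjoinD => //; apply/adjoinN/adjoinC.
Qed.

End Quintic.

(** * The polynomial a(x) *)
Section DefiningPolynomial.
Variables (k : fieldType) (q l : nat).
Hypothesis q0 : (0 < q)%N.
Notation a := (apoly k q l).

Lemma nparams_le : (nparams q l <= q)%N.
Proof. by rewrite /nparams; case: ifP => _ //; apply: leq_pred. Qed.

Lemma apoly_size : (size a <= q.+1)%N.
Proof.
apply: leq_trans (size_polyD _ _) _; rewrite geq_max size_polyXn leqnn /=.
apply: leq_trans (size_sum _ _ _) _; apply/bigmax_leqP => i _.
by apply: leq_trans (size_scale_leq _ _) _; rewrite size_polyXn ltnS leq_subr.
Qed.

Lemma apoly_neq0 : a != 0.
Proof.
apply/eqP => /(congr1 (fun P : {poly _} => P`_q)).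
rewrite coefD coefXn eqxx coef_sum big1 ?addr0 => [|i _].
  by rewrite coef0 => /eqP; rewrite oner_eq0.
rewrite coefZ coefXn gtn_eqF ?mulr0 //.
by have := ltn_ord i; have := nparams_le; lia.
Qed.

Lemma polyX_dvd_sum (K : fieldType) (J : finType) (c : J -> K) d (n : J -> nat) :
  (0 < d)%N -> (forall i, 0 < n i)%N -> 'X %| 'X^d + \sum_i c i *: 'X^(n i).
Proof.
move=> d0 n0; rewrite dvdp_addr; last first.
  by rewrite -(prednK d0) exprS dvdp_mulIl.
apply: (big_ind (dvdp 'X)) => [|f h|i _]; [exact: dvdp0|exact: dvdp_add|].
by rewrite -(prednK (n0 i)) exprS scalerAr dvdp_mulIl.
Qed.

Lemma apoly_dvd : l != 1%N -> 'X %| a.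
Proof.
move=> l1; apply: polyX_dvd_sum => // i.
by have := ltn_ord i; rewrite {2}/nparams (negPf l1); lia.
Qed.

Lemma apoly_X : q = 1%N -> l != 1%N -> a = 'X.
Proof.
move=> q1 l1; rewrite /apoly big1 ?addr0 ?q1 // => i _.
by have := ltn_ord i; rewrite {2}/nparams (negPf l1).
Qed.

Lemma apoly_linear : q = 1%N -> l = 1%N -> exists theta, a = 'X + theta%:P.
Proof.
move=> q1 l1; rewrite /apoly; move: (psX k) ; rewrite /param_field.
have -> : nparams q l = 1%N by rewrite /nparams l1 q1.
by move=> c; exists (tofrac (c ord0)); rewrite big_ord1 q1 subnn expr0 alg_polyC.
Qed.

(** Coefficientwise, p kills the power series. *)
Lemma pchar_param p : p \in [pchar k] -> p \in [pchar param_field k q l].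
Proof.
move=> charp; rewrite inE (pcharf_prime charp) /=.
have coefMn (f : mpseries (nparams q l) k) n t : pscoef (f *+ n) t = pscoef f t *+ n.
  by elim: n => // n IH; rewrite !mulrS -IH.
have p0 : p%:R = 0 :> mpseries (nparams q l) k.
  by apply: psP => t; rewrite coefMn mulrn_pchar.
by have := congr1 (@tofrac _) p0; rewrite rmorph_nat rmorph0 => ->.
Qed.

End DefiningPolynomial.

(** * The canonical ideal *)

Lemma W_sym M P : W M P = W P M.
Proof.
apply: funext => y; rewrite /W /canon /frob mulnC -subnDA addnC subnDA.
by apply: propext; split=> -[[n [s ->]] ?]; split=> //; exists s, n; rewrite addnC.
Qed.

(** The generators enter symmetrically. *)
Lemma weight_connected_coprime M P : coprime M P -> (3 < M)%N -> (3 < P)%N ->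
    ~~ ((minn M P == 4) && (maxn M P == 5)) -> forall s1 s2,
  {in s1, forall y, W M P y} -> {in s2, forall y, W M P y} ->
  size s1 = size s2 -> sumn s1 = sumn s2 -> swaps (swapW M P) s1 s2.
Proof.
wlog MP : M P / (M < P)%N => [hwlog co M4 P4 not45|].
  have [MP|PM|e] := ltngtP M P; first exact: hwlog.
    have -> : swapW M P = swapW P M by rewrite /swapW W_sym.
    by rewrite W_sym; apply: hwlog; rewrite // 1?coprime_sym 1?minnC 1?maxnC.
  by move: co; rewrite e /coprime gcdnn; move: P4; case: (P) => [|[]].
move=> co M4 _ not45; apply: weight_connected => //.
by move: not45; rewrite (minn_idPl (ltnW MP)) (maxn_idPr (ltnW MP)).
Qed.

Theorem theorem26 (k : closedFieldType) (p m q l : nat)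
    (charp : p \in [pchar k])
    (m_ge1 : (1 <= m)%N) (p_ndiv_m : ~~ (p %| m)%N)
    (l_bounds : (1 <= l <= p.-1)%N) (m_eq : (m + l = p * q)%N)
    (F : fieldType) (iota : {rmorphism param_field k q l -> F}) (x X : F)
    (hF : AS_function_field iota p l (apoly k q l) x X)
    (Kbar : closedFieldType) (j : {rmorphism param_field k q l -> Kbar})
    (Kbar_alg : forall c : Kbar, algebraicOver j c)
    (Fbar : fieldType) (iotabar : {rmorphism Kbar -> Fbar}) (xbar Xbar : Fbar)
    (hFbar : AS_function_field iotabar p l (map_poly j (apoly k q l)) xbar Xbar)
    (g : nat) (hg : has_genus iotabar xbar g) (g_ge3 : (3 <= g)%N)
    (not_hyperelliptic : ~ hyperelliptic iotabar)
    (not_trigonal : ~ trigonal iotabar)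
    (not_plane_quintic : ~ plane_quintic iotabar) :
  forall P : {mpoly (param_field k q l)[#|index_set p q l|]},
    canonical_ideal (apoly k q l) iota x X P <->
    ideal_gen (fun Q => G1 Q \/ G2 (apoly k q l) Q) P.
Proof.
clear Kbar_alg hg g_ge3 m_ge1.
have pr := pcharf_prime charp; have p2 := prime_gt1 pr.
have q0 : (0 < q)%N by case: (posnP q) m_eq l_bounds => // ->; rewrite muln0; lia.
have p5 : (4 < p)%N.
  have p4 : p != 4%N by apply: contraTneq pr => ->.
  have [ph pt] : p <> 2%N /\ p <> 3%N.
    have := covering_p hFbar; split=> e.
      by apply: not_hyperelliptic; rewrite /hyperelliptic -e.
    by apply: not_trigonal; rewrite /trigonal -e.
  by lia.
have lp : (0 < l < p)%N by lia.
have coPm : coprime p m by rewrite prime_coprime.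
have a0 := apoly_neq0 k l q0; have asz := apoly_size k q l; have ad := @apoly_dvd k q l q0.
have m4 : l != 1%N -> (3 < m)%N.
  move=> l1; have [q1|q1] := eqVneq q 1%N; last first.
    have q2 : (1 < q)%N by lia.
    by have := leq_mul (leqnn p) q2; lia.
  have aX : map_poly j (apoly k q l) = 'X by rewrite apoly_X // map_polyX.
  have mE : m = (p - l)%N by rewrite q1 muln1 in m_eq; lia.
  rewrite mE in coPm *.
  have cov := covering_root hFbar aX lp coPm l1.
  have rat := covering_rational hFbar aX lp coPm l1.
  rewrite ltnNge; apply/negP => le3.
  have [e|[e|e]] : (p - l = 1 \/ p - l = 2 \/ p - l = 3)%N by lia.
  - by apply: not_hyperelliptic; apply: rat.
  - by apply: not_hyperelliptic; rewrite /hyperelliptic -e.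
  - by apply: not_trigonal; rewrite /trigonal -e.
have lq : (l < p.-1 * q)%N.
  have [l1|/m4 m4'] := eqVneq l 1%N; first by have := leq_mul (leqnn p.-1) q0; lia.
  have : (p.-1 * q + q = p * q)%N by rewrite -mulSnr prednK // ltnW.
  have [q1|q1] := eqVneq q 1%N; first by rewrite q1; lia.
  have q2 : (1 < q)%N by lia.
  by have := leq_mul (leqnn p.-1) q2; lia.
move=> P; split; last first.
  exact: (phi_ideal (ltnW p2) lp q0 hF a0 asz ad lq).
have [l1|l1] := eqVneq l 1%N.
  apply: (canonical_ideal_linear (ltnW p2) lp q0 hF a0 asz ad lq l1 p5) => q1.
  rewrite ltn_neqAle p5 andbT; apply/eqP => e.
  apply: not_plane_quintic; have [theta aE] := @apoly_linear k q l q1 l1.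
  apply: (@linear_pole_quintic _ _ _ (j theta) xbar Xbar).
    by rewrite e (fmorph_pchar j); apply: pchar_param.
  by move: hFbar; rewrite aE rmorphD /= map_polyX map_polyC -e [X in AS_function_field _ _ X _ _ _ -> _]l1.
apply: (canonical_ideal_weight (ltnW p2) lp q0 hF a0 asz ad lq m_eq coPm l1).
  by have := leq_mul p5 (leqnn m); have := leq_mul (leqnn p) (m4 l1); lia.
apply: weight_connected_coprime => //; first by rewrite ltnW.
  exact: m4.
have {}m4 := m4 l1; apply/negP => /andP[/eqP e4 /eqP e5]; move/eqP: l1; apply.
have q1 : q = 1%N.
  apply/eqP; rewrite eqn_leq q0 andbT leqNgt; apply/negP => q2.
  by have := leq_mul (leqnn p) q2; lia.
by rewrite q1 muln1 in m_eq; lia.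
Qed.
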